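(* We have $$G_{343} = 2^{1/4}p^{-1/7},$$ where $$p = 1 + \frac{10m^2}{s^{1/3}} - \frac{s^{1/3}}{6},$$ and $$s = 12m^2\left(9(7 - m^2) + \sqrt{3}\sqrt{27(m^4 + 49) + 122m^2}\right),$$ $$m = 7^{3/2}\left\{1 + \left(\frac{\cos\frac{\pi}{7}}{2\cos^2\frac{2\pi}{7}}\right)^{2/7} + \left(\frac{\cos\frac{2\pi}{7}}{2\cos^2\frac{3\pi}{7}}\right)^{2/7} + \left(\frac{\cos\frac{3\pi}{7}}{2\cos^2\frac{\pi}{7}}\right)^{2/7}\right\}^{-2}.$$
   Context: For $|q|<1$, let $\chi(q) := (-q;q^2)_\infty = \prod_{k=0}^{\infty}(1+q^{2k+1})$. For a positive rational number $n$ and $q=\exp(-\pi\sqrt{n})$, the class invariant $G_n$ is defined by $G_n := 2^{-1/4}q^{-1/24}\chi(q)$. Fractional powers of positive real numbers are the positive real ones. *)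

(* Defs.v *)
From Stdlib Require Import Reals.
From Coquelicot Require Import Coquelicot.
Open Scope R_scope.

(* [prod_f_R0 f N] has the N+1 factors f 0, ..., f N.  The partial products
   converge for |q| < 1, which is the only meaningful range of [q]. *)
Definition chi (q : R) : R :=
  real (Lim_seq (fun N => prod_f_R0 (fun k => 1 + q ^ (2 * k + 1)) N)).

(* Meaningful for n > 0.  [Rpower x y] is exp (y * ln x), the positive real
   power when x > 0. *)
Definition class_invariant (n : R) : R :=
  let q := exp (- PI * sqrt n) in
  Rpower 2 (-1/4) * Rpower q (-1/24) * chi q.

(* Main.v *)
Require Import Defs.
From Stdlib Require Import Reals Lra Lia ZArith.
From Coquelicot Require Import Coquelicot.
Open Scope R_scope.

(* With theta constants theta_i at q = exp (-c), put b = sqrt (theta_2 / theta_3) and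
   a = sqrt (theta_4 / theta_3), so that a^8 + b^8 = 1. Ramanujan's modular equation of
   degree 7 reads a a' + b b' = 1, where a', b' are taken at 7c; it follows from a
   rearrangement of a double series over the lattice Z[sqrt (-7)] and the inversion
   formula c -> pi^2 / c exchanges a and b. At c = pi / sqrt 7 this gives 2 a b = 1
   for the values at pi sqrt 7, and then at c = pi sqrt 7 a polynomial equation whose
   relevant root is unique: (a' b')(pi sqrt 343) = g^3 / 2, where g is the positive root
   of g^7 + 7 g^3 + 7 g^2 + 7 g = 1. The triple product gives
   theta_2 theta_4 / theta_3^2 = 2 q^(1/4) chi^(-6), hence G_343 = 2^(1/4) / g.
   The numbers of the statement lie in Q(g): the trigonometric sum is
   (12 + 7g + 2g^2 - 2g^3 + g^4 + g^5) / 3, and p = g^7, because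
   y = p - 1 = - 7 (g + g^2 + g^3) solves y^3 + 5 m^2 y = m^4 - 7 m^2, which is the
   equation that Cardano's formula solves in the statement. *)

(** The inversion formula is reached by Polya's finite argument: binomial coefficients along a
    residue class are summed with roots of unity, and a limit turns both sides into theta series.
    The triple product is likewise the limit of a finite product whose coefficients are q-binomial.
    Both limits, like every exchange of two infinite sums, go through Tannery's theorem.

    With k, k' the moduli at exp (- pi sqrt 343), a' b' is the fourth root of k k', and G = (2 k
    k')^(-1/12); so a' b' = g^3 / 2 is the same as G = 2^(1/4) / g.

    Identities in Q(g) are checked by [ring] modulo the equation of g. What algebra cannot decide is
    which real root is meant. This is settled by the bounds 0 < g < 1/7, by the inequality b < a,
    and by three uniqueness arguments: for the trigonometric sum, for the modular equation at pi
    sqrt 343, and for the cubic solved by Cardano's formula. *)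

(** * Dominated convergence for series *)

Lemma sum_n_nonneg (a : nat -> R) (n : nat) :
  (forall k, 0 <= a k) -> 0 <= sum_n a n.
Proof.
intro H; induction n as [|n IH]; [rewrite sum_O; auto|].
rewrite sum_Sn; apply Rplus_le_le_0_compat; auto.
Qed.

Lemma Series_nonneg (a : nat -> R) :
  ex_series a -> (forall n, 0 <= a n) -> 0 <= Series a.
Proof.
intros Ha H.
exact (is_lim_seq_le (fun _ => 0) (sum_n a) 0 (Series a)
  (fun n => sum_n_nonneg a n H) (is_lim_seq_const 0) (Series_correct _ Ha)).
Qed.

(** Beyond some K the differences [Rabs (a n k - l k)] are dominated by a small tail of [2 * M], and
    the sum of the first K + 1 of them tends to 0. Fubini, the inversion formula and the triple
    product all rest on this lemma. *)
Lemma tannery (a : nat -> nat -> R) (l M : nat -> R) :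
  ex_series M ->
  (forall n k, Rabs (a n k) <= M k) ->
  (forall k, is_lim_seq (fun n => a n k) (l k)) ->
  is_lim_seq (fun n => Series (a n)) (Series l).
Proof.
intros HM Hb Hl.
assert (Hlb : forall k, Rabs (l k) <= M k).
{ intro k.
  generalize (is_lim_seq_abs _ _ (Hl k)); intro H.
  apply (is_lim_seq_le _ (fun _ => M k) _ _ (fun n => Hb n k) H (is_lim_seq_const _)). }
assert (Ha : forall n, ex_series (fun k => Rabs (a n k))).
{ intro n; apply (ex_series_le (fun k => Rabs (a n k)) M); auto.
  intro k; unfold norm; simpl; unfold abs; simpl; rewrite Rabs_Rabsolu; auto. }
assert (HL : ex_series (fun k => Rabs (l k))).
{ apply (ex_series_le (fun k => Rabs (l k)) M); auto.
  intro k; unfold norm; simpl; unfold abs; simpl; rewrite Rabs_Rabsolu; auto. }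
set (d := fun n k => Rabs (a n k - l k)).
assert (Hd : forall n k, 0 <= d n k <= 2 * M k).
{ intros n k; unfold d; split; [apply Rabs_pos|].
  unfold Rminus; eapply Rle_trans; [apply Rabs_triang|rewrite Rabs_Ropp].
  generalize (Hb n k) (Hlb k); lra. }
assert (H2M : ex_series (fun k => 2 * M k)) by (apply (ex_series_scal 2 M HM)).
assert (Hde : forall n, ex_series (d n)).
{ intro n; apply (ex_series_le (d n) (fun k => 2 * M k)); auto.
  intro k; unfold norm; simpl; unfold abs; simpl.
  rewrite Rabs_pos_eq; apply Hd. }
assert (Hdl : is_lim_seq (fun n => Series (d n)) 0).
{ apply is_lim_seq_spec; intro eps.
  assert (HMs := Series_correct _ H2M).
  change (is_lim_seq (sum_n (fun k => 2 * M k)) (Series (fun k => 2 * M k))) in HMs.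
  apply is_lim_seq_spec in HMs.
  destruct (HMs (pos_div_2 eps)) as [K HK].
  specialize (HK K (le_n K)); simpl in HK.
  assert (Hfin : is_lim_seq (fun n => sum_n (d n) K) 0).
  { clear HK. induction K as [|K IH].
    - apply is_lim_seq_ext with (fun n => d n 0%nat).
      intro n; now rewrite sum_O.
      unfold d; rewrite <- (Rabs_R0); apply (is_lim_seq_abs _ 0).
      replace (Finite 0) with (Finite (l O - l O)) by (f_equal; ring).
      apply is_lim_seq_minus'; [apply Hl|apply is_lim_seq_const].
    - apply is_lim_seq_ext with (fun n => sum_n (d n) K + d n (S K)).
      intro n; now rewrite sum_Sn.
      replace (Finite 0) with (Finite (0+0)) by (f_equal; ring).
      apply is_lim_seq_plus'; auto.
      unfold d; rewrite <- (Rabs_R0); apply (is_lim_seq_abs _ 0).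
      replace (Finite 0) with (Finite (l (S K) - l (S K))) by (f_equal; ring).
      apply is_lim_seq_minus'; [apply Hl|apply is_lim_seq_const]. }
  apply is_lim_seq_spec in Hfin.
  destruct (Hfin (pos_div_2 eps)) as [N HN].
  exists N; intros n Hn.
  specialize (HN n Hn); simpl in HN.
  rewrite Rminus_0_r in *.
  assert (Hsplit : forall u : nat -> R, ex_series u ->
     Series u = sum_n u K + Series (fun k => u (S K + k)%nat)).
  { intros u Hu; rewrite (Series_incr_n u (S K)); [|lia|auto].
    f_equal. rewrite sum_n_Reals; reflexivity. }
  rewrite Hsplit; auto.
  assert (T1 : 0 <= Series (fun k => d n (S K + k)%nat) <= Series (fun k => 2 * M (S K + k)%nat)).
  { split.
    - apply Series_nonneg; [|intro; apply Hd].
      apply (ex_series_incr_n (d n) (S K)); auto.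
    - apply Series_le; [intro; apply Hd|].
      apply (ex_series_incr_n (fun k => 2 * M k) (S K)); auto. }
  rewrite Hsplit in HK by auto.
  apply Rabs_def2 in HK; apply Rabs_def2 in HN.
  apply Rabs_def1; lra. }
apply is_lim_seq_spec; intro eps.
apply is_lim_seq_spec in Hdl; destruct (Hdl eps) as [N HN].
exists N; intros n Hn; specialize (HN n Hn); rewrite Rminus_0_r in HN.
rewrite <- Series_minus; try (apply ex_series_Rabs; auto; fail).
eapply Rle_lt_trans; [apply Series_Rabs, Hde|].
eapply Rle_lt_trans; [apply Rle_abs|exact HN].
Qed.

(** * Sums over the integers *)

(** Equalities that come out of [sum_n] live in the carrier of a canonical structure; restated at
    type [R] they are recognised by [ring]. *)
Ltac R_eq := match goal with |- ?x = ?y => change (@eq R x y) end.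

Lemma ex_series_dominated (a b : nat -> R) :
  (forall n, Rabs (a n) <= b n) -> ex_series b -> ex_series a.
Proof. intros H Hb; exact (ex_series_le a b H Hb). Qed.

Lemma sum_n_le_Series (u : nat -> R) N :
  (forall n, 0 <= u n) -> ex_series u -> sum_n u N <= Series u.
Proof.
intros Hu Hex.
apply (is_lim_seq_incr_compare (sum_n u)).
- exact (Series_correct _ Hex).
- intro n; rewrite sum_Sn; unfold plus; simpl; generalize (Hu (S n)); lra.
Qed.

Lemma Series_double (a : nat -> R) :
  ex_series (fun n => Rabs (a n)) ->
  ex_series (fun n => Rabs (a (2 * n)%nat)) /\
  ex_series (fun n => Rabs (a (2 * n + 1)%nat)) /\
  Series a = Series (fun n => a (2 * n)%nat) + Series (fun n => a (2 * n + 1)%nat).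
Proof.
intro H.
assert (Hsum : forall (u : nat -> R) N,
  sum_n u (2 * N + 1) = sum_n (fun n => u (2 * n)%nat) N + sum_n (fun n => u (2 * n + 1)%nat) N).
{ intros u N; induction N as [|N IH].
  - simpl (2 * 0 + 1)%nat; rewrite sum_Sn, !sum_O; reflexivity.
  - replace (2 * S N + 1)%nat with (S (S (2 * N + 1))) by lia.
    rewrite !sum_Sn, IH; unfold plus; simpl plus.
    replace (S (2 * N + 1)) with (2 * S N)%nat by lia.
    replace (S (2 * S N)) with (2 * S N + 1)%nat by lia.
    unfold plus; simpl; ring. }
assert (Hmon : forall u : nat -> R, (forall n, 0 <= u n) -> forall B,
  (forall N, sum_n u N <= B) -> ex_series u).
{ intros u Hu B HB.
  destruct (ex_finite_lim_seq_incr (sum_n u) B) as [l Hl]; auto.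
  - intro n; rewrite sum_Sn; unfold plus; simpl; generalize (Hu (S n)); lra.
  - exists l; exact Hl. }
assert (He : ex_series (fun n => Rabs (a (2 * n)%nat))).
{ apply (Hmon _ (fun n => Rabs_pos _) (Series (fun n => Rabs (a n)))); intro N.
  eapply Rle_trans; [|apply (sum_n_le_Series _ (2 * N + 1) (fun n => Rabs_pos _) H)].
  rewrite Hsum.
  generalize (sum_n_nonneg (fun n => Rabs (a (2 * n + 1)%nat)) N (fun n => Rabs_pos _)); lra. }
assert (Ho : ex_series (fun n => Rabs (a (2 * n + 1)%nat))).
{ apply (Hmon _ (fun n => Rabs_pos _) (Series (fun n => Rabs (a n)))); intro N.
  eapply Rle_trans; [|apply (sum_n_le_Series _ (2 * N + 1) (fun n => Rabs_pos _) H)].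
  rewrite Hsum.
  generalize (sum_n_nonneg (fun n => Rabs (a (2 * n)%nat)) N (fun n => Rabs_pos _)); lra. }
split; [|split]; auto.
assert (L1 : is_lim_seq (fun N => sum_n a (2 * N + 1)) (Series a)).
{ apply (is_lim_seq_subseq (sum_n a) (Series a) (fun N => 2 * N + 1)%nat).
  - apply eventually_subseq; intro n; lia.
  - apply Series_correct, ex_series_Rabs, H. }
assert (L2 : is_lim_seq (fun N => sum_n a (2 * N + 1))
  (Series (fun n => a (2 * n)%nat) + Series (fun n => a (2 * n + 1)%nat))).
{ apply is_lim_seq_ext with (1 := fun N => eq_sym (Hsum a N)).
  apply is_lim_seq_plus'; apply Series_correct, ex_series_Rabs; auto. }
apply is_lim_seq_unique in L1; apply is_lim_seq_unique in L2.
rewrite L1 in L2; now injection L2.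
Qed.

Lemma sum_n_Series_swap (a : nat -> nat -> R) (N : nat) :
  (forall i, ex_series (a i)) ->
  ex_series (fun j => sum_n (fun i => a i j) N) /\
  sum_n (fun i => Series (a i)) N = Series (fun j => sum_n (fun i => a i j) N).
Proof.
intro H; induction N as [|N [IH1 IH2]].
- split.
  + apply ex_series_ext with (a O); auto. intro j; now rewrite sum_O.
  + rewrite sum_O; apply Series_ext; intro j; now rewrite sum_O.
- assert (E : forall j, sum_n (fun i => a i j) N + a (S N) j = sum_n (fun i => a i j) (S N)).
  { intro j; now rewrite sum_Sn. }
  split.
  + apply ex_series_ext with (1 := E).
    apply (ex_series_plus _ _ IH1 (H (S N))).
  + rewrite sum_Sn, IH2; unfold plus; simpl.
    rewrite <- Series_plus; auto. apply Series_ext, E.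
Qed.

(** Finitely many rows can be summed under the series over [j] by linearity; [M] dominates these
    partial sums uniformly, so Tannery's theorem passes to all rows. *)
Lemma Series_fubini (a : nat -> nat -> R) (M : nat -> R) :
  ex_series M -> (forall i, ex_series (a i)) ->
  (forall N j, Rabs (sum_n (fun i => a i j) N) <= M j) ->
  (forall j, ex_series (fun i => a i j)) ->
  Series (fun i => Series (a i)) = Series (fun j => Series (fun i => a i j)).
Proof.
intros HM Hr HB Hc.
apply is_series_unique.
change (is_lim_seq (sum_n (fun i => Series (a i))) (Series (fun j => Series (fun i => a i j)))).
apply is_lim_seq_ext with (fun N => Series (fun j => sum_n (fun i => a i j) N)).
- intro N; symmetry; apply (sum_n_Series_swap a N Hr).
- apply tannery with M; auto.
  intro j; apply Series_correct, Hc.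
Qed.

(** Pairing n with -1 - n lists every integer once, 0 included, and makes the reflection z -> -1 - z
    a mere swap of the two halves. *)
Definition zsum (f : Z -> R) : R :=
  Series (fun n => f (Z.of_nat n) + f (-1 - Z.of_nat n)%Z).

Definition zsummable (f : Z -> R) : Prop :=
  ex_series (fun n => Rabs (f (Z.of_nat n)) + Rabs (f (-1 - Z.of_nat n)%Z)).

Lemma zsummable_split (f : Z -> R) :
  zsummable f <->
  ex_series (fun n => Rabs (f (Z.of_nat n))) /\
  ex_series (fun n => Rabs (f (-1 - Z.of_nat n)%Z)).
Proof.
split.
- intro H; split; apply ex_series_dominated with (2 := H); intro n;
  rewrite Rabs_Rabsolu;
  generalize (Rabs_pos (f (Z.of_nat n))) (Rabs_pos (f (-1 - Z.of_nat n)%Z)); lra.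
- intros [H1 H2]; exact (ex_series_plus _ _ H1 H2).
Qed.

Lemma zsum_split (f : Z -> R) :
  zsummable f ->
  zsum f = Series (fun n => f (Z.of_nat n)) + Series (fun n => f (-1 - Z.of_nat n)%Z).
Proof.
intro H; apply zsummable_split in H; destruct H as [H1 H2].
apply Series_plus; now apply ex_series_Rabs.
Qed.

Lemma zsummable_dominated (f g : Z -> R) :
  (forall z, Rabs (f z) <= g z) -> zsummable g -> zsummable f.
Proof.
intros H Hg; apply ex_series_dominated with (2 := Hg); intro n.
assert (H1 := H (Z.of_nat n)); assert (H2 := H (-1 - Z.of_nat n)%Z).
generalize (Rle_abs (g (Z.of_nat n))) (Rle_abs (g (-1 - Z.of_nat n)%Z)); intros.
rewrite Rabs_pos_eq; [lra|].
apply Rplus_le_le_0_compat; apply Rabs_pos.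
Qed.

Lemma zsummable_ext (f g : Z -> R) :
  (forall z, f z = g z) -> zsummable f -> zsummable g.
Proof.
intro H; apply ex_series_ext; intro n; now rewrite !H.
Qed.

Lemma zsum_ext (f g : Z -> R) : (forall z, f z = g z) -> zsum f = zsum g.
Proof. intro H; apply Series_ext; intro n; now rewrite !H. Qed.

Lemma zsummable_abs (f : Z -> R) : zsummable f -> zsummable (fun z => Rabs (f z)).
Proof. apply ex_series_ext; intro n; now rewrite !Rabs_Rabsolu. Qed.

Lemma zsummable_ex (f : Z -> R) :
  zsummable f -> ex_series (fun n => f (Z.of_nat n) + f (-1 - Z.of_nat n)%Z).
Proof.
intro H; apply ex_series_dominated with (2 := H); intro n; apply Rabs_triang.
Qed.

Lemma zsummable_plus (f g : Z -> R) :
  zsummable f -> zsummable g -> zsummable (fun z => f z + g z).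
Proof.
intros Hf Hg.
apply zsummable_dominated with (fun z => Rabs (f z) + Rabs (g z)).
- intro z; apply Rabs_triang.
- generalize (ex_series_plus _ _ Hf Hg); apply ex_series_ext; intro n.
  unfold plus; simpl.
  rewrite !(Rabs_pos_eq (_ + _)); try (apply Rplus_le_le_0_compat; apply Rabs_pos); ring.
Qed.

Lemma zsum_plus (f g : Z -> R) :
  zsummable f -> zsummable g -> zsum (fun z => f z + g z) = zsum f + zsum g.
Proof.
intros Hf Hg; unfold zsum.
rewrite <- Series_plus by (now apply zsummable_ex).
apply Series_ext; intro n; ring.
Qed.

Lemma zsummable_scal (c : R) (f : Z -> R) :
  zsummable f -> zsummable (fun z => c * f z).
Proof.
intro H; generalize (ex_series_scal (Rabs c) _ H); apply ex_series_ext; intro n.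
rewrite !Rabs_mult; unfold scal; simpl; unfold mult; simpl; ring.
Qed.

Lemma zsum_scal (c : R) (f : Z -> R) : zsum (fun z => c * f z) = c * zsum f.
Proof.
unfold zsum; rewrite <- Series_scal_l; apply Series_ext; intro n; ring.
Qed.

Lemma zsum_nonneg (f : Z -> R) : zsummable f -> (forall z, 0 <= f z) -> 0 <= zsum f.
Proof.
intros Hs H; apply Series_nonneg; [now apply zsummable_ex|].
intro n; apply Rplus_le_le_0_compat; apply H.
Qed.

Lemma zshift1 (f : Z -> R) :
  zsummable f ->
  zsummable (fun z => f (z + 1)%Z) /\ zsum (fun z => f (z + 1)%Z) = zsum f.
Proof.
intro H; assert (H' := H); apply zsummable_split in H'; destruct H' as [H1 H2].
assert (A1 : ex_series (fun n => Rabs (f (Z.of_nat n + 1)%Z))).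
{ apply ex_series_incr_1 in H1; revert H1; apply ex_series_ext; intro n.
  now rewrite Nat2Z.inj_succ. }
assert (A2 : ex_series (fun n => Rabs (f (-1 - Z.of_nat n + 1)%Z))).
{ apply ex_series_incr_1; revert H2; apply ex_series_ext; intro n.
  do 2 f_equal; lia. }
assert (S1 : zsummable (fun z => f (z + 1)%Z)).
{ apply zsummable_split; split; auto. }
split; auto.
rewrite (zsum_split _ S1), (zsum_split _ H).
rewrite (Series_incr_1 (fun n => f (Z.of_nat n))) by (now apply ex_series_Rabs).
rewrite (Series_incr_1 (fun n => f (-1 - Z.of_nat n + 1)%Z)) by (now apply ex_series_Rabs).
rewrite (Series_ext (fun n => f (Z.of_nat n + 1)%Z) (fun n => f (Z.of_nat (S n)))).
2: intro n; f_equal; lia.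
rewrite (Series_ext (fun n => f (-1 - Z.of_nat (S n) + 1)%Z) (fun n => f (-1 - Z.of_nat n)%Z)).
2: intro n; f_equal; lia.
simpl; ring.
Qed.

Lemma zreflect (f : Z -> R) :
  zsummable f ->
  zsummable (fun z => f (- z)%Z) /\ zsum (fun z => f (- z)%Z) = zsum f.
Proof.
intro H.
destruct (zshift1 _ H) as [K1 K2].
(* The reflection z -> -1 - z swaps the halves of each term; composed with a shift by one it gives z
   -> - z. *)
assert (G : forall g, zsummable g ->
  zsummable (fun z => g (-1 - z)%Z) /\ zsum (fun z => g (-1 - z)%Z) = zsum g).
{ clear; intros f H; split.
  - revert H; apply ex_series_ext; intro n; rewrite Rplus_comm.
    now replace (-1 - (-1 - Z.of_nat n))%Z with (Z.of_nat n) by lia.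
  - apply Series_ext; intro n; rewrite Rplus_comm.
    now replace (-1 - (-1 - Z.of_nat n))%Z with (Z.of_nat n) by lia. }
destruct (G _ K1) as [L1 L2].
assert (E : forall z, f (-1 - z + 1)%Z = f (- z)%Z) by (intro z; f_equal; lia).
split.
- exact (zsummable_ext _ _ E L1).
- rewrite <- (zsum_ext _ _ E), L2; exact K2.
Qed.

Lemma zshift (k : Z) (f : Z -> R) :
  zsummable f ->
  zsummable (fun z => f (z + k)%Z) /\ zsum (fun z => f (z + k)%Z) = zsum f.
Proof.
assert (P : forall n g, zsummable g -> zsummable (fun z => g (z + Z.of_nat n)%Z) /\
   zsum (fun z => g (z + Z.of_nat n)%Z) = zsum g).
{ induction n as [|n IH]; intros g Hg.
  - assert (E : forall z, g z = g (z + Z.of_nat 0)%Z) by (intro z; f_equal; lia).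
    split; [exact (zsummable_ext _ _ E Hg)|symmetry; apply zsum_ext, E].
  - destruct (IH g Hg) as [I1 I2]; destruct (zshift1 _ I1) as [J1 J2].
    assert (E : forall z, g (z + 1 + Z.of_nat n)%Z = g (z + Z.of_nat (S n))%Z)
      by (intro z; f_equal; lia).
    split; [exact (zsummable_ext _ _ E J1)|].
    rewrite <- (zsum_ext _ _ E), J2; exact I2. }
intro H.
destruct (Z_le_dec 0 k) as [Hk|Hk].
- rewrite <- (Z2Nat.id k) by lia; apply P, H.
- destruct (zreflect f H) as [R1 R2].
  destruct (P (Z.to_nat (- k)) _ R1) as [S1 S2].
  rewrite (Z2Nat.id (- k)) in S1, S2 by lia.
  destruct (zreflect _ S1) as [T1 T2].
  assert (E : forall z, f (- (- z + - k))%Z = f (z + k)%Z) by (intro z; f_equal; lia).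
  split; [exact (zsummable_ext _ _ E T1)|].
  rewrite <- (zsum_ext _ _ E), T2, S2; exact R2.
Qed.

Lemma zdissect (f : Z -> R) :
  zsummable f ->
  zsummable (fun z => f (2 * z)%Z) /\ zsummable (fun z => f (2 * z + 1)%Z) /\
  zsum f = zsum (fun z => f (2 * z)%Z) + zsum (fun z => f (2 * z + 1)%Z).
Proof.
intro H; assert (H' := H); apply zsummable_split in H'; destruct H' as [H1 H2].
destruct (Series_double _ H1) as [A1 [A2 A3]].
destruct (Series_double _ H2) as [B1 [B2 B3]].
assert (E1 : forall n, f (Z.of_nat (2 * n)) = f (2 * Z.of_nat n)%Z) by (intro n; f_equal; lia).
assert (E2 : forall n, f (Z.of_nat (2 * n + 1)) = f (2 * Z.of_nat n + 1)%Z) by (intro n; f_equal; lia).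
(* The map n -> -1 - n exchanges parities, so the even indices of the negative half belong to the
   odd integers. *)
assert (E3 : forall n, f (-1 - Z.of_nat (2 * n))%Z = f (2 * (-1 - Z.of_nat n) + 1)%Z) by (intro n; f_equal; lia).
assert (E4 : forall n, f (-1 - Z.of_nat (2 * n + 1))%Z = f (2 * (-1 - Z.of_nat n))%Z) by (intro n; f_equal; lia).
assert (S1 : zsummable (fun z => f (2 * z)%Z)).
{ apply zsummable_split; split.
  - revert A1; apply ex_series_ext; intro n; now rewrite E1.
  - revert B2; apply ex_series_ext; intro n; now rewrite E4. }
assert (S2 : zsummable (fun z => f (2 * z + 1)%Z)).
{ apply zsummable_split; split.
  - revert A2; apply ex_series_ext; intro n; now rewrite E2.
  - revert B1; apply ex_series_ext; intro n; now rewrite E3. }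
split; [|split]; auto.
rewrite (zsum_split _ H), (zsum_split _ S1), (zsum_split _ S2), A3, B3.
rewrite (Series_ext _ _ E1), (Series_ext _ _ E2), (Series_ext _ _ E3), (Series_ext _ _ E4).
ring.
Qed.

Lemma zsum_sym (f : Z -> R) :
  zsummable f -> (forall z, f (- z)%Z = f z) ->
  zsum f = f 0%Z + 2 * Series (fun n => f (Z.of_nat n + 1)%Z).
Proof.
intros H E; rewrite (zsum_split _ H); apply zsummable_split in H; destruct H as [H1 H2].
rewrite (Series_incr_1 (fun n => f (Z.of_nat n))) by (now apply ex_series_Rabs).
rewrite (Series_ext (fun n => f (Z.of_nat (S n))) (fun n => f (Z.of_nat n + 1)%Z)).
2: intro n; f_equal; lia.
rewrite (Series_ext (fun n => f (-1 - Z.of_nat n)%Z) (fun n => f (Z.of_nat n + 1)%Z)).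
2: intro n; rewrite <- E; f_equal; lia.
simpl; ring.
Qed.

Lemma ztannery (a : nat -> Z -> R) (l M : Z -> R) :
  zsummable M ->
  (forall n k, Rabs (a n k) <= M k) ->
  (forall k, is_lim_seq (fun n => a n k) (l k)) ->
  is_lim_seq (fun n => zsum (a n)) (zsum l).
Proof.
intros HM Hb Hl; unfold zsum.
apply tannery with (fun n => M (Z.of_nat n) + M (-1 - Z.of_nat n)%Z).
- now apply zsummable_ex.
- intros n k; eapply Rle_trans; [apply Rabs_triang|].
  generalize (Hb n (Z.of_nat k)) (Hb n (-1 - Z.of_nat k)%Z); lra.
- intro k; apply is_lim_seq_plus'; apply Hl.
Qed.

Lemma sum_n_Rabs (u : nat -> R) N : Rabs (sum_n u N) <= sum_n (fun n => Rabs (u n)) N.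
Proof.
induction N as [|N IH]; [rewrite !sum_O; lra|].
rewrite !sum_Sn; unfold plus; simpl.
eapply Rle_trans; [apply Rabs_triang|]; lra.
Qed.

(** The four sign quadrants are folded into one double sequence over the naturals; its partial
    column sums are bounded by the absolute column sums. *)
Lemma zfubini (F : Z -> Z -> R) (M : Z -> R) :
  zsummable M ->
  (forall i, zsummable (F i)) ->
  (forall j, zsummable (fun i => F i j)) ->
  (forall j, zsum (fun i => Rabs (F i j)) <= M j) ->
  zsum (fun i => zsum (F i)) = zsum (fun j => zsum (fun i => F i j)).
Proof.
intros HM Hr Hc HB.
set (a := fun i j : nat =>
  (F (Z.of_nat i) (Z.of_nat j) + F (Z.of_nat i) (-1 - Z.of_nat j)%Z) +
  (F (-1 - Z.of_nat i)%Z (Z.of_nat j) + F (-1 - Z.of_nat i)%Z (-1 - Z.of_nat j)%Z)).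
assert (E1 : zsum (fun i => zsum (F i)) = Series (fun i => Series (a i))).
{ unfold zsum at 1; apply Series_ext; intro i; unfold zsum, a.
  rewrite <- Series_plus; try exact (zsummable_ex _ (Hr _)); auto. }
assert (E2 : zsum (fun j => zsum (fun i => F i j)) = Series (fun j => Series (fun i => a i j))).
{ unfold zsum at 1; apply Series_ext; intro j; unfold zsum, a.
  rewrite <- Series_plus; try exact (zsummable_ex _ (Hc _)).
  apply Series_ext; intro i; ring. }
rewrite E1, E2.
apply Series_fubini with (fun j => M (Z.of_nat j) + M (-1 - Z.of_nat j)%Z).
- now apply zsummable_ex.
- intro i; unfold a; apply (ex_series_plus (V := R_NormedModule)); [exact (zsummable_ex _ (Hr (Z.of_nat i)))|exact (zsummable_ex _ (Hr (-1 - Z.of_nat i)%Z))].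
- intros N j.
  assert (K : forall j, Rabs (sum_n (fun i => F (Z.of_nat i) j + F (-1 - Z.of_nat i)%Z j) N) <= M j).
  { intro k; eapply Rle_trans; [apply sum_n_Rabs|].
    eapply Rle_trans; [|apply (HB k)].
    eapply Rle_trans; [apply sum_n_le_Series|].
    - intro n; apply Rabs_pos.
    - apply ex_series_dominated with (2 := Hc k); intro n; rewrite Rabs_Rabsolu; apply Rabs_triang.
    - apply Series_le; [|apply Hc].
      intro n; split; [apply Rabs_pos|apply Rabs_triang]. }
  assert (E : sum_n (fun i => a i j) N =
     sum_n (fun i => F (Z.of_nat i) (Z.of_nat j) + F (-1 - Z.of_nat i)%Z (Z.of_nat j)) N +
     sum_n (fun i => F (Z.of_nat i) (-1 - Z.of_nat j)%Z + F (-1 - Z.of_nat i)%Z (-1 - Z.of_nat j)%Z) N).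
  { clear. induction N as [|N IH]; [rewrite !sum_O; unfold a; R_eq; ring|].
    rewrite !sum_Sn, IH; unfold a, plus; cbn -[Z.of_nat]; R_eq; ring. }
  rewrite E; eapply Rle_trans; [apply Rabs_triang|].
  generalize (K (Z.of_nat j)) (K (-1 - Z.of_nat j)%Z); lra.
- intro j.
  apply ex_series_ext with (fun i =>
    (F (Z.of_nat i) (Z.of_nat j) + F (-1 - Z.of_nat i)%Z (Z.of_nat j)) +
    (F (Z.of_nat i) (-1 - Z.of_nat j)%Z + F (-1 - Z.of_nat i)%Z (-1 - Z.of_nat j)%Z)).
  + intro i; unfold a; R_eq; ring.
  + apply (ex_series_plus (V := R_NormedModule)); [exact (zsummable_ex _ (Hc (Z.of_nat j)))|exact (zsummable_ex _ (Hc (-1 - Z.of_nat j)%Z))].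
Qed.

(** * Quadratic identities between theta functions *)

Lemma zsum_abs_nonneg (f : Z -> R) : zsummable f -> 0 <= zsum (fun z => Rabs (f z)).
Proof. intro H; apply zsum_nonneg; [now apply zsummable_abs|intro; apply Rabs_pos]. Qed.

Lemma zsubsum2 (f : Z -> R) (k : Z) :
  zsummable f ->
  zsummable (fun z => f (2 * z + k)%Z) /\
  zsum (fun z => Rabs (f (2 * z + k)%Z)) <= zsum (fun z => Rabs (f z)).
Proof.
intro H.
destruct (zdissect f H) as [D1 [D2 _]].
destruct (zdissect _ (zsummable_abs _ H)) as [_ [_ D3]].
assert (P1 := zsum_abs_nonneg _ D1); assert (P2 := zsum_abs_nonneg _ D2).
destruct (Z.Even_or_Odd k) as [[q Hq]|[q Hq]].
- assert (E : forall z, f (2 * (z + q))%Z = f (2 * z + k)%Z) by (intro z; f_equal; lia).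
  destruct (zshift q _ D1) as [S1 S2].
  destruct (zshift q _ (zsummable_abs _ D1)) as [_ S3].
  split; [exact (zsummable_ext _ _ E S1)|].
  rewrite (zsum_ext _ (fun z => Rabs (f (2 * (z + q))%Z))) by (intro z; now rewrite E).
  rewrite S3, D3; lra.
- assert (E : forall z, f (2 * (z + q) + 1)%Z = f (2 * z + k)%Z) by (intro z; f_equal; lia).
  destruct (zshift q _ D2) as [S1 S2].
  destruct (zshift q _ (zsummable_abs _ D2)) as [_ S3].
  split; [exact (zsummable_ext _ _ E S1)|].
  rewrite (zsum_ext _ (fun z => Rabs (f (2 * (z + q) + 1)%Z))) by (intro z; now rewrite E).
  rewrite S3, D3; lra.
Qed.

Lemma zsubsum8 (f : Z -> R) (k : Z) :
  zsummable f ->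
  zsummable (fun z => f (8 * z + k)%Z) /\
  zsum (fun z => Rabs (f (8 * z + k)%Z)) <= zsum (fun z => Rabs (f z)).
Proof.
intro H.
destruct (zsubsum2 f k H) as [A1 A2].
destruct (zsubsum2 _ 0 A1) as [B1 B2].
destruct (zsubsum2 _ 0 B1) as [C1 C2].
assert (E : forall z, f (2 * (2 * (2 * z + 0) + 0) + k)%Z = f (8 * z + k)%Z) by (intro z; f_equal; lia).
split; [exact (zsummable_ext _ _ E C1)|].
rewrite (zsum_ext _ (fun z => Rabs (f (2 * (2 * (2 * z + 0) + 0) + k)%Z))) by (intro z; now rewrite E).
lra.
Qed.

Lemma zrev (c : Z) (f : Z -> R) :
  zsummable f ->
  zsummable (fun z => f (c - z)%Z) /\ zsum (fun z => f (c - z)%Z) = zsum f.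
Proof.
intro H; destruct (zshift c f H) as [S1 S2]; destruct (zreflect _ S1) as [R1 R2].
assert (E : forall z, f (- z + c)%Z = f (c - z)%Z) by (intro z; f_equal; lia).
split; [exact (zsummable_ext _ _ E R1)|].
rewrite <- (zsum_ext _ _ E), R2; exact S2.
Qed.

(** This is the rearrangement of a lattice sum: after a linear change of variables, summing over [b]
    first leaves the sums of [G] over residue classes modulo [N]. The last hypothesis supplies the
    domination for Fubini; it is used for N = 2 and N = 8. *)
Lemma zconvolution (G H : Z -> R) (N c : Z) :
  zsummable G -> zsummable H ->
  (forall k, zsummable (fun b => G (N * b + k)%Z) /\
     zsum (fun b => Rabs (G (N * b + k)%Z)) <= zsum (fun b => Rabs (G b))) ->
  zsum (fun b => zsum (fun y => G (N * b + c - y)%Z * H y)) =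
  zsum (fun y => H y * zsum (fun b => G (N * b + (c - y))%Z)).
Proof.
intros HG HH HN.
set (C := zsum (fun b => Rabs (G b))).
(* Each term is at most the absolute sum: a shift by z makes [Rabs (H z)] the first term of the
   nonnegative half. *)
assert (bnd : exists B, forall z, Rabs (H z) <= B).
{ exists (zsum (fun z => Rabs (H z))); intro z.
  destruct (zshift z _ (zsummable_abs _ HH)) as [S1 S2].
  assert (S1' := proj1 (zsummable_split _) S1); destruct S1' as [T1 T2].
  rewrite <- S2, (zsum_split _ S1).
  assert (U : 0 <= Series (fun n => Rabs (H (-1 - Z.of_nat n + z)%Z))).
  { apply Series_nonneg; [now apply ex_series_Rabs|intro; apply Rabs_pos]. }
  rewrite (Series_incr_1 (fun n => Rabs (H (Z.of_nat n + z)%Z))) by (now apply ex_series_Rabs).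
  assert (V : 0 <= Series (fun n => Rabs (H (Z.of_nat (S n) + z)%Z))).
  { apply Series_nonneg; [|intro; apply Rabs_pos].
    apply (ex_series_incr_1 (fun n => Rabs (H (Z.of_nat n + z)%Z))).
    now apply ex_series_Rabs. }
  change (Z.of_nat 0 + z)%Z with z; lra. }
destruct bnd as [B HB].
assert (BG : forall b y, Rabs (G (N * b + c - y)%Z * H y) <= B * Rabs (G (N * b + c - y)%Z)).
{ intros b y; rewrite Rabs_mult, (Rmult_comm B).
  apply Rmult_le_compat_l; [apply Rabs_pos|apply HB]. }
assert (E : forall y b, G (N * b + (c - y))%Z = G (N * b + c - y)%Z) by (intros; f_equal; lia).
rewrite (zfubini _ (fun y => C * Rabs (H y))).
- apply zsum_ext; intro y; rewrite <- zsum_scal; apply zsum_ext; intro b.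
  rewrite E; ring.
- apply zsummable_scal, zsummable_abs, HH.
- intro b; apply zsummable_dominated with (1 := BG b).
  apply zsummable_scal, zsummable_abs.
  exact (proj1 (zrev (N * b + c) _ HG)).
- intro y.
  apply zsummable_ext with (fun b => H y * G (N * b + (c - y))%Z).
  + intro b; rewrite E; ring.
  + apply zsummable_scal, HN.
- intro y.
  rewrite (zsum_ext _ (fun b => Rabs (H y) * Rabs (G (N * b + (c - y))%Z))).
  + rewrite zsum_scal, Rmult_comm; apply Rmult_le_compat_r; [apply Rabs_pos|].
    apply HN.
  + intro b; rewrite E, Rabs_mult; ring.
Qed.

(* [gsum c] is the theta constant theta_3 at q = exp (- c). *)
Definition gauss (c : R) (z : Z) : R := exp (- c * IZR z ^ 2).
Definition gsum (c : R) : R := zsum (gauss c).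

Lemma gauss_sym c z : gauss c (- z) = gauss c z.
Proof. unfold gauss; rewrite opp_IZR; f_equal; ring. Qed.

Lemma exp_pow (x : R) (n : nat) : exp x ^ n = exp (INR n * x).
Proof.
induction n as [|n IH]; [simpl; rewrite Rmult_0_l, exp_0; auto|].
rewrite S_INR; simpl; rewrite IH, <- exp_plus; f_equal; ring.
Qed.

Lemma gauss_geom c n : 0 < c -> gauss c (Z.of_nat n) <= exp (- c) ^ n.
Proof.
intro Hc; unfold gauss; rewrite exp_pow, <- INR_IZR_INZ.
assert (0 <= INR n * (INR n - 1) \/ False).
{ left; destruct n as [|n]; [simpl; lra|].
  rewrite S_INR; generalize (pos_INR n); intros; nra. }
destruct H as [H|[]].
destruct (Rle_lt_or_eq_dec (- c * INR n ^ 2) (INR n * - c)) as [L|L].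
- nra.
- left; now apply exp_increasing.
- rewrite L; lra.
Qed.

Lemma exp_opp_lt_1 c : 0 < c -> 0 < exp (- c) < 1.
Proof.
intro H; split; [apply exp_pos|]. rewrite <- exp_0; apply exp_increasing; lra.
Qed.

Lemma zsummable_gauss c : 0 < c -> zsummable (gauss c).
Proof.
intro Hc; destruct (exp_opp_lt_1 c Hc) as [Q1 Q2].
assert (G : ex_series (fun n => exp (- c) ^ n)).
{ apply ex_series_geom; rewrite Rabs_pos_eq; lra. }
apply zsummable_split; split; apply ex_series_dominated with (2 := G); intro n;
rewrite Rabs_Rabsolu, Rabs_pos_eq by (left; apply exp_pos).
- now apply gauss_geom.
- replace (-1 - Z.of_nat n)%Z with (- Z.of_nat (S n))%Z by lia.
  rewrite gauss_sym; eapply Rle_trans; [now apply gauss_geom|].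
  simpl; rewrite <- (Rmult_1_l (exp (- c) ^ n)) at 2.
  apply Rmult_le_compat_r; [|lra]. apply pow_le; lra.
Qed.

Lemma gauss_scale c k z : gauss c (k * z) = gauss (c * IZR k ^ 2) z.
Proof. unfold gauss; rewrite mult_IZR; f_equal; ring. Qed.

(** In q = exp (- c) this is theta_3(q)^2 = theta_3(q^2)^2 + theta_2(q^2)^2. It comes from b^2 + (b
    - y)^2 = ((2b - y)^2 + y^2) / 2, where 2b - y and y are any two integers of equal parity. *)
Lemma gsum_square c :
  0 < c -> gsum c ^ 2 = gsum (2 * c) ^ 2 + (gsum (c / 2) - gsum (2 * c)) ^ 2.
Proof.
intro Hc.
assert (Sc := zsummable_gauss c Hc).
assert (Sh : zsummable (gauss (c / 2))) by (apply zsummable_gauss; lra).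
assert (L : gsum c ^ 2 =
  zsum (fun b => zsum (fun y => gauss (c / 2) (2 * b + 0 - y) * gauss (c / 2) y))).
{ replace (gsum c ^ 2) with (gsum c * gsum c) by ring; unfold gsum at 2; rewrite <- zsum_scal.
  apply zsum_ext; intro b; unfold gsum.
  rewrite <- (proj2 (zrev b _ Sc)), Rmult_comm, <- zsum_scal.
  apply zsum_ext; intro y; unfold gauss; rewrite <- !exp_plus; f_equal.
  rewrite !minus_IZR, plus_IZR, mult_IZR; field. }
rewrite L, zconvolution; auto; [|intro k; now apply zsubsum2].
set (R0 := gsum (2 * c)); set (R1 := gsum (c / 2) - gsum (2 * c)).
destruct (zdissect _ Sh) as [D1 [D2 D3]].
assert (E0 : zsum (fun z => gauss (c / 2) (2 * z)) = R0).
{ unfold R0, gsum; apply zsum_ext; intro z; rewrite gauss_scale; f_equal; field. }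
assert (E1 : zsum (fun z => gauss (c / 2) (2 * z + 1)) = R1).
{ unfold R1, gsum in *; rewrite D3, E0; unfold R0, gsum; ring. }
assert (F0 : forall z, zsum (fun b => gauss (c / 2) (2 * b + (0 - 2 * z))) = R0).
{ intro z; rewrite <- E0, <- (proj2 (zshift (- z) _ D1)).
  apply zsum_ext; intro b; f_equal; lia. }
assert (F1 : forall z, zsum (fun b => gauss (c / 2) (2 * b + (0 - (2 * z + 1)))) = R1).
{ intro z; rewrite <- E1, <- (proj2 (zshift (- z - 1) _ D2)).
  apply zsum_ext; intro b; f_equal; lia. }
destruct (zdissect (fun y => gauss (c / 2) y * zsum (fun b => gauss (c / 2) (2 * b + (0 - y)))))
  as [_ [_ D]].
{ apply zsummable_dominated with (fun y => (zsum (fun b => Rabs (gauss (c / 2) b))) * Rabs (gauss (c / 2) y)).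
  - intro y; rewrite Rabs_mult, Rmult_comm; apply Rmult_le_compat_r; [apply Rabs_pos|].
    destruct (zsubsum2 _ (0 - y) Sh) as [K1 K2].
    eapply Rle_trans; [|exact K2].
    right; rewrite Rabs_pos_eq.
    + apply zsum_ext; intro; rewrite Rabs_pos_eq; auto; left; apply exp_pos.
    + apply zsum_nonneg; auto; intro; left; apply exp_pos.
  - apply zsummable_scal, zsummable_abs, Sh. }
rewrite D; cbv beta.
rewrite (zsum_ext _ (fun z => R0 * gauss (c / 2) (2 * z))) by (intro z; cbv beta; rewrite F0; ring).
rewrite (zsum_ext (fun z => gauss _ (2 * z + 1) * _) (fun z => R1 * gauss (c / 2) (2 * z + 1)))
  by (intro z; cbv beta; rewrite F1; ring).
rewrite !zsum_scal, E0, E1; unfold R1, R0; ring.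
Qed.

(** [M] and [s] are separate arguments so that moduli and residues come out as numerals; both
    equations are then closed by [eq_refl]. *)
Lemma zdissect_step (f : Z -> R) (N r M s : Z) :
  (M = 2 * N)%Z -> (s = r + N)%Z ->
  zsummable (fun z => f (N * z + r)%Z) ->
  zsummable (fun z => f (M * z + r)%Z) /\
  zsummable (fun z => f (M * z + s)%Z) /\
  zsum (fun z => f (N * z + r)%Z) =
    zsum (fun z => f (M * z + r)%Z) + zsum (fun z => f (M * z + s)%Z).
Proof.
intros HM Hs H; destruct (zdissect _ H) as [D1 [D2 D3]].
assert (E1 : forall z, f (N * (2 * z) + r)%Z = f (M * z + r)%Z) by (intro; f_equal; lia).
assert (E2 : forall z, f (N * (2 * z + 1) + r)%Z = f (M * z + s)%Z) by (intro; f_equal; lia).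
split; [exact (zsummable_ext _ _ E1 D1)|split; [exact (zsummable_ext _ _ E2 D2)|]].
now rewrite <- (zsum_ext _ _ E1), <- (zsum_ext _ _ E2).
Qed.

(** * Residue classes modulo 8 and the lattice of Z[sqrt (-7)] *)

Definition gsum8 (c : R) (k : Z) : R := zsum (fun b => gauss c (8 * b + k)).
Definition gsum4 (c : R) (k : Z) : R := zsum (fun b => gauss c (4 * b + k)).

Lemma zdissect8 (f : Z -> R) :
  zsummable f ->
  zsum f =
    zsum (fun z => f (8 * z + 0)%Z) + zsum (fun z => f (8 * z + 1)%Z) +
    zsum (fun z => f (8 * z + 2)%Z) + zsum (fun z => f (8 * z + 3)%Z) +
    zsum (fun z => f (8 * z + 4)%Z) + zsum (fun z => f (8 * z + 5)%Z) +
    zsum (fun z => f (8 * z + 6)%Z) + zsum (fun z => f (8 * z + 7)%Z).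
Proof.
intro H.
assert (E : forall z, f z = f (1 * z + 0)%Z) by (intro; f_equal; ring).
apply (zsummable_ext _ _ E) in H; rewrite (zsum_ext _ _ E).
destruct (zdissect_step f 1 0 2 1 eq_refl eq_refl H) as [H0 [H1 ->]].
destruct (zdissect_step f 2 0 4 2 eq_refl eq_refl H0) as [H00 [H02 ->]].
destruct (zdissect_step f 2 1 4 3 eq_refl eq_refl H1) as [H01 [H03 ->]].
destruct (zdissect_step f 4 0 8 4 eq_refl eq_refl H00) as [_ [_ ->]].
destruct (zdissect_step f 4 1 8 5 eq_refl eq_refl H01) as [_ [_ ->]].
destruct (zdissect_step f 4 2 8 6 eq_refl eq_refl H02) as [_ [_ ->]].
destruct (zdissect_step f 4 3 8 7 eq_refl eq_refl H03) as [_ [_ ->]].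
ring.
Qed.

Lemma gsum8_shift c k m : 0 < c -> gsum8 c (k + 8 * m) = gsum8 c k.
Proof.
intro H; unfold gsum8.
destruct (zsubsum8 _ k (zsummable_gauss c H)) as [S _].
rewrite <- (proj2 (zshift m _ S)); apply zsum_ext; intro b; f_equal; ring.
Qed.

Lemma gsum8_opp c k : 0 < c -> gsum8 c (- k) = gsum8 c k.
Proof.
intro H; unfold gsum8.
destruct (zsubsum8 _ k (zsummable_gauss c H)) as [S _].
rewrite <- (proj2 (zreflect _ S)); apply zsum_ext; intro b.
rewrite <- gauss_sym; f_equal; ring.
Qed.

Lemma gsum8_flip c k k' : 0 < c -> (k + k' = 8)%Z -> gsum8 c k = gsum8 c k'.
Proof.
intros H E; rewrite <- (gsum8_opp c k' H), <- (gsum8_shift c (- k') 1 H); f_equal; lia.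
Qed.

(** Sorting integers by their power of 2 and using the symmetry k -> 8 - k determines only these
    combinations of class sums. They are the ones that occur in [gsum_septic]. *)
Lemma gsum8_values c :
  0 < c ->
  gsum8 c 0 + gsum8 c 4 = gsum (16 * c) /\
  2 * gsum8 c 2 = gsum (4 * c) - gsum (16 * c) /\
  2 * (gsum8 c 1 + gsum8 c 3) = gsum c - gsum (4 * c).
Proof.
intro H; assert (S := zsummable_gauss c H).
assert (E : forall z, gauss c z = gauss c (1 * z + 0)) by (intro; f_equal; ring).
assert (S1 := zsummable_ext _ _ E S).
destruct (zdissect_step (gauss c) 1 0 2 1 eq_refl eq_refl S1) as [H0 [H1 D1]].
destruct (zdissect_step (gauss c) 2 0 4 2 eq_refl eq_refl H0) as [H00 [H02 D2]].
destruct (zdissect_step (gauss c) 2 1 4 3 eq_refl eq_refl H1) as [H01 [H03 D3]].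
destruct (zdissect_step (gauss c) 4 0 8 4 eq_refl eq_refl H00) as [_ [_ D4]].
destruct (zdissect_step (gauss c) 4 1 8 5 eq_refl eq_refl H01) as [_ [_ D5]].
destruct (zdissect_step (gauss c) 4 2 8 6 eq_refl eq_refl H02) as [_ [_ D6]].
destruct (zdissect_step (gauss c) 4 3 8 7 eq_refl eq_refl H03) as [_ [_ D7]].
rewrite D5, D7 in D3; rewrite D6 in D2.
rewrite <- (zsum_ext _ _ E) in D1.
assert (K : forall k, zsum (fun z => gauss c (8 * z + k)) = gsum8 c k) by reflexivity.
rewrite !K in D3; rewrite !K in D2; rewrite !K in D4; rewrite !K in D6.
assert (P5 : gsum8 c 5 = gsum8 c 3).
{ apply gsum8_flip; auto; lia. }
assert (P6 : gsum8 c 6 = gsum8 c 2).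
{ apply gsum8_flip; auto; lia. }
assert (P7 : gsum8 c 7 = gsum8 c 1).
{ apply gsum8_flip; auto; lia. }
rewrite P5, P7 in D3; rewrite P6 in D2.
assert (Q2 : zsum (fun z => gauss c (2 * z + 0)) = gsum (4 * c)).
{ unfold gsum; apply zsum_ext; intro z; rewrite Z.add_0_r, gauss_scale; f_equal; ring. }
assert (Q4 : zsum (fun z => gauss c (4 * z + 0)) = gsum (16 * c)).
{ unfold gsum; apply zsum_ext; intro z; rewrite Z.add_0_r, gauss_scale; f_equal; ring. }
rewrite Q2 in D1, D2; rewrite Q4 in D2, D4.
change (zsum (gauss c)) with (gsum c) in D1.
rewrite D3 in D1.
split; [|split]; lra.
Qed.

(** Every odd integer is 1 modulo 4 up to sign, so the class 1 carries half of the odd terms. *)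
Lemma gsum4_odd c : 0 < c -> 2 * gsum4 c 1 = gsum c - gsum (4 * c).
Proof.
intro H; assert (S := zsummable_gauss c H).
assert (E : forall z, gauss c z = gauss c (1 * z + 0)) by (intro; f_equal; ring).
assert (S1 := zsummable_ext _ _ E S).
destruct (zdissect_step (gauss c) 1 0 2 1 eq_refl eq_refl S1) as [H0 [H1 D1]].
destruct (zdissect_step (gauss c) 2 1 4 3 eq_refl eq_refl H1) as [H01 [H03 D3]].
rewrite <- (zsum_ext _ _ E) in D1.
assert (Q2 : zsum (fun z => gauss c (2 * z + 0)) = gsum (4 * c)).
{ unfold gsum; apply zsum_ext; intro z; rewrite Z.add_0_r, gauss_scale; f_equal; ring. }
assert (Q3 : zsum (fun z => gauss c (4 * z + 3)) = gsum4 c 1).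
{ rewrite <- (proj2 (zrev (-1) _ H03)); apply zsum_ext; intro z.
  rewrite <- gauss_sym; f_equal; ring. }
rewrite Q3 in D3; change (zsum (fun z => gauss c (4 * z + 1))) with (gsum4 c 1) in D3.
rewrite Q2 in D1; change (zsum (gauss c)) with (gsum c) in D1.
lra.
Qed.

(* With y = b - a and x = 8b + 2 - y one has
   (4a+1)^2 + 7(4b+1)^2 = 2(x^2 + 7y^2): this is division by (1 + sqrt(-7))/2
   in the ring of integers of Q(sqrt(-7)). *)
Lemma gsum4_product c :
  0 < c ->
  gsum4 c 1 * gsum4 (7 * c) 1 =
  zsum (fun y => gauss (14 * c) y * gsum8 (2 * c) (2 - y)).
Proof.
intro H.
assert (S1 : zsummable (fun z => gauss c (4 * z + 1))).
{ assert (S := zsummable_gauss c H).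
  destruct (zsubsum2 _ 1 S) as [T1 _]; destruct (zsubsum2 _ 0 T1) as [T2 _].
  revert T2; apply zsummable_ext; intro z; f_equal; ring. }
assert (L : gsum4 c 1 * gsum4 (7 * c) 1 =
  zsum (fun b => zsum (fun y => gauss (2 * c) (8 * b + 2 - y) * gauss (14 * c) y))).
{ unfold gsum4 at 2; rewrite <- zsum_scal.
  apply zsum_ext; intro b; unfold gsum4.
  rewrite <- (proj2 (zrev b _ S1)), Rmult_comm, <- zsum_scal.
  apply zsum_ext; intro y; unfold gauss; rewrite <- !exp_plus; f_equal.
  rewrite ?minus_IZR, ?plus_IZR, ?mult_IZR, ?minus_IZR, ?plus_IZR, ?mult_IZR; ring. }
rewrite L; apply (zconvolution (gauss (2 * c)) (gauss (14 * c)) 8 2).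
- apply zsummable_gauss; lra.
- apply zsummable_gauss; lra.
- intro k; apply zsubsum8, zsummable_gauss; lra.
Qed.

(** In [gsum4_product] at c / 8 the classes r of y are paired with the classes 2 - r. With the
    symmetry k -> 8 - k the eight products collapse to (s0 + s4) t2 + s2 (t0 + t4) + (s1 + s3) (t1 +
    t3), where s and t are the class sums at 7c / 4 and c / 4. *)
Lemma gsum_septic c :
  0 < c ->
  (gsum (c / 8) - gsum (c / 2)) * (gsum (7 * c / 8) - gsum (7 * c / 2)) =
  2 * gsum (28 * c) * (gsum c - gsum (4 * c)) +
  2 * gsum (4 * c) * (gsum (7 * c) - gsum (28 * c)) +
  (gsum (c / 4) - gsum c) * (gsum (7 * c / 4) - gsum (7 * c)).
Proof.
intro H.
assert (P := gsum4_product (c / 8) ltac:(lra)).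
assert (O1 := gsum4_odd (c / 8) ltac:(lra)).
assert (O2 := gsum4_odd (7 * (c / 8)) ltac:(lra)).
replace (4 * (c / 8)) with (c / 2) in O1 by field.
replace (4 * (7 * (c / 8))) with (7 * c / 2) in O2 by field.
replace (7 * (c / 8)) with (7 * c / 8) in * by field.
replace (2 * (c / 8)) with (c / 4) in P by field.
replace (14 * (c / 8)) with (7 * c / 4) in P by field.
assert (H1 : 0 < c / 4) by lra; assert (H2 : 0 < 7 * c / 4) by lra.
assert (S : zsummable (fun y => gauss (7 * c / 4) y * gsum8 (c / 4) (2 - y))).
{ apply zsummable_dominated with (fun y => (zsum (fun b => Rabs (gauss (c / 4) b))) * Rabs (gauss (7 * c / 4) y)).
  - intro y; rewrite Rabs_mult, Rmult_comm; apply Rmult_le_compat_r; [apply Rabs_pos|].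
    destruct (zsubsum8 _ (2 - y) (zsummable_gauss _ H1)) as [K1 K2].
    eapply Rle_trans; [|exact K2].
    right; unfold gsum8; rewrite Rabs_pos_eq.
    + apply zsum_ext; intro; rewrite Rabs_pos_eq; auto; left; apply exp_pos.
    + apply zsum_nonneg; auto; intro; left; apply exp_pos.
  - apply zsummable_scal, zsummable_abs, zsummable_gauss, H2. }
rewrite (zdissect8 _ S) in P.
(* For y = 8z + r the second factor depends only on 2 - r modulo 8; [m] selects a convenient
   representative [k]. *)
assert (W : forall r k, (exists m, k = 2 - r + 8 * m)%Z ->
  zsum (fun z => gauss (7 * c / 4) (8 * z + r) * gsum8 (c / 4) (2 - (8 * z + r))) =
  gsum8 (7 * c / 4) r * gsum8 (c / 4) k).
{ intros r k [m Hm]; rewrite (Rmult_comm (gsum8 (7 * c / 4) r)).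
  unfold gsum8 at 3; rewrite <- zsum_scal.
  apply zsum_ext; intro z; rewrite Rmult_comm; f_equal.
  rewrite <- (gsum8_shift _ (2 - (8 * z + r)) (z + m) H1); f_equal; lia. }
rewrite (W 0 2)%Z in P by (exists 0%Z; lia).
rewrite (W 1 1)%Z in P by (exists 0%Z; lia).
rewrite (W 2 0)%Z in P by (exists 0%Z; lia).
rewrite (W 3 (-1))%Z in P by (exists 0%Z; lia).
rewrite (W 4 (-2))%Z in P by (exists 0%Z; lia).
rewrite (W 5 (-3))%Z in P by (exists 0%Z; lia).
rewrite (W 6 4)%Z in P by (exists 1%Z; lia).
rewrite (W 7 3)%Z in P by (exists 1%Z; lia).
change (-1)%Z with (- (1))%Z in P; change (-2)%Z with (- (2))%Z in P;
change (-3)%Z with (- (3))%Z in P.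
rewrite !(gsum8_opp (c / 4)) in P by auto.
assert (P5 : gsum8 (7 * c / 4) 5 = gsum8 (7 * c / 4) 3).
{ apply gsum8_flip; auto; lia. }
assert (P6 : gsum8 (7 * c / 4) 6 = gsum8 (7 * c / 4) 2).
{ apply gsum8_flip; auto; lia. }
assert (P7 : gsum8 (7 * c / 4) 7 = gsum8 (7 * c / 4) 1).
{ apply gsum8_flip; auto; lia. }
rewrite P5, P6, P7 in P.
destruct (gsum8_values _ H1) as [V1 [V2 V3]].
destruct (gsum8_values _ H2) as [U1 [U2 U3]].
replace (16 * (c / 4)) with (4 * c) in * by field.
replace (4 * (c / 4)) with c in * by field.
replace (16 * (7 * c / 4)) with (28 * c) in * by field.
replace (4 * (7 * c / 4)) with (7 * c) in * by field.
rewrite <- O1, <- O2, <- V2, <- V3, <- U2, <- U3, <- V1, <- U1.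
match goal with |- ?l = _ => transitivity (4 * (gsum4 (c / 8) 1 * gsum4 (7 * c / 8) 1)) end.
ring.
rewrite P; ring.
Qed.

(** * Bounds and limits at infinity, theta constants and their duplication *)

Lemma gsum_sym c : 0 < c -> gsum c = 1 + 2 * Series (fun n => gauss c (Z.of_nat n + 1)).
Proof.
intro H; unfold gsum; rewrite zsum_sym.
- f_equal; unfold gauss; rewrite <- exp_0; f_equal; simpl; ring.
- now apply zsummable_gauss.
- intro z; apply gauss_sym.
Qed.

Lemma gsum_bounds c : 0 < c -> 1 <= gsum c <= 1 + 2 / (exp c - 1).
Proof.
intro H; rewrite gsum_sym by auto.
destruct (exp_opp_lt_1 c H) as [Q1 Q2].
assert (B : forall n, 0 <= gauss c (Z.of_nat n + 1) <= exp (- c) * exp (- c) ^ n).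
{ intro n; split; [left; apply exp_pos|].
  replace (Z.of_nat n + 1)%Z with (Z.of_nat (S n)) by lia.
  apply (gauss_geom c (S n) H). }
assert (G : ex_series (fun n => exp (- c) * exp (- c) ^ n)).
{ apply (ex_series_scal (exp (- c)) (fun n => exp (- c) ^ n)).
  apply ex_series_geom; rewrite Rabs_pos_eq; lra. }
assert (0 <= Series (fun n => gauss c (Z.of_nat n + 1))).
{ apply Series_nonneg; [|intro; apply B].
  apply ex_series_dominated with (2 := G); intro n; rewrite Rabs_pos_eq; apply B. }
assert (Series (fun n => gauss c (Z.of_nat n + 1)) <= / (exp c - 1)).
{ eapply Rle_trans; [apply Series_le; [exact B|exact G]|].
  rewrite Series_scal_l, Series_geom by (rewrite Rabs_pos_eq; lra).
  right; rewrite exp_Ropp in *.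
  assert (0 < exp c) by apply exp_pos.
  assert (exp 0 < exp c) by (apply exp_increasing; lra).
  rewrite exp_0 in *; field; lra. }
unfold Rdiv; lra.
Qed.

Lemma gsum_le c : 0 < c -> gsum c <= 1 + 2 / c.
Proof.
intro H; eapply Rle_trans; [apply gsum_bounds; auto|].
apply Rplus_le_compat_l, Rmult_le_compat_l; [lra|].
apply Rinv_le_contravar; auto.
generalize (exp_ineq1_le c); lra.
Qed.

Lemma gsum_pow2_lim a : 0 < a -> is_lim_seq (fun n => gsum (a * 2 ^ n)) 1.
Proof.
intro H.
assert (P : forall n, 0 < a * 2 ^ n).
{ intro n; apply Rmult_lt_0_compat; auto; apply pow_lt; lra. }
apply is_lim_seq_le_le with (fun _ => 1) (fun n => 1 + 2 / a * (1 / 2) ^ n).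
- intro n; split; [now apply gsum_bounds|].
  eapply Rle_trans; [apply gsum_le; auto|].
  right; unfold Rdiv; rewrite Rmult_1_l, pow_inv, Rinv_mult; ring.
- apply is_lim_seq_const.
- replace (Finite 1) with (Finite (1 + 2 / a * 0)) by (f_equal; ring).
  apply is_lim_seq_plus'; [apply is_lim_seq_const|].
  apply (is_lim_seq_scal_l _ _ 0), is_lim_seq_geom.
  rewrite Rabs_pos_eq; lra.
Qed.

(** With q = exp (- c), [theta2] sums q^(z^2 / 4) over odd z, as all z minus even z, and [theta4]
    sums (-1)^z q^(z^2), as twice the even terms minus all terms. Everything thus stays within
    values of [gsum]. *)
Definition theta2 (c : R) : R := gsum (c / 4) - gsum c.
Definition theta4 (c : R) : R := 2 * gsum (4 * c) - gsum c.

Lemma theta2_pow2_lim a : 0 < a -> is_lim_seq (fun n => theta2 (a * 2 ^ n)) 0.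
Proof.
intro H; replace (Finite 0) with (Finite (1 - 1)) by (f_equal; ring).
apply is_lim_seq_minus'.
- apply is_lim_seq_ext with (fun n => gsum (a / 4 * 2 ^ n)).
  + intro n; f_equal; field.
  + apply gsum_pow2_lim; lra.
- now apply gsum_pow2_lim.
Qed.

Lemma theta2_pos c : 0 < c -> 0 < theta2 c.
Proof.
intro H; unfold theta2; replace c with (4 * (c / 4)) at 2 by field.
rewrite <- gsum4_odd by lra; apply Rmult_lt_0_compat; [lra|].
destruct (zsubsum2 _ 1 (zsummable_gauss (c / 4) ltac:(lra))) as [S1 _].
destruct (zsubsum2 _ 0 S1) as [S2 _].
assert (S : zsummable (fun z => gauss (c / 4) (4 * z + 1))).
{ revert S2; apply zsummable_ext; intro z; f_equal; ring. }
assert (P : forall z, 0 < gauss (c / 4) z) by (intro; apply exp_pos).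
unfold gsum4; rewrite (zsum_split _ S).
apply zsummable_split in S; destruct S as [U1 U2].
rewrite Series_incr_1 by (now apply ex_series_Rabs).
assert (0 <= Series (fun n => gauss (c / 4) (4 * Z.of_nat (S n) + 1))).
{ apply Series_nonneg; [|intro; left; apply P].
  apply (ex_series_incr_1 (fun n => gauss (c / 4) (4 * Z.of_nat n + 1))).
  now apply ex_series_Rabs. }
assert (0 <= Series (fun n => gauss (c / 4) (4 * (-1 - Z.of_nat n) + 1))).
{ apply Series_nonneg; [|intro; left; apply P]. now apply ex_series_Rabs. }
generalize (P (4 * Z.of_nat 0 + 1)%Z); lra.
Qed.

(** All three are algebraic consequences of [gsum_square] at c times powers of 2. The last one is
    Jacobi's identity, which makes the two moduli complementary. *)
Lemma theta_duplication c :
  0 < c ->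
  gsum c * theta4 c = theta4 (2 * c) ^ 2 /\
  theta2 (c / 2) ^ 2 = 2 * theta2 c * gsum c /\
  gsum c ^ 4 = theta2 c ^ 4 + theta4 c ^ 4.
Proof.
intro H.
assert (Q1 := gsum_square c H).
assert (Q2 := gsum_square (2 * c) ltac:(lra)).
assert (Q3 := gsum_square (c / 2) ltac:(lra)).
replace (2 * c / 2) with c in Q2 by field.
replace (2 * (2 * c)) with (4 * c) in Q2 by ring.
replace (2 * (c / 2)) with c in Q3 by field.
replace (c / 2 / 2) with (c / 4) in Q3 by field.
unfold theta2, theta4.
replace (4 * (2 * c)) with (8 * c) by ring.
replace (c / 2 / 4) with (c / 8) by field.
assert (Q4 := gsum_square (4 * c) ltac:(lra)).
replace (2 * (4 * c)) with (8 * c) in Q4 by field.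
replace (4 * c / 2) with (2 * c) in Q4 by field.
assert (Q5 := gsum_square (c / 4) ltac:(lra)).
replace (2 * (c / 4)) with (c / 2) in Q5 by field.
replace (c / 4 / 2) with (c / 8) in Q5 by field.
set (g := gsum) in *.
split; [|split].
- nra.
- nra.
- assert (E4 : (2 * g (4 * c) - g c) ^ 2 = 2 * g (2 * c) ^ 2 - g c ^ 2) by nra.
  assert (E2 : (g (c / 4) - g c) ^ 2 = 2 * g (2 * c) * (g (c / 2) - g (2 * c))) by nra.
  assert (E1 : (g (c / 2) - g (2 * c)) ^ 2 = g c ^ 2 - g (2 * c) ^ 2) by nra.
  replace ((g (c / 4) - g c) ^ 4) with (((g (c / 4) - g c) ^ 2) ^ 2) by ring.
  replace ((2 * g (4 * c) - g c) ^ 4) with (((2 * g (4 * c) - g c) ^ 2) ^ 2) by ring.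
  rewrite E2, E4.
  replace ((2 * g (2 * c) * (g (c / 2) - g (2 * c))) ^ 2)
    with (4 * g (2 * c) ^ 2 * (g (c / 2) - g (2 * c)) ^ 2) by ring.
  rewrite E1; ring.
Qed.

(** * The modular equation of degree 7 by descent under c -> 2c *)

Definition prodA (c : R) : R := gsum c * gsum (7 * c).
Definition prodB (c : R) : R := theta2 (c / 2) * theta2 (7 * c / 2) / 2.

(** As [theta2 (4 * c) = gsum c - gsum (4 * c)], expanding [prodB (8 * c)] produces the mixed
    products of [gsum_septic], which can so be eliminated. What remains involves only values of
    [prodA] and [prodB]. *)
Lemma prod_recurrence c :
  0 < c -> prodA c = prodA (4 * c) + 2 * prodB (8 * c) + prodB c - prodB (2 * c).
Proof.
intro H; assert (S := gsum_septic c H); unfold prodA, prodB, theta2.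
replace (c / 2 / 4) with (c / 8) by field.
replace (7 * c / 2 / 4) with (7 * c / 8) by field.
replace (2 * c / 2) with c by field.
replace (7 * (2 * c) / 2) with (7 * c) by field.
replace (8 * c / 2) with (4 * c) by field.
replace (7 * (8 * c) / 2) with (28 * c) by field.
replace (4 * c / 4) with c by field.
replace (28 * c / 4) with (7 * c) by field.
replace (7 * (4 * c)) with (28 * c) by ring.
lra.
Qed.

Lemma prodA_lim a : 0 < a -> is_lim_seq (fun n => prodA (a * 2 ^ n)) 1.
Proof.
intro H; replace (Finite 1) with (Finite (1 * 1)) by (f_equal; ring).
apply is_lim_seq_mult'; [now apply gsum_pow2_lim|].
apply is_lim_seq_ext with (fun n => gsum (7 * a * 2 ^ n)).
- intro n; f_equal; ring.
- apply gsum_pow2_lim; lra.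
Qed.

Lemma prodB_lim a : 0 < a -> is_lim_seq (fun n => prodB (a * 2 ^ n)) 0.
Proof.
intro H; replace (Finite 0) with (Finite (0 * 0 / 2)) by (f_equal; field).
apply (is_lim_seq_scal_r _ (/ 2) (0 * 0)), is_lim_seq_mult'.
- apply is_lim_seq_ext with (fun n => theta2 (a / 2 * 2 ^ n)).
  + intro n; f_equal; field.
  + apply theta2_pow2_lim; lra.
- apply is_lim_seq_ext with (fun n => theta2 (7 * a / 2 * 2 ^ n)).
  + intro n; f_equal; field.
  + apply theta2_pow2_lim; lra.
Qed.

(* The difference D of the two sides satisfies D(c) = - D(2c) by the recurrence,
   and D tends to 0 at infinity. *)
Lemma prod_difference c :
  0 < c -> prodA c - prodA (2 * c) = prodB c - 2 * prodB (2 * c) + 2 * prodB (4 * c).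
Proof.
set (D := fun c => prodA c - prodA (2 * c) - prodB c + 2 * prodB (2 * c) - 2 * prodB (4 * c)).
assert (step : forall x, 0 < x -> D (2 * x) = - D x).
{ intros x Hx; unfold D.
  assert (R1 := prod_recurrence x Hx).
  replace (2 * (2 * x)) with (4 * x) by ring.
  replace (4 * (2 * x)) with (8 * x) by ring. lra. }
intro H.
assert (iter : forall n, Rabs (D (c * 2 ^ n)) = Rabs (D c)).
{ induction n as [|n IH]; [simpl; now rewrite Rmult_1_r|].
  replace (c * 2 ^ S n) with (2 * (c * 2 ^ n)) by (simpl; ring).
  rewrite step, Rabs_Ropp; auto.
  apply Rmult_lt_0_compat; auto; apply pow_lt; lra. }
assert (L : is_lim_seq (fun n => D (c * 2 ^ n)) 0).
{ replace (Finite 0) with (Finite (1 - 1 - 0 + 2 * 0 - 2 * 0)) by (f_equal; ring).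
  assert (E : forall (f : R -> R) k l, 0 < k -> (forall a, 0 < a -> is_lim_seq (fun n => f (a * 2 ^ n)) (Finite l)) ->
    is_lim_seq (fun n => f (k * (c * 2 ^ n))) l).
  { intros f k l Hk Hf; apply is_lim_seq_ext with (fun n => f (k * c * 2 ^ n)).
    - intro n; f_equal; ring.
    - apply Hf; nra. }
  unfold D; apply is_lim_seq_minus'; [apply is_lim_seq_plus'; [apply is_lim_seq_minus';
    [apply is_lim_seq_minus'|]|]|].
  - now apply prodA_lim.
  - apply E; [lra|apply prodA_lim].
  - now apply prodB_lim.
  - apply (is_lim_seq_scal_l _ 2 0), E; [lra|apply prodB_lim].
  - apply (is_lim_seq_scal_l _ 2 0), E; [lra|apply prodB_lim]. }
apply is_lim_seq_abs in L.
apply is_lim_seq_ext with (1 := iter) in L.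
apply is_lim_seq_unique in L; rewrite Lim_seq_const in L.
injection L; rewrite Rabs_R0; intro Z.
apply Rabs_eq_0 in Z; unfold D in Z; lra.
Qed.

(** Adding [prod_difference] at c, 2c and 4c leaves [prodA (8 * c)] and values of [prodB];
    [gsum_septic] at 2c recognises in them the product of the two [theta4]. *)
Lemma theta_septic c :
  0 < c ->
  gsum c * gsum (7 * c) =
  theta4 (2 * c) * theta4 (14 * c) + theta2 (c / 2) * theta2 (7 * c / 2) / 2.
Proof.
intro H.
assert (D1 := prod_difference c H).
assert (D2 := prod_difference (2 * c) ltac:(lra)).
assert (D3 := prod_difference (4 * c) ltac:(lra)).
replace (2 * (2 * c)) with (4 * c) in D2 by ring.
replace (4 * (2 * c)) with (8 * c) in D2 by ring.
replace (2 * (4 * c)) with (8 * c) in D3 by ring.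
replace (4 * (4 * c)) with (16 * c) in D3 by ring.
assert (S := gsum_septic (2 * c) ltac:(lra)).
change (prodA c = theta4 (2 * c) * theta4 (14 * c) + prodB c).
enough (theta4 (2 * c) * theta4 (14 * c) =
  prodA (8 * c) + 2 * prodB (16 * c) - prodB (2 * c) + prodB (4 * c)) by lra.
unfold prodA, prodB, theta2, theta4.
replace (2 * c / 2 / 4) with (2 * c / 8) by field.
replace (7 * (2 * c) / 2 / 4) with (7 * (2 * c) / 8) by field.
replace (4 * c / 2) with (2 * c) by field.
replace (7 * (4 * c) / 2) with (7 * (2 * c)) by field.
replace (16 * c / 2) with (4 * (2 * c)) by field.
replace (7 * (16 * c) / 2) with (28 * (2 * c)) by field.
replace (4 * (2 * c) / 4) with (2 * c) by field.
replace (28 * (2 * c) / 4) with (7 * (2 * c)) by field.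
replace (7 * (8 * c)) with (28 * (2 * c)) by ring.
replace (8 * c) with (4 * (2 * c)) by ring.
replace (4 * (14 * c)) with (28 * (2 * c)) by ring.
replace (14 * c) with (7 * (2 * c)) by ring.
lra.
Qed.

(** * The inversion formula of the theta function *)

(** This is the binomial coefficient C(2m, m + z), the coefficient of x^z in (x + 2 + 1/x)^m.
    Indexing by all integers from the centre makes it symmetric and fit for [zsum]. *)
Fixpoint polya (m : nat) (z : Z) : R :=
  match m with
  | O => if Z.eq_dec z 0 then 1 else 0
  | S m => polya m (z - 1) + 2 * polya m z + polya m (z + 1)
  end.

Lemma polya_support m z : (Z.of_nat m < Z.abs z)%Z -> polya m z = 0.
Proof.
revert z; induction m as [|m IH]; intros z H.
- simpl; destruct (Z.eq_dec z 0); [lia|auto].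
- simpl; rewrite !IH by lia; ring.
Qed.

Lemma polya_nonneg m z : 0 <= polya m z.
Proof.
revert z; induction m as [|m IH]; intro z; simpl.
- destruct (Z.eq_dec z 0); lra.
- generalize (IH (z - 1)%Z) (IH z) (IH (z + 1)%Z); lra.
Qed.

Lemma polya_sym m z : polya m (- z) = polya m z.
Proof.
revert z; induction m as [|m IH]; intro z; simpl.
- destruct (Z.eq_dec z 0), (Z.eq_dec (- z) 0); auto; lia.
- rewrite <- (IH (z - 1)%Z), <- (IH (z + 1)%Z), IH.
  replace (- (z - 1))%Z with (- z + 1)%Z by lia.
  replace (- (z + 1))%Z with (- z - 1)%Z by lia. ring.
Qed.

Lemma polya_center_pos m : 0 < polya m 0.
Proof.
induction m as [|m IH]; [simpl; lra|].
simpl; generalize (polya_nonneg m (-1)) (polya_nonneg m 1); lra.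
Qed.

(** The quotient of neighbouring binomial coefficients, cross-multiplied so that it also holds
    outside the support. *)
Lemma polya_step m z :
  (INR m + IZR z + 1) * polya m (z + 1) = (INR m - IZR z) * polya m z.
Proof.
revert z; induction m as [|m IH]; intro z.
- simpl; destruct (Z.eq_dec z 0) as [->|N]; [destruct (Z.eq_dec (0 + 1) 0); [lia|ring]|].
  destruct (Z.eq_dec (z + 1) 0) as [E|]; [|ring].
  replace z with (-1)%Z by lia; ring.
- rewrite S_INR; simpl polya.
  assert (I0 := IH (z - 1)%Z); assert (I1 := IH z); assert (I2 := IH (z + 1)%Z).
  replace (z - 1 + 1)%Z with z in * by lia.
  replace (z + 1 - 1)%Z with z by lia.
  rewrite minus_IZR in I0; rewrite plus_IZR in I2.
  nra.
Qed.

Lemma ex_series_finite (u : nat -> R) N : (forall n, (N <= n)%nat -> u n = 0) -> ex_series u.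
Proof.
intro H; apply (ex_series_incr_n u N).
apply ex_series_ext with (fun _ => 0).
- intro n; rewrite H; auto; lia.
- exists 0; change (is_lim_seq (sum_n (fun _ => 0)) 0).
  apply is_lim_seq_ext with (fun _ => 0); [|apply is_lim_seq_const].
  intro n; induction n as [|n IH]; [now rewrite sum_O|].
  rewrite sum_Sn, <- IH; unfold plus; simpl; R_eq; ring.
Qed.

Lemma zsummable_finite f N : (forall z, (N < Z.abs z)%Z -> f z = 0) -> zsummable f.
Proof.
intro H; apply ex_series_finite with (Z.to_nat (Z.abs N + 1)); intros n Hn.
rewrite !H by lia; rewrite Rabs_R0; ring.
Qed.

Lemma zsummable_polya m g : zsummable (fun z => polya m z * g z).
Proof.
apply zsummable_finite with (Z.of_nat m); intros z Hz.
rewrite polya_support by auto; ring.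
Qed.

Lemma polya_generating m y :
  zsum (fun z => polya m z * cos (IZR z * y)) = (2 + 2 * cos y) ^ m.
Proof.
induction m as [|m IH].
- assert (S := zsummable_polya 0 (fun z => cos (IZR z * y))).
  rewrite zsum_sym; auto.
  + simpl; rewrite Rmult_0_l, cos_0.
    rewrite (Series_ext _ (fun _ => 0 * 0)).
    2:{ intro n; destruct (Z.eq_dec (Z.of_nat n + 1) 0); [lia|ring]. }
    rewrite Series_scal_l; ring.
  + intro z; rewrite polya_sym, opp_IZR, Ropp_mult_distr_l_reverse, cos_neg; auto.
- simpl pow; rewrite <- IH.
  assert (S0 := zsummable_polya m (fun z => cos (IZR z * y))).
  assert (S1 := zsummable_polya m (fun z => cos (IZR (z + 1) * y))).
  assert (S2 := zsummable_polya m (fun z => cos (IZR (z - 1) * y))).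
  destruct (zshift (-1) _ S1) as [T1 U1]; destruct (zshift 1 _ S2) as [T2 U2].
  rewrite <- zsum_scal.
  rewrite (zsum_ext (fun z => (2 + 2 * cos y) * (polya m z * cos (IZR z * y)))
     (fun z => 2 * (polya m z * cos (IZR z * y)) +
       (polya m z * cos (IZR (z + 1) * y) + polya m z * cos (IZR (z - 1) * y)))).
  2:{ intro z.
      replace (IZR (z + 1) * y) with (IZR z * y + y) by (rewrite plus_IZR; ring).
      replace (IZR (z - 1) * y) with (IZR z * y - y) by (rewrite minus_IZR; ring).
      rewrite cos_plus, cos_minus; ring. }
  rewrite zsum_plus; [|now apply zsummable_scal|now apply zsummable_plus].
  rewrite zsum_plus; auto.
  rewrite <- U1, <- U2, <- zsum_plus, <- zsum_plus; auto.
  2: now apply zsummable_scal.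
  2: now apply zsummable_plus.
  apply zsum_ext; intro z; cbv beta.
  replace (z + -1 + 1)%Z with z by lia; replace (z + 1 - 1)%Z with z by lia.
  simpl polya; change (z + -1)%Z with (z - 1)%Z; ring.
Qed.

Fixpoint rsum (f : nat -> R) (n : nat) : R :=
  match n with O => 0 | S n => rsum f n + f n end.

(** It presents a sum of varying length as a series, to which [tannery] applies. *)
Lemma Series_truncated (f : nat -> R) n :
  Series (fun j => if Nat.ltb j n then f j else 0) = rsum f n.
Proof.
apply is_series_unique.
change (is_lim_seq (sum_n (fun j => if Nat.ltb j n then f j else 0)) (rsum f n)).
apply is_lim_seq_ext_loc with (fun _ => rsum f n); [|apply is_lim_seq_const].
exists n; intros N HN.
assert (P : forall k, sum_n (fun j => if Nat.ltb j n then f j else 0) k = rsum f (Nat.min (S k) n)).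
{ induction k as [|k IH].
  - rewrite sum_O; destruct n; simpl; R_eq; ring.
  - rewrite sum_Sn, IH; unfold plus; cbn -[Nat.min Nat.ltb rsum].
    destruct (Nat.ltb_spec (S k) n).
    + rewrite !Nat.min_l by lia. simpl; R_eq; ring.
    + rewrite !Nat.min_r by lia. R_eq; ring. }
rewrite P, Nat.min_r by lia; auto.
Qed.

Lemma zsum_rsum (F : nat -> Z -> R) n :
  (forall j, zsummable (F j)) ->
  zsummable (fun z => rsum (fun j => F j z) n) /\
  zsum (fun z => rsum (fun j => F j z) n) = rsum (fun j => zsum (F j)) n.
Proof.
intro H; induction n as [|n [I1 I2]]; simpl.
- assert (S : zsummable (fun _ => 0)) by (apply zsummable_finite with 0%Z; auto).
  split; auto.
  rewrite (zsum_ext _ (fun _ => 0 * 0)) by (intro; ring).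
  rewrite zsum_scal; ring.
- split; [now apply zsummable_plus|].
  rewrite zsum_plus; auto. now rewrite I2.
Qed.

Lemma rsum_ext f g n : (forall j, (j < n)%nat -> f j = g j) -> rsum f n = rsum g n.
Proof.
intro H; induction n as [|n IH]; simpl; auto.
rewrite IH, H; auto.
Qed.

Lemma rsum_scal c f n : rsum (fun j => c * f j) n = c * rsum f n.
Proof. induction n as [|n IH]; simpl; [ring|rewrite IH; ring]. Qed.

Lemma dirichlet_kernel n x :
  sin (x / 2) * (1 + 2 * rsum (fun j => cos (INR (S j) * x)) n) = sin ((INR n + / 2) * x).
Proof.
induction n as [|n IH].
- simpl; replace ((0 + / 2) * x) with (x / 2) by field; ring.
- cbn [rsum].
  replace ((INR (S n) + / 2) * x) with (INR (S n) * x + x / 2) by field.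
  replace ((INR n + / 2) * x) with (INR (S n) * x - x / 2) in IH by (rewrite S_INR; field).
  rewrite sin_plus; rewrite sin_minus in IH. lra.
Qed.

(** D is the sum of the z-th powers of all l-th roots of unity; since l is odd, the roots other than
    1 pair off into n cosines. *)
Lemma dirichlet_at_multiple n (z : Z) :
  let l := (2 * n + 1)%nat in
  let D := 1 + 2 * rsum (fun j => cos (IZR z * (2 * PI * INR (S j) / INR l))) n in
  ((Z.of_nat l | z)%Z -> D = INR l) /\ (~ (Z.of_nat l | z)%Z -> D = 0).
Proof.
intros l D.
assert (Hl : 0 < INR l) by (apply lt_0_INR; unfold l; lia).
assert (El : INR l = 2 * INR n + 1) by (unfold l; rewrite plus_INR, mult_INR; simpl; ring).
split.
- intros [k ->]; unfold D.
  rewrite (rsum_ext _ (fun j => 1 * 1)).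
  + rewrite rsum_scal, El.
    assert (rsum (fun _ => 1) n = INR n).
    { clear. induction n as [|n IH]; [reflexivity|]. rewrite S_INR; simpl; now rewrite IH. }
    lra.
  + intros j _; rewrite mult_IZR, <- INR_IZR_INZ.
    replace (IZR k * INR l * (2 * PI * INR (S j) / INR l)) with (2 * IZR (k * Z.of_nat (S j)) * PI).

    * generalize (k * Z.of_nat (S j))%Z; intro q.
      rewrite Rmult_1_l.
      replace (2 * IZR q * PI) with (0 + 2 * IZR q * PI) by ring.
      destruct (Z_le_dec 0 q).
      -- rewrite <- (Z2Nat.id q) by lia; rewrite <- INR_IZR_INZ, cos_period; apply cos_0.
      -- rewrite <- cos_neg.
         replace (- (0 + 2 * IZR q * PI)) with (0 + 2 * IZR (- q) * PI) by (rewrite opp_IZR; ring).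
         rewrite <- (Z2Nat.id (- q)) by lia; rewrite <- INR_IZR_INZ, cos_period; apply cos_0.
    * rewrite mult_IZR, <- INR_IZR_INZ; field; lra.
- intro N.
  assert (K := dirichlet_kernel n (IZR z * (2 * PI / INR l))).
  (* As l = 2n + 1, the right side of the kernel formula is sin (z pi) = 0, while the factor sin (z
     pi / l) vanishes only if l divides z. *)
  replace ((INR n + / 2) * (IZR z * (2 * PI / INR l))) with (IZR z * PI) in K
    by (rewrite El; field; generalize (pos_INR n); lra).
  rewrite (rsum_ext _ (fun j => cos (IZR z * (2 * PI * INR (S j) / INR l)))) in K
    by (intros j _; f_equal; field; lra).
  fold D in K.
  rewrite (sin_eq_0_1 (IZR z * PI)) in K by (now exists z).
  apply Rmult_integral in K; destruct K as [K|K]; auto.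
  exfalso; apply sin_eq_0_0 in K; destruct K as [k Hk]; apply N.
  exists k; apply eq_IZR; rewrite mult_IZR, <- INR_IZR_INZ.
  apply Rmult_eq_reg_r with (PI / INR l).
  + transitivity (IZR k * PI); [rewrite <- Hk; field; lra|field; lra].
  + apply Rgt_not_eq, Rdiv_lt_0_compat; auto; apply PI_RGT_0.
Qed.

Lemma Series_multiples (u : nat -> R) (l : nat) :
  (0 < l)%nat -> ex_series u -> ex_series (fun k => u (l * k)%nat) ->
  (forall n, ~ (Nat.divide l n) -> u n = 0) ->
  Series u = Series (fun k => u (l * k)%nat).
Proof.
intros Hl Hu Hv Hz.
assert (block : forall K i, (i < l)%nat -> sum_n u (l * K + i) = sum_n u (l * K)).
{ intros K i; induction i as [|i IH]; intro Hi; [now rewrite Nat.add_0_r|].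
  rewrite Nat.add_succ_r, sum_Sn, IH by lia.
  rewrite (Hz (S (l * K + i))).
  - unfold plus; simpl; R_eq; ring.
  - intros [q Hq].
    assert (q <= K \/ S K <= q)%nat as [C|C] by lia; nia. }
assert (part : forall K, sum_n u (l * K) = sum_n (fun k => u (l * k)%nat) K).
{ induction K as [|K IH]; [now rewrite Nat.mul_0_r, !sum_O, Nat.mul_0_r|].
  rewrite sum_Sn, <- IH, <- (block K (l - 1)%nat) by lia.
  replace (l * S K)%nat with (S (l * K + (l - 1))) by lia.
  now rewrite sum_Sn. }
assert (L1 : is_lim_seq (fun K => sum_n u (l * K)) (Series u)).
{ apply (is_lim_seq_subseq (sum_n u) (Series u) (fun K => l * K)%nat).
  - apply eventually_subseq; intro n; nia.
  - now apply Series_correct. }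
assert (L2 : is_lim_seq (fun K => sum_n u (l * K)) (Series (fun k => u (l * k)%nat))).
{ apply is_lim_seq_ext with (1 := fun K => eq_sym (part K)). now apply Series_correct. }
apply is_lim_seq_unique in L1; apply is_lim_seq_unique in L2.
rewrite L1 in L2; now injection L2.
Qed.

(** Both sides times 4^m are the sum of [polya m z * D z]. Expanding [D] gives the cosines, because
    2 + 2 cos (2x) = 4 (cos x)^2; restricting to the multiples of l, where [D] is l, gives the
    binomial coefficients. *)
Lemma polya_identity (m n : nat) :
  let l := (2 * n + 1)%nat in
  1 + 2 * rsum (fun j => (cos (PI * INR (S j) / INR l) ^ 2) ^ m) n =
  INR l * (polya m 0 / 4 ^ m) *
  (1 + 2 * Series (fun k => polya m (Z.of_nat (l * S k)) / polya m 0)).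
Proof.
intro l.
assert (Hl : 0 < INR l) by (apply lt_0_INR; unfold l; lia).
set (D := fun z => 1 + 2 * rsum (fun j => cos (IZR z * (2 * PI * INR (S j) / INR l))) n).
assert (DM : forall z, (Z.of_nat l | z)%Z -> D z = INR l) by (intro z; apply dirichlet_at_multiple).
assert (DN : forall z, ~ (Z.of_nat l | z)%Z -> D z = 0) by (intro z; apply dirichlet_at_multiple).
assert (HS : zsummable (fun z => polya m z * D z)) by apply zsummable_polya.
assert (L : zsum (fun z => polya m z * D z) =
  4 ^ m + 2 * rsum (fun j => (2 + 2 * cos (2 * PI * INR (S j) / INR l)) ^ m) n).
{ rewrite (zsum_ext _ (fun z => polya m z * cos (IZR z * 0) +
    2 * rsum (fun j => polya m z * cos (IZR z * (2 * PI * INR (S j) / INR l))) n)).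
  2:{ intro z; rewrite Rmult_0_r, cos_0, rsum_scal; unfold D; ring. }
  destruct (zsum_rsum (fun j z => polya m z * cos (IZR z * (2 * PI * INR (S j) / INR l))) n)
    as [R1 R2].
  { intro j; apply zsummable_polya. }
  rewrite zsum_plus, zsum_scal, R2, polya_generating.
  - rewrite cos_0; replace (2 + 2 * 1) with 4 by ring.
    f_equal; f_equal; apply rsum_ext; intros j _; apply polya_generating.
  - apply zsummable_polya.
  - now apply zsummable_scal. }
assert (M : zsum (fun z => polya m z * D z) =
  INR l * (polya m 0 + 2 * Series (fun k => polya m (Z.of_nat (l * S k))))).
{ rewrite zsum_sym; auto.
  2:{ intro z; rewrite polya_sym; f_equal; unfold D; f_equal; f_equal; apply rsum_ext.
      intros j _; rewrite opp_IZR, Ropp_mult_distr_l_reverse; apply cos_neg. }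
  rewrite DM by (exists 0%Z; lia).
  set (u := fun n => polya m (Z.of_nat n) * D (Z.of_nat n)).
  assert (Eu : forall N, (S m <= N)%nat -> u N = 0).
  { intros N HN; unfold u; rewrite polya_support by lia; ring. }
  assert (Ev : forall N, (S m <= N)%nat -> u (l * N)%nat = 0).
  { intros N HN; apply Eu; unfold l; nia. }
  assert (U : Series u = Series (fun k => u (l * k)%nat)).
  { apply Series_multiples.
    - unfold l; lia.
    - exact (ex_series_finite _ _ Eu).
    - exact (ex_series_finite _ _ Ev).
    - intros N HN; unfold u; rewrite DN; [ring|].
      intros [q Hq]; apply HN; exists (Z.to_nat q).
      assert (0 <= q)%Z by (unfold l in *; nia).
      apply Nat2Z.inj; rewrite Nat2Z.inj_mul, Z2Nat.id; auto. }
  rewrite (Series_incr_1 u) in U by exact (ex_series_finite _ _ Eu).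
  rewrite (Series_incr_1 (fun k => u (l * k)%nat)) in U by exact (ex_series_finite _ _ Ev).
  rewrite Nat.mul_0_r in U.
  assert (V : Series (fun k => u (S k)) = Series (fun k => u (l * S k)%nat)) by lra.
  rewrite (Series_ext (fun n => polya m (Z.of_nat n + 1) * _) (fun k => u (S k))).
  2:{ intro k; unfold u; replace (Z.of_nat k + 1)%Z with (Z.of_nat (S k)) by lia; auto. }
  rewrite V, (Series_ext (fun k => u (l * S k)%nat)
    (fun k => INR l * polya m (Z.of_nat (l * S k)))).
  2:{ intro k; unfold u; rewrite DM; [ring|]. exists (Z.of_nat (S k)); lia. }
  rewrite Series_scal_l; ring. }
assert (P0 := polya_center_pos m).
assert (P4 : 0 < 4 ^ m) by (apply pow_lt; lra).
rewrite (Series_ext _ (fun k => / polya m 0 * polya m (Z.of_nat (l * S k))))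
  by (intro; unfold Rdiv; ring).
rewrite Series_scal_l.
apply Rmult_eq_reg_l with (4 ^ m); [|lra].
transitivity (zsum (fun z => polya m z * D z)).
- rewrite L, Rmult_plus_distr_l, Rmult_1_r; f_equal.
  rewrite (Rmult_comm (4 ^ m)), Rmult_assoc; f_equal.
  rewrite Rmult_comm, <- rsum_scal; apply rsum_ext; intros j _.
  rewrite <- Rpow_mult_distr; f_equal.
  replace (2 * PI * INR (S j) / INR l) with (2 * (PI * INR (S j) / INR l))
    by (field; lra).
  rewrite cos_2a_cos; ring.
- rewrite M; field; lra.
Qed.

Lemma polya_ratio_nonneg m z : 0 <= polya m z / polya m 0.
Proof.
apply Rmult_le_pos; [apply polya_nonneg|left; apply Rinv_0_lt_compat, polya_center_pos].
Qed.

Lemma polya_ratio_step m k :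
  polya m (Z.of_nat (S k)) / polya m 0 =
  (INR m - INR k) / (INR m + INR k + 1) * (polya m (Z.of_nat k) / polya m 0).
Proof.
assert (E := polya_step m (Z.of_nat k)); rewrite <- INR_IZR_INZ in E.
replace (Z.of_nat (S k)) with (Z.of_nat k + 1)%Z by lia.
assert (P := polya_center_pos m).
assert (0 <= INR m) by apply pos_INR; assert (0 <= INR k) by apply pos_INR.
apply Rmult_eq_reg_l with (INR m + INR k + 1); [|lra].
unfold Rdiv; rewrite <- Rmult_assoc, E; field; lra.
Qed.

(** For k < K the factor 1 - (2k + 1) / (m + k + 1) is at most exp (- (2k + 1) / (m + K)), and the
    odd numbers add up to K^2. [K] stays fixed in the denominator while the induction runs on k. *)
Lemma polya_ratio_upper m K :
  (K <= m)%nat ->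
  polya m (Z.of_nat K) / polya m 0 <= exp (- (INR K ^ 2 / (INR m + INR K))).
Proof.
intro HK.
enough (G : forall k, (k <= K)%nat ->
  polya m (Z.of_nat k) / polya m 0 <= exp (- (INR k ^ 2 / (INR m + INR K)))) by (now apply G).
assert (P := polya_center_pos m).
assert (0 <= INR m) by apply pos_INR; assert (0 <= INR K) by apply pos_INR.
induction k as [|k IH]; intro Hk.
- simpl; unfold Rdiv; rewrite Rinv_r by lra.
  rewrite !Rmult_0_l, Ropp_0, exp_0; lra.
- rewrite polya_ratio_step.
  assert (0 <= INR k) by apply pos_INR.
  assert (Hk' : INR k + 1 <= INR K) by (rewrite <- S_INR; apply le_INR; lia).
  assert (HKm : INR K <= INR m) by (apply le_INR; lia).
  replace (- (INR (S k) ^ 2 / (INR m + INR K))) with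
    (- ((2 * INR k + 1) / (INR m + INR K)) + - (INR k ^ 2 / (INR m + INR K)))
    by (rewrite S_INR; field; lra).
  rewrite exp_plus; apply Rmult_le_compat.
  + apply Rdiv_le_0_compat; lra.
  + apply polya_ratio_nonneg.
  + eapply Rle_trans; [|apply exp_ineq1_le].
    replace ((INR m - INR k) / (INR m + INR k + 1)) with
      (1 + - ((2 * INR k + 1) * / (INR m + INR k + 1))) by (field; lra).
    apply Rplus_le_compat_l, Ropp_le_contravar, Rmult_le_compat_l; [lra|].
    apply Rinv_le_contravar; lra.
  + apply IH; lia.
Qed.

(** Here the same factor is written 1 / (1 + (2k + 1) / (m - k)), and m - k >= m - K + 1 for k <
    K. *)
Lemma polya_ratio_lower m K :
  (K <= m)%nat ->
  exp (- (INR K ^ 2 / (INR m - INR K + 1))) <= polya m (Z.of_nat K) / polya m 0.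
Proof.
intro HK.
assert (HKm : INR K <= INR m) by (apply le_INR; lia).
enough (G : forall k, (k <= K)%nat ->
  exp (- (INR k ^ 2 / (INR m - INR K + 1))) <= polya m (Z.of_nat k) / polya m 0) by (now apply G).
assert (P := polya_center_pos m).
induction k as [|k IH]; intro Hk.
- simpl; unfold Rdiv; rewrite Rinv_r by lra.
  rewrite !Rmult_0_l, Ropp_0, exp_0; lra.
- rewrite polya_ratio_step.
  assert (0 <= INR k) by apply pos_INR.
  assert (Hk' : INR k + 1 <= INR K) by (rewrite <- S_INR; apply le_INR; lia).
  replace (- (INR (S k) ^ 2 / (INR m - INR K + 1))) with
    (- ((2 * INR k + 1) / (INR m - INR K + 1)) + - (INR k ^ 2 / (INR m - INR K + 1)))
    by (rewrite S_INR; field; lra).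
  rewrite exp_plus; apply Rmult_le_compat; try (left; apply exp_pos); [|apply IH; lia].
  rewrite exp_Ropp.
  replace ((INR m - INR k) / (INR m + INR k + 1)) with
      (/ (1 + (2 * INR k + 1) * / (INR m - INR k))) by (field; lra).
  apply Rinv_le_contravar.
  + assert (0 < / (INR m - INR k)) by (apply Rinv_0_lt_compat; lra). nra.
  + eapply Rle_trans; [|apply exp_ineq1_le].
    apply Rplus_le_compat_l, Rmult_le_compat_l; [lra|].
    apply Rinv_le_contravar; lra.
Qed.

(** For m = S i this selects an odd l = [width c i] with l^2 / m -> c. Then C(2m, m + l k) / C(2m,
    m) tends to exp (- c k^2), and (cos (pi j / l))^(2m) to exp (- pi^2 j^2 / c). *)
Definition half_width (c : R) (i : nat) : nat := Z.to_nat (up (sqrt (c * INR (S i)) / 2)).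
Definition width (c : R) (i : nat) : nat := (2 * half_width c i + 1)%nat.

Lemma width_bounds c i :
  sqrt (c * INR (S i)) <= INR (width c i) <= sqrt (c * INR (S i)) + 3.
Proof.
unfold width, half_width; set (x := sqrt (c * INR (S i))).
assert (0 <= x) by apply sqrt_pos.
destruct (archimed (x / 2)) as [A1 A2].
assert (Z0 : (0 <= up (x / 2))%Z) by (apply le_IZR; lra).
rewrite plus_INR, mult_INR, (INR_IZR_INZ (Z.to_nat _)), Z2Nat.id by auto.
simpl; lra.
Qed.

Lemma width_pos c i : 1 <= INR (width c i).
Proof. change 1 with (INR 1); apply le_INR; unfold width; lia. Qed.

Lemma inv_sqrt_lim : is_lim_seq (fun i => / sqrt (INR (S i))) 0.
Proof.
apply is_lim_seq_ext with (fun i => sqrt (/ INR (S i))).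
- intro i; apply sqrt_inv.
- rewrite <- sqrt_0; apply is_lim_seq_continuous.
  + apply continuity_pt_sqrt; lra.
  + replace (Finite 0) with (Rbar_inv p_infty) by reflexivity.
    apply is_lim_seq_inv; [|easy].
    apply (is_lim_seq_incr_1 INR), is_lim_seq_INR.
Qed.

Section Width.
Variable c : R.
Hypothesis c_pos : 0 < c.

Let M i := INR (S i).
Let L i := INR (width c i).

Lemma M_pos i : 1 <= M i.
Proof. unfold M; rewrite S_INR; generalize (pos_INR i); lra. Qed.

Lemma width_lim : is_lim_seq (fun i => L i / sqrt (M i)) (sqrt c).
Proof.
apply is_lim_seq_le_le with (fun _ => sqrt c) (fun i => sqrt c + 3 * / sqrt (M i)).
- intro i; destruct (width_bounds c i) as [B1 B2]; fold (M i) in *; fold (L i) in *.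
  generalize (M_pos i); intro.
  assert (0 < sqrt (M i)) by (apply sqrt_lt_R0; lra).
  rewrite sqrt_mult in B1, B2 by lra.
  split; apply Rmult_le_reg_r with (sqrt (M i)); auto.
  + replace (L i / sqrt (M i) * sqrt (M i)) with (L i) by (field; lra); lra.
  + replace (L i / sqrt (M i) * sqrt (M i)) with (L i) by (field; lra).
    rewrite Rmult_plus_distr_r, Rmult_assoc, Rinv_l by lra; lra.
- apply is_lim_seq_const.
- replace (Finite (sqrt c)) with (Finite (sqrt c + 3 * 0)) by (f_equal; ring).
  apply is_lim_seq_plus'; [apply is_lim_seq_const|].
  apply (is_lim_seq_scal_l _ 3 0), inv_sqrt_lim.
Qed.

Lemma width_sq_lim : is_lim_seq (fun i => L i ^ 2 / M i) c.
Proof.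
rewrite <- (sqrt_sqrt c) by lra.
apply is_lim_seq_ext with (fun i => (L i / sqrt (M i)) * (L i / sqrt (M i))).
- intro i; generalize (M_pos i); intro.
  assert (0 < sqrt (M i)) by (apply sqrt_lt_R0; lra).
  rewrite <- (sqrt_sqrt (M i)) at 3 by lra. field; lra.
- apply is_lim_seq_mult'; apply width_lim.
Qed.

Lemma width_over_lim : is_lim_seq (fun i => L i / M i) 0.
Proof.
replace (Finite 0) with (Finite (sqrt c * 0)) by (f_equal; ring).
apply is_lim_seq_ext with (fun i => (L i / sqrt (M i)) * / sqrt (M i)).
- intro i; generalize (M_pos i); intro.
  assert (0 < sqrt (M i)) by (apply sqrt_lt_R0; lra).
  rewrite <- (sqrt_sqrt (M i)) at 3 by lra. field; lra.
- apply is_lim_seq_mult'; [apply width_lim|apply inv_sqrt_lim].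
Qed.

Lemma inv_width_lim : is_lim_seq (fun i => / L i) 0.
Proof.
replace (Finite 0) with (Finite (/ sqrt c * 0)) by (f_equal; ring).
apply is_lim_seq_ext with (fun i => / (L i / sqrt (M i)) * / sqrt (M i)).
- intro i; generalize (M_pos i) (width_pos c i); fold (L i); intros.
  assert (0 < sqrt (M i)) by (apply sqrt_lt_R0; lra).
  field; lra.
- apply is_lim_seq_mult'; [|apply inv_sqrt_lim].
  apply (is_lim_seq_inv _ (Finite (sqrt c))); [apply width_lim|].
  intro E; injection E; apply Rgt_not_eq, sqrt_lt_R0, c_pos.
Qed.

Lemma width_sq_lower i : c * M i <= L i ^ 2.
Proof.
destruct (width_bounds c i) as [B1 _]; fold (M i) in *; fold (L i) in *.
generalize (M_pos i); intro.
rewrite <- (sqrt_sqrt (c * M i)) by nra.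
assert (0 <= sqrt (c * M i)) by apply sqrt_pos. nra.
Qed.

Lemma width_sq_upper i : L i ^ 2 <= M i * (2 * c + 18).
Proof.
destruct (width_bounds c i) as [_ B2]; fold (M i) in *; fold (L i) in *.
generalize (M_pos i) (width_pos c i); fold (L i); intros.
assert (Q : sqrt (c * M i) * sqrt (c * M i) = c * M i) by (apply sqrt_sqrt; nra).
assert (0 <= sqrt (c * M i)) by apply sqrt_pos.
assert (L i ^ 2 <= (sqrt (c * M i) + 3) ^ 2) by nra.
(* This gives (x + 3)^2 <= 2 x^2 + 18 for x = sqrt (c * M i); then 18 <= 18 * M i. *)
assert (0 <= (sqrt (c * M i) - 3) ^ 2) by apply pow2_ge_0. nra.
Qed.

Lemma ex_series_gauss d : 0 < d -> ex_series (fun k => gauss d (Z.of_nat k + 1)).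
Proof.
intro Hd; destruct (zshift 1 _ (zsummable_gauss d Hd)) as [S1 _].
apply zsummable_split in S1; now apply ex_series_Rabs.
Qed.

Lemma polya_side_lim :
  is_lim_seq (fun i => 1 + 2 * Series (fun k =>
     polya (S i) (Z.of_nat (width c i * S k)) / polya (S i) 0)) (gsum c).
Proof.
rewrite gsum_sym by auto.
apply is_lim_seq_plus'; [apply is_lim_seq_const|].
apply (is_lim_seq_scal_l _ 2 (Finite _)).
(* If K = L i * s <= M i, then K^2 / (M i + K) >= K^2 / (2 * M i) >= (c / 2) s^2, which explains the
   halved c. If K > M i, the binomial coefficient vanishes. *)
apply tannery with (fun k => gauss (c / 2) (Z.of_nat k + 1)).
- apply ex_series_gauss; lra.
- intros i k; rewrite Rabs_pos_eq by apply polya_ratio_nonneg.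
  destruct (le_lt_dec (width c i * S k) (S i)) as [H|H].
  + eapply Rle_trans; [now apply polya_ratio_upper|].
    unfold gauss; rewrite mult_INR; fold (M i); fold (L i).
    replace (Z.of_nat k + 1)%Z with (Z.of_nat (S k)) by lia; rewrite <- INR_IZR_INZ.
    set (s := INR (S k)).
    assert (0 < s) by (apply lt_0_INR; lia).
    assert (HK : L i * s <= M i) by (unfold L, M, s; rewrite <- mult_INR; now apply le_INR).
    generalize (M_pos i) (width_pos c i) (width_sq_lower i); fold (L i); intros.
    assert (0 < L i * s) by nra.
    assert (HE : - ((L i * s) ^ 2 / (M i + L i * s)) <= - (c / 2) * s ^ 2).
    { rewrite <- Ropp_mult_distr_l; apply Ropp_le_contravar.
      apply Rmult_le_reg_r with (M i + L i * s); [lra|].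
      replace ((L i * s) ^ 2 / (M i + L i * s) * (M i + L i * s)) with (L i ^ 2 * s ^ 2) by (field; lra).
      assert (0 <= s ^ 2) by apply pow2_ge_0.
      apply Rle_trans with (c * M i * s ^ 2); [|nra].
      apply Rle_trans with (c / 2 * s ^ 2 * (2 * M i)); [|nra].
      apply Rmult_le_compat_l; [|lra]. nra. }
    destruct HE as [HE|HE]; [left; now apply exp_increasing|rewrite HE; lra].
  + rewrite polya_support by lia; unfold Rdiv; rewrite Rmult_0_l; left; apply exp_pos.
- intro k; unfold gauss.
  replace (Z.of_nat k + 1)%Z with (Z.of_nat (S k)) by lia; rewrite <- INR_IZR_INZ.
  set (s := INR (S k)).
  assert (Hs : 0 < s) by (apply lt_0_INR; lia).
  assert (KM : is_lim_seq (fun i => L i * s / M i) 0).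
  { replace (Finite 0) with (Finite (0 * s)) by (f_equal; ring).
    apply is_lim_seq_ext with (fun i => L i / M i * s).
    - intro i; field; generalize (M_pos i); lra.
    - apply (is_lim_seq_scal_r _ s 0), width_over_lim. }
  assert (KK : is_lim_seq (fun i => (L i * s) ^ 2 / M i) (c * s ^ 2)).
  { apply is_lim_seq_ext with (fun i => L i ^ 2 / M i * s ^ 2).
    - intro i; field; generalize (M_pos i); lra.
    - apply (is_lim_seq_scal_r _ (s ^ 2) c), width_sq_lim. }
  assert (IM : is_lim_seq (fun i => / M i) 0).
  { replace (Finite 0) with (Finite (0 * 0)) by (f_equal; ring).
    apply is_lim_seq_ext with (fun i => / sqrt (M i) * / sqrt (M i)).
    - intro i; rewrite <- Rinv_mult, sqrt_sqrt; auto; generalize (M_pos i); lra.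
    - apply is_lim_seq_mult'; apply inv_sqrt_lim. }
  assert (ev : eventually (fun i => (width c i * S k <= S i)%nat)).
  { apply is_lim_seq_spec in KM; destruct (KM (mkposreal 1 Rlt_0_1)) as [N HN].
    exists N; intros i Hi; specialize (HN i Hi); simpl in HN.
    rewrite Rminus_0_r in HN; apply Rabs_def2 in HN; destruct HN as [HN _].
    apply INR_le; rewrite mult_INR; fold (M i); fold (L i); fold s.
    generalize (M_pos i); intro.
    apply Rmult_lt_compat_r with (r := M i) in HN; [|lra].
    replace (L i * s / M i * M i) with (L i * s) in HN by (field; lra). lra. }
  apply is_lim_seq_le_le_loc with
    (u := fun i => exp (- (((L i * s) ^ 2 / M i) / (1 - L i * s / M i + / M i))))
    (w := fun i => exp (- (((L i * s) ^ 2 / M i) / (1 + L i * s / M i)))).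
  + destruct ev as [N HN]; exists N; intros i Hi; specialize (HN i Hi).
    assert (U := polya_ratio_upper _ _ HN); assert (V := polya_ratio_lower _ _ HN).
    rewrite mult_INR in U, V; fold (M i) in U, V; fold (L i) in U, V; fold s in U, V.
    assert (HK : L i * s <= M i) by (unfold L, M, s; rewrite <- mult_INR; now apply le_INR).
    generalize (M_pos i) (width_pos c i); fold (L i); intros.
    assert (0 < L i * s) by nra.
    replace ((L i * s) ^ 2 / M i / (1 - L i * s / M i + / M i)) with
      ((L i * s) ^ 2 / (M i - L i * s + 1)) by (field; lra).
    replace ((L i * s) ^ 2 / M i / (1 + L i * s / M i)) with
      ((L i * s) ^ 2 / (M i + L i * s)) by (field; lra).
    lra.
  + replace (- c * s ^ 2) with (- (c * s ^ 2 / (1 - 0 + 0))) by field.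
    apply is_lim_seq_continuous; [apply derivable_continuous_pt, derivable_pt_exp|].
    refine (proj1 (is_lim_seq_opp _ (Finite (c * s ^ 2 / (1 - 0 + 0)))) _).
    apply is_lim_seq_div'; auto; [|lra].
    apply is_lim_seq_plus'; auto; apply is_lim_seq_minus'; auto; apply is_lim_seq_const.
  + replace (- c * s ^ 2) with (- (c * s ^ 2 / (1 + 0))) by field.
    apply is_lim_seq_continuous; [apply derivable_continuous_pt, derivable_pt_exp|].
    refine (proj1 (is_lim_seq_opp _ (Finite (c * s ^ 2 / (1 + 0)))) _).
    apply is_lim_seq_div'; auto; [|lra].
    apply is_lim_seq_plus'; auto; apply is_lim_seq_const.
Qed.

(** From sin x >= x - x^3 / 6 and x^2 <= 4. The range contains [0, pi / 2], where the angles pi (j +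
    1) / l with j < n lie. *)
Lemma sin_ge_third x : 0 <= x <= 2 -> x / 3 <= sin x.
Proof.
intros [H1 H2].
destruct (sin_bound x 0) as [B _]; try (generalize PI2_3_2; lra).
unfold sin_approx, sin_term in B; simpl in B.
nra.
Qed.

Lemma cos_sq_pow_upper x m : (cos x ^ 2) ^ m <= exp (- (INR m * sin x ^ 2)).
Proof.
replace (- (INR m * sin x ^ 2)) with (INR m * - (sin x ^ 2)) by ring.
rewrite <- exp_pow; apply pow_incr; split; [apply pow2_ge_0|].
eapply Rle_trans; [|apply exp_ineq1_le].
generalize (sin2_cos2 x); unfold Rsqr; nra.
Qed.

(** 1 / cos^2 = 1 + tan^2 <= exp (tan^2). *)
Lemma cos_sq_pow_lower x m :
  cos x <> 0 -> exp (- (INR m * (sin x ^ 2 / cos x ^ 2))) <= (cos x ^ 2) ^ m.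
Proof.
intro H.
replace (- (INR m * (sin x ^ 2 / cos x ^ 2))) with (INR m * - (sin x ^ 2 / cos x ^ 2)) by ring.
rewrite <- exp_pow; apply pow_incr; split; [left; apply exp_pos|].
assert (P : 0 < cos x ^ 2) by (apply pow2_gt_0; auto).
rewrite exp_Ropp.
replace (cos x ^ 2) with (/ (/ cos x ^ 2)) at 2 by (field; auto).
apply Rinv_le_contravar; [now apply Rinv_0_lt_compat|].
eapply Rle_trans; [|apply exp_ineq1_le].
right; generalize (sin2_cos2 x); unfold Rsqr; intro E.
replace (1 + sin x ^ 2 / cos x ^ 2) with ((sin x * sin x + cos x * cos x) / cos x ^ 2)
  by (field; auto).
rewrite E; unfold Rdiv; ring.
Qed.
Lemma cos_side_lim :
  is_lim_seq (fun i => 1 + 2 * rsum (fun j =>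
     (cos (PI * INR (S j) / INR (width c i)) ^ 2) ^ S i) (half_width c i)) (gsum (PI ^ 2 / c)).
Proof.
assert (HPI := PI_RGT_0).
rewrite gsum_sym by (apply Rdiv_lt_0_compat; nra).
apply is_lim_seq_plus'; [apply is_lim_seq_const|].
apply (is_lim_seq_scal_l _ 2 (Finite _)).
apply is_lim_seq_ext with (fun i => Series (fun j => if Nat.ltb j (half_width c i)
  then (cos (PI * INR (S j) / INR (width c i)) ^ 2) ^ S i else 0)).
{ intro i; apply Series_truncated. }
(* The 9 is the square of the 3 in [sin_ge_third]; 2 c + 18 comes from [width_sq_upper]. *)
set (d := PI ^ 2 / (9 * (2 * c + 18))).
assert (Hd : 0 < d) by (apply Rdiv_lt_0_compat; nra).
apply tannery with (fun k => gauss d (Z.of_nat k + 1)).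
- now apply ex_series_gauss.
- intros i k; unfold gauss.
  replace (Z.of_nat k + 1)%Z with (Z.of_nat (S k)) by lia; rewrite <- INR_IZR_INZ.
  destruct (Nat.ltb_spec k (half_width c i)) as [H|H].
  2:{ rewrite Rabs_R0; left; apply exp_pos. }
  rewrite Rabs_pos_eq by (apply pow_le, pow2_ge_0).
  eapply Rle_trans; [apply cos_sq_pow_upper|].
  fold (M i); fold (L i); set (s := INR (S k)).
  assert (Hs : 0 < s) by (apply lt_0_INR; lia).
  generalize (M_pos i) (width_pos c i) (width_sq_upper i); fold (L i); intros H1 H2 H3.
  assert (HL : 2 * s <= L i).
  { unfold s, L; change 2 with (INR 2); rewrite <- mult_INR; apply le_INR; unfold width; lia. }
  set (x := PI * s / L i).
  assert (Ex : x * L i = PI * s) by (unfold x; field; lra).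
  assert (Hx : 0 <= x <= 2).
  { split; [apply Rdiv_le_0_compat; nra|].
    apply Rmult_le_reg_r with (L i); [lra|]. rewrite Ex. generalize PI_4; nra. }
  assert (B := sin_ge_third x Hx).
  assert (HE : - (M i * sin x ^ 2) <= - d * s ^ 2).
  { rewrite <- Ropp_mult_distr_l; apply Ropp_le_contravar.
    apply Rle_trans with (M i * (x / 3) ^ 2).
    - apply Rmult_le_reg_r with (9 * (2 * c + 18) * L i ^ 2); [nra|].
      replace (d * s ^ 2 * (9 * (2 * c + 18) * L i ^ 2)) with ((PI * s) ^ 2 * L i ^ 2)
        by (unfold d; field; lra).
      replace (M i * (x / 3) ^ 2 * (9 * (2 * c + 18) * L i ^ 2)) with
        ((x * L i) ^ 2 * (M i * (2 * c + 18))) by field.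
      rewrite Ex; apply Rmult_le_compat_l; [apply pow2_ge_0|auto].
    - apply Rmult_le_compat_l; [lra|]. apply pow_incr; lra. }
  destruct HE as [HE|HE]; [left; now apply exp_increasing|rewrite HE; lra].
- intro k; unfold gauss.
  replace (Z.of_nat k + 1)%Z with (Z.of_nat (S k)) by lia; rewrite <- INR_IZR_INZ.
  set (s := INR (S k)).
  assert (Hs : 0 < s) by (apply lt_0_INR; lia).
  set (x := fun i => PI * s / L i).
  assert (Lpos : forall i, 1 <= L i) by (intro; apply width_pos).
  assert (xpos : forall i, 0 < x i) by (intro i; generalize (Lpos i); intro; apply Rdiv_lt_0_compat; nra).
  assert (Lx : is_lim_seq x 0).
  { replace (Finite 0) with (Finite (PI * s * 0)) by (f_equal; ring).
    apply (is_lim_seq_scal_l _ (PI * s) 0), inv_width_lim. }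
  assert (Lxx : is_lim_seq (fun i => M i * x i ^ 2) (PI ^ 2 / c * s ^ 2)).
  { replace (PI ^ 2 / c * s ^ 2) with (PI ^ 2 * s ^ 2 * / c) by (field; lra).
    apply is_lim_seq_ext with (fun i => PI ^ 2 * s ^ 2 * / (L i ^ 2 / M i)).
    - intro i; unfold x; generalize (Lpos i) (M_pos i); intros; field; lra.
    - apply (is_lim_seq_scal_l _ (PI ^ 2 * s ^ 2) (Finite (/ c))).
      apply (is_lim_seq_inv _ (Finite c)); [apply width_sq_lim|].
      intro E; injection E; lra. }
  assert (Lsinc : is_lim_seq (fun i => sin (x i) / x i) 1).
  { apply (is_lim_comp_seq (fun y => sin y / y) x 0 1); auto.
    - apply is_lim_sinc_0.
    - exists 0%nat; intros i _ E; injection E; generalize (xpos i); lra. }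
  assert (Lsin : is_lim_seq (fun i => M i * sin (x i) ^ 2) (PI ^ 2 / c * s ^ 2)).
  { replace (PI ^ 2 / c * s ^ 2) with (PI ^ 2 / c * s ^ 2 * (1 * 1)) by ring.
    apply is_lim_seq_ext with (fun i => M i * x i ^ 2 * (sin (x i) / x i * (sin (x i) / x i))).
    - intro i; generalize (xpos i); intro; field; lra.
    - apply is_lim_seq_mult'; auto; apply is_lim_seq_mult'; auto. }
  assert (Lcos : is_lim_seq (fun i => cos (x i)) 1).
  { rewrite <- cos_0; apply is_lim_seq_continuous; auto; apply continuity_cos. }
  apply is_lim_seq_le_le_loc with
    (u := fun i => exp (- (M i * (sin (x i) ^ 2 / cos (x i) ^ 2))))
    (w := fun i => exp (- (M i * sin (x i) ^ 2))).
  + assert (E1 : eventually (fun i => cos (x i) <> 0)).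
    { apply is_lim_seq_spec in Lcos; destruct (Lcos (mkposreal 1 Rlt_0_1)) as [N HN].
      exists N; intros i Hi E; specialize (HN i Hi); simpl in HN; rewrite E in HN.
      rewrite Rabs_left in HN; lra. }
    assert (E2 : eventually (fun i => (k < half_width c i)%nat)).
    { assert (LL := inv_width_lim); apply is_lim_seq_spec in LL.
      assert (P3 : 0 < / (2 * s + 1)) by (apply Rinv_0_lt_compat; lra).
      destruct (LL (mkposreal _ P3)) as [N HN].
      exists N; intros i Hi; specialize (HN i Hi); simpl in HN; rewrite Rminus_0_r in HN.
      apply Rabs_def2 in HN; destruct HN as [HN _].
      apply Rinv_lt_cancel in HN; [|generalize (Lpos i); lra].
      unfold L, s in HN; change 2 with (INR 2) in HN; change 1 with (INR 1) in HN.
      rewrite <- mult_INR, <- plus_INR in HN; apply INR_lt in HN; unfold width in HN; lia. }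
    destruct E1 as [N1 E1]; destruct E2 as [N2 E2]; exists (N1 + N2)%nat; intros i Hi.
    specialize (E1 i ltac:(lia)); specialize (E2 i ltac:(lia)).
    apply Nat.ltb_lt in E2; rewrite E2; split.
    * apply cos_sq_pow_lower, E1.
    * apply cos_sq_pow_upper.
  + rewrite <- Ropp_mult_distr_l.
    apply is_lim_seq_continuous; [apply derivable_continuous_pt, derivable_pt_exp|].
    refine (proj1 (is_lim_seq_opp _ (Finite (PI ^ 2 / c * s ^ 2))) _).
    replace (PI ^ 2 / c * s ^ 2) with (PI ^ 2 / c * s ^ 2 / (1 * 1)) by (field; lra).
    apply is_lim_seq_ext with (fun i => M i * sin (x i) ^ 2 / (cos (x i) * cos (x i))).
    * intro i; unfold Rdiv; rewrite Rmult_assoc; do 3 f_equal; ring.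
    * apply is_lim_seq_div'; [exact Lsin|exact (is_lim_seq_mult' _ _ _ _ Lcos Lcos)|lra].
  + rewrite <- Ropp_mult_distr_l.
    apply is_lim_seq_continuous; [apply derivable_continuous_pt, derivable_pt_exp|].
    refine (proj1 (is_lim_seq_opp _ (Finite (PI ^ 2 / c * s ^ 2))) Lsin).
Qed.

(** [polya_identity] solved for the central coefficient. The point is that the sequence on the left
    does not involve c, while its limit is expressed through c. *)
Lemma center_lim :
  is_lim_seq (fun i => sqrt (M i) * (polya (S i) 0 / 4 ^ S i))
    (gsum (PI ^ 2 / c) / gsum c / sqrt c).
Proof.
assert (G : 1 <= gsum c) by (now apply gsum_bounds).
assert (Q : 0 < sqrt c) by (now apply sqrt_lt_R0).
apply is_lim_seq_ext_loc with (fun i =>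
  (1 + 2 * rsum (fun j => (cos (PI * INR (S j) / INR (width c i)) ^ 2) ^ S i) (half_width c i)) /
  (1 + 2 * Series (fun k => polya (S i) (Z.of_nat (width c i * S k)) / polya (S i) 0)) /
  (L i / sqrt (M i))).
(* The denominator tends to [gsum c >= 1]; once within 1 of this limit it is positive. *)
- assert (LL := polya_side_lim); apply is_lim_seq_spec in LL.
  destruct (LL (mkposreal 1 Rlt_0_1)) as [N HN]; exists N; intros i Hi.
  specialize (HN i Hi); simpl pos in HN; apply Rabs_def2 in HN; destruct HN as [_ HN].
  generalize (M_pos i) (width_pos c i); fold (L i); intros.
  assert (0 < sqrt (M i)) by (apply sqrt_lt_R0; lra).
  assert (ID := polya_identity (S i) (half_width c i)); cbv zeta in ID.
  change (2 * half_width c i + 1)%nat with (width c i) in ID.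
  fold (L i) in ID; rewrite ID.
  assert (0 < 4 ^ S i) by (apply pow_lt; lra).
  field; repeat split; lra.
- apply is_lim_seq_div'; [apply is_lim_seq_div'| |]; try lra.
  + apply cos_side_lim.
  + apply polya_side_lim.
  + apply width_lim.
Qed.
End Width.

(** The sequence of [center_lim] has the same limit for c and for pi. At pi the two theta values
    coincide, so the common limit is 1 / sqrt PI. *)
Lemma gsum_inversion c : 0 < c -> gsum (PI ^ 2 / c) = sqrt (c / PI) * gsum c.
Proof.
intro H; assert (HPI := PI_RGT_0).
assert (L1 := center_lim c H); assert (L2 := center_lim PI HPI).
apply is_lim_seq_unique in L1; apply is_lim_seq_unique in L2.
rewrite L1 in L2.
assert (E : gsum (PI ^ 2 / c) / gsum c / sqrt c = gsum (PI ^ 2 / PI) / gsum PI / sqrt PI)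
  by (now injection L2).
replace (PI ^ 2 / PI) with PI in E by (field; lra).
assert (G : 1 <= gsum c) by (now apply gsum_bounds).
assert (G' : 1 <= gsum PI) by (now apply gsum_bounds).
assert (Q : 0 < sqrt c) by (now apply sqrt_lt_R0).
assert (Q' : 0 < sqrt PI) by (now apply sqrt_lt_R0).
rewrite sqrt_div by lra.
replace (gsum (PI ^ 2 / c)) with (gsum (PI ^ 2 / c) / gsum c / sqrt c * (gsum c * sqrt c)) by (field; lra).
rewrite E; field; lra.
Qed.

(** * Product formulas *)

Fixpoint rprod (f : nat -> R) (n : nat) : R :=
  match n with O => 1 | S n => rprod f n * f n end.

Lemma rprod_pos f n : (forall j, 0 < f j) -> 0 < rprod f n.
Proof. intro H; induction n; simpl; [lra|]. now apply Rmult_lt_0_compat. Qed.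

Lemma rprod_ext f g n : (forall j, f j = g j) -> rprod f n = rprod g n.
Proof. intro H; induction n as [|n IH]; simpl; auto; now rewrite IH, H. Qed.

Lemma rprod_mult f g n : rprod (fun j => f j * g j) n = rprod f n * rprod g n.
Proof. induction n as [|n IH]; simpl; [ring|rewrite IH; ring]. Qed.

Lemma rprod_le_exp x n :
  (forall j, 0 <= x j) -> rprod (fun j => 1 + x j) n <= exp (rsum x n).
Proof.
intro H; induction n as [|n IH]; simpl; [rewrite exp_0; lra|].
rewrite exp_plus; apply Rmult_le_compat; auto.
- left; apply rprod_pos; intro j; generalize (H j); lra.
- generalize (H n); lra.
- apply exp_ineq1_le.
Qed.

Lemma rsum_le f g n : (forall j, f j <= g j) -> rsum f n <= rsum g n.
Proof. intro H; induction n as [|n IH]; simpl; [lra|generalize (H n); lra]. Qed.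

Lemma rsum_geom q n : 0 < q < 1 -> rsum (fun j => q ^ j) n <= / (1 - q).
Proof.
intro H; assert (E : (1 - q) * rsum (fun j => q ^ j) n = 1 - q ^ n).
{ induction n as [|n IH]; simpl; [ring|]. rewrite Rmult_plus_distr_l, IH; ring. }
apply Rmult_le_reg_l with (1 - q); [lra|].
rewrite E, Rinv_r by lra. generalize (pow_lt q n); lra.
Qed.

Lemma pow_decr q m n : 0 < q < 1 -> (m <= n)%nat -> q ^ n <= q ^ m.
Proof.
intros H L; replace n with (m + (n - m))%nat by lia; rewrite pow_add.
rewrite <- (Rmult_1_r (q ^ m)) at 2; apply Rmult_le_compat_l; [apply pow_le; lra|].
rewrite <- (pow1 (n - m)); apply pow_incr; lra.
Qed.

Lemma chi_lim q : 0 < q < 1 ->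
  is_lim_seq (rprod (fun j => 1 + q ^ (2 * j + 1))) (chi q) /\ 1 <= chi q.
Proof.
intro H; set (X := rprod (fun j => 1 + q ^ (2 * j + 1))).
assert (P : forall j, 0 < q ^ (2 * j + 1)) by (intro; apply pow_lt; lra).
assert (Xpos : forall n, 0 < X n) by (intro; apply rprod_pos; intro j; generalize (P j); lra).
assert (incr : forall n, X n <= X (S n)).
{ intro n; unfold X; cbn [rprod]; fold (X n); generalize (Xpos n) (P n); intros; nra. }
destruct (ex_finite_lim_seq_incr X (exp (/ (1 - q)))) as [l Hl]; auto.
{ intro n; eapply Rle_trans; [apply rprod_le_exp; intro; left; apply P|].
  assert (rsum (fun j => q ^ (2 * j + 1)) n <= / (1 - q)).
  { eapply Rle_trans; [|apply (rsum_geom q n H)]. apply rsum_le; intro j.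
    apply pow_decr; auto; lia. }
  destruct H0 as [H0|H0]; [left; now apply exp_increasing|rewrite H0; lra]. }
assert (E : chi q = l).
(* [prod_f_R0 _ n] has n + 1 factors and [rprod _ n] has n, hence the shift to [S n]. *)
{ unfold chi; rewrite (Lim_seq_ext _ (fun n => X (S n))).
  - apply is_lim_seq_incr_1 in Hl; apply is_lim_seq_unique in Hl; now rewrite Hl.
  - intro n; induction n as [|n IH]; [unfold X; cbn [rprod prod_f_R0]; ring|].
    change (prod_f_R0 (fun k => 1 + q ^ (2 * k + 1)) (S n)) with
      (prod_f_R0 (fun k => 1 + q ^ (2 * k + 1)) n * (1 + q ^ (2 * S n + 1))).
    rewrite IH; reflexivity. }
rewrite E; split; auto.
apply (is_lim_seq_le (fun _ => 1) X 1 l); auto; [|apply is_lim_seq_const].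
induction n as [|n IH]; [unfold X; simpl; lra|generalize (incr n); lra].
Qed.

(* With U n = prod_(j < n) (1 - q^(2j+2)) the product equals U (2n) / U n. *)
Lemma euler_lim q : 0 < q < 1 ->
  is_lim_seq (fun n => rprod (fun j => 1 + q ^ (2 * j + 1)) n *
    rprod (fun j => 1 - q ^ (2 * j + 1)) n * rprod (fun j => 1 + q ^ (2 * j + 2)) n) 1.
Proof.
intro H; set (U := rprod (fun j => 1 - q ^ (2 * j + 2))).
assert (P : forall j, 0 < q ^ j) by (intro; apply pow_lt; lra).
assert (P1 : forall j, q ^ (2 * j + 2) <= q).
{ intro j; rewrite <- (pow_1 q) at 2; apply pow_decr; auto; lia. }
assert (Upos : forall n, 0 < U n) by (intro; apply rprod_pos; intro j; generalize (P1 j); lra).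
assert (Udecr : forall n, U (S n) <= U n).
{ intro n; change (U n * (1 - q ^ (2 * n + 2)) <= U n).
  generalize (Upos n) (P (2 * n + 2)%nat); generalize (U n) (q ^ (2 * n + 2)); intros; nra. }
(* A positive lower bound keeps the limit of U away from 0, so that U (2n) / U n tends to 1. Each
   factor satisfies 1 - x >= exp (- x / (1 - x)), and x / (1 - x) <= q^n / (1 - q). *)
assert (Ulow : forall n, exp (- (/ (1 - q) * / (1 - q))) <= U n).
{ intro n; apply Rle_trans with (exp (- rsum (fun j => / (1 - q) * q ^ j) n)).
  - rewrite rsum_scal.
    assert (HH : - (/ (1 - q) * / (1 - q)) <= - (/ (1 - q) * rsum (fun j => q ^ j) n)).
    { apply Ropp_le_contravar, Rmult_le_compat_l; [|now apply rsum_geom].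
      left; apply Rinv_0_lt_compat; lra. }
    destruct HH as [HH|HH]; [left; now apply exp_increasing|rewrite HH; apply Rle_refl].
  - induction n as [|n IH]; cbn [rsum]; [rewrite Ropp_0, exp_0; unfold U; simpl; lra|].
    rewrite Ropp_plus_distr, exp_plus; change (U (S n)) with (U n * (1 - q ^ (2 * n + 2))).
    apply Rmult_le_compat; try (left; apply exp_pos); auto.
    set (x := q ^ (2 * n + 2)).
    assert (Hx : 0 < x <= q ^ n) by (split; [apply P|apply pow_decr; auto; lia]).
    assert (x <= q) by apply P1.
    rewrite exp_Ropp; replace (1 - x) with (/ (1 + x / (1 - x))) by (field; lra).
    apply Rinv_le_contravar.
    + assert (0 <= x / (1 - x)) by (apply Rdiv_le_0_compat; lra). lra.
    + eapply Rle_trans; [|apply exp_ineq1_le].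
      apply Rplus_le_compat_l; unfold Rdiv; rewrite Rmult_comm.
      apply Rmult_le_compat; try lra.
      * left; apply Rinv_0_lt_compat; lra.
      * apply Rinv_le_contravar; lra. }
destruct (ex_finite_lim_seq_decr U _ Udecr Ulow) as [l Hl].
assert (lpos : 0 < l).
{ eapply Rlt_le_trans; [apply (exp_pos (- (/ (1 - q) * / (1 - q))))|].
  apply (is_lim_seq_le (fun _ => exp (- (/ (1 - q) * / (1 - q)))) U (Finite _) l); auto.
  apply is_lim_seq_const. }
assert (E : forall n, U (2 * n)%nat = rprod (fun j => 1 + q ^ (2 * j + 1)) n *
    rprod (fun j => 1 - q ^ (2 * j + 1)) n * rprod (fun j => 1 + q ^ (2 * j + 2)) n * U n).
{ induction n as [|n IH]; [unfold U; simpl; ring|].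
  replace (2 * S n)%nat with (S (S (2 * n))) by lia; unfold U in *; cbn [rprod]; rewrite IH.
  replace (q ^ (2 * (2 * n) + 2)) with (q ^ (2 * n + 1) * q ^ (2 * n + 1))
    by (rewrite <- pow_add; f_equal; lia).
  replace (q ^ (2 * S (2 * n) + 2)) with (q ^ (2 * n + 2) * q ^ (2 * n + 2))
    by (rewrite <- pow_add; f_equal; lia).
  ring. }
apply is_lim_seq_ext with (fun n => U (2 * n)%nat / U n).
- intro n; rewrite E; generalize (Upos n); intro; field; lra.
- replace (Finite 1) with (Finite (l / l)) by (f_equal; field; lra).
  apply is_lim_seq_div'; auto; [|lra].
  apply (is_lim_seq_subseq U l (fun n => 2 * n)%nat); auto.
  apply eventually_subseq; intro n; lia.
Qed.

(** * The triple product as a limit of finite products *)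

(** The coefficient of w^k in the product of (1 + w q^(2j+1)) (1 + q^(2j+1) / w) over j < n, that is
    q^(k^2) times the Gaussian binomial coefficient (2n, n + k) in base q^2. At q = 1 it is
    [polya]. *)
Fixpoint jacobi (q : R) (n : nat) (k : Z) : R :=
  match n with
  | O => if Z.eq_dec k 0 then 1 else 0
  | S n => (1 + (q ^ (2 * n + 1)) ^ 2) * jacobi q n k +
           q ^ (2 * n + 1) * (jacobi q n (k - 1) + jacobi q n (k + 1))
  end.

Lemma jacobi_support q n k : (Z.of_nat n < Z.abs k)%Z -> jacobi q n k = 0.
Proof.
revert k; induction n as [|n IH]; intros k H; cbn [jacobi].
- destruct (Z.eq_dec k 0); [lia|auto].
- rewrite !IH by lia; ring.
Qed.

Lemma jacobi_sym q n k : jacobi q n (- k) = jacobi q n k.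
Proof.
revert k; induction n as [|n IH]; intro k; cbn [jacobi].
- destruct (Z.eq_dec k 0), (Z.eq_dec (- k) 0); auto; lia.
- rewrite <- (IH (k - 1)%Z), <- (IH (k + 1)%Z), IH.
  replace (- (k - 1))%Z with (- k + 1)%Z by lia.
  replace (- (k + 1))%Z with (- k - 1)%Z by lia. ring.
Qed.

Lemma jacobi_nonneg q n k : 0 < q -> 0 <= jacobi q n k.
Proof.
intro H; revert k; induction n as [|n IH]; intro k; cbn [jacobi].
- destruct (Z.eq_dec k 0); lra.
- generalize (IH (k - 1)%Z) (IH k) (IH (k + 1)%Z) (pow_lt q (2 * n + 1) H)
    (pow2_ge_0 (q ^ (2 * n + 1))); intros.
  apply Rplus_le_le_0_compat; apply Rmult_le_pos; lra.
Qed.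

Lemma jacobi_center_pos q n : 0 < q -> 0 < jacobi q n 0.
Proof.
intro H; induction n as [|n IH]; cbn [jacobi]; [simpl; lra|].
generalize (jacobi_nonneg q n (0 - 1) H) (jacobi_nonneg q n (0 + 1) H)
  (pow_lt q (2 * n + 1) H) (pow2_ge_0 (q ^ (2 * n + 1))); intros.
apply Rplus_lt_le_0_compat; [apply Rmult_lt_0_compat|apply Rmult_le_pos]; lra.
Qed.

Lemma zsummable_jacobi q n g : zsummable (fun z => jacobi q n z * g z).
Proof.
apply zsummable_finite with (Z.of_nat n); intros z Hz.
rewrite jacobi_support by auto; ring.
Qed.

(** [W z] stands for w^z and is characterised by its recursion, so that it can be a constant, a sign
    or an exponential. *)
Lemma jacobi_generating q n w (W : Z -> R) :
  w <> 0 -> W 0%Z = 1 -> (forall z, W (z + 1)%Z = w * W z) ->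
  zsum (fun z => jacobi q n z * W z) =
  rprod (fun j => (1 + w * q ^ (2 * j + 1)) * (1 + q ^ (2 * j + 1) / w)) n.
Proof.
intros Hw W0 HW; induction n as [|n IH].
- assert (S := zsummable_jacobi q 0 W).
  cbn [rprod]; rewrite (zsum_split _ S); apply zsummable_split in S; destruct S as [S1 _].
  rewrite Series_incr_1 by (now apply ex_series_Rabs).
  rewrite (Series_ext (fun n => jacobi q 0 (Z.of_nat (S n)) * _) (fun _ => 0 * 0)).
  2:{ intro n; rewrite jacobi_support by lia; ring. }
  rewrite (Series_ext (fun n => jacobi q 0 (-1 - Z.of_nat n) * _) (fun _ => 0 * 0)).
  2:{ intro n; rewrite jacobi_support by lia; ring. }
  rewrite Series_scal_l; simpl; rewrite W0; ring.
- cbn [rprod]; rewrite <- IH.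
  set (x := q ^ (2 * n + 1)).
  assert (S0 := zsummable_jacobi q n W).
  destruct (zshift (-1) _ (zsummable_jacobi q n (fun z => W (z + 1)%Z))) as [T1 U1].
  destruct (zshift 1 _ (zsummable_jacobi q n (fun z => W (z - 1)%Z))) as [T2 U2].
  assert (HW' : forall z, W (z - 1)%Z = W z / w).
  { intro z; replace z with (z - 1 + 1)%Z at 2 by lia; rewrite HW; field; auto. }
  rewrite (zsum_ext (fun z => jacobi q n z * W (z + 1)%Z) (fun z => w * (jacobi q n z * W z))) in U1
    by (intro z; rewrite HW; ring).
  rewrite (zsum_ext (fun z => jacobi q n z * W (z - 1)%Z) (fun z => / w * (jacobi q n z * W z))) in U2
    by (intro z; rewrite HW'; field; auto).
  rewrite zsum_scal in U1, U2.
  rewrite (zsum_ext _ (fun z => (1 + x ^ 2) * (jacobi q n z * W z) +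
     x * (jacobi q n (z + -1) * W (z + -1 + 1)%Z + jacobi q n (z + 1) * W (z + 1 - 1)%Z))).
  2:{ intro z; cbn [jacobi]; fold x.
      replace (z + -1 + 1)%Z with z by lia; replace (z + 1 - 1)%Z with z by lia.
      change (z + -1)%Z with (z - 1)%Z; ring. }
  rewrite zsum_plus, !zsum_scal, zsum_plus, U1, U2; auto.
  + field; auto.
  + now apply zsummable_scal.
  + now apply zsummable_scal, zsummable_plus.
Qed.

Definition qpow (c : R) (z : Z) : R := exp (- c * IZR z).

Lemma qpow_add c x y : qpow c (x + y) = qpow c x * qpow c y.
Proof. unfold qpow; rewrite plus_IZR, <- exp_plus; f_equal; ring. Qed.

Lemma qpow_nat c n : qpow c (Z.of_nat n) = exp (- c) ^ n.
Proof. unfold qpow; rewrite exp_pow, INR_IZR_INZ; f_equal; ring. Qed.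

(** The q-analogue of [polya_step]: the quotient of neighbouring coefficients, cross-multiplied to
    hold for every integer k. *)
Lemma jacobi_step c n k :
  let q := exp (- c) in
  jacobi q n (k + 1) * (1 - q ^ (2 * n + 2) * qpow c (2 * k)) =
  jacobi q n k * q * (qpow c (2 * k) - q ^ (2 * n)).
Proof.
intro q; revert k; induction n as [|n IH]; intro k.
- simpl jacobi; change (2 * 0)%nat with 0%nat; simpl.
  destruct (Z.eq_dec k 0) as [->|N].
  + destruct (Z.eq_dec (0 + 1) 0); [lia|].
    replace (qpow c 0) with 1 by (unfold qpow; rewrite <- exp_0; f_equal; ring). simpl; ring_simplify.
    replace (qpow c 0) with 1 by (unfold qpow; rewrite <- exp_0; f_equal; ring). ring.
  + destruct (Z.eq_dec (k + 1) 0) as [E|]; [|ring].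
    replace k with (-1)%Z by lia.
    replace (q * (q * 1)) with (qpow c (Z.of_nat 2)) by (rewrite qpow_nat; unfold q; simpl; ring).
    rewrite Rmult_minus_distr_l, <- qpow_add; simpl.
    replace (qpow c 0) with 1 by (unfold qpow; rewrite <- exp_0; f_equal; ring). ring.
- assert (I0 := IH (k - 1)%Z); assert (I1 := IH k); assert (I2 := IH (k + 1)%Z).
  cbn [jacobi].
  replace (k - 1 + 1)%Z with k in * by lia.
  replace (k + 1 - 1)%Z with k by lia.
  set (y := qpow c (2 * k)) in *.
  set (Q := q ^ (2 * n)) in *.
  assert (Q2 : q ^ (2 * n + 2) = Q * q ^ 2) by (unfold Q; now rewrite pow_add).
  assert (Q1 : q ^ (2 * n + 1) = Q * q) by (unfold Q; rewrite pow_add; simpl; ring).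
  assert (Q3 : q ^ (2 * S n) = Q * q ^ 2) by (unfold Q; rewrite <- pow_add; f_equal; lia).
  assert (Q4 : q ^ (2 * S n + 2) = Q * q ^ 4) by (unfold Q; rewrite <- pow_add; f_equal; lia).
  assert (qn : q <> 0) by (apply Rgt_not_eq, exp_pos).
  assert (Y2 : qpow c (2 * (k + 1)) = y * q ^ 2).
  { unfold y; replace (2 * (k + 1))%Z with (2 * k + Z.of_nat 2)%Z by lia.
    now rewrite qpow_add, qpow_nat. }
  assert (Y0 : qpow c (2 * (k - 1)) * q ^ 2 = y).
  { unfold y; replace (2 * k)%Z with (2 * (k - 1) + Z.of_nat 2)%Z by lia.
    now rewrite qpow_add, qpow_nat. }
  rewrite Q2 in I0, I1, I2; rewrite Y2 in I2.
  rewrite Q1, Q3, Q4.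
  set (a0 := jacobi q n (k - 1)) in *; set (a1 := jacobi q n k) in *.
  set (a2 := jacobi q n (k + 1)) in *; set (a3 := jacobi q n (k + 1 + 1)) in *.
  (* The hypothesis at k - 1, multiplied by a power of q so that only y and nonnegative powers of q
     remain. *)
  assert (J0 : a1 * (1 - Q * y) * q = a0 * (y - Q * q ^ 2)).
  { rewrite <- Y0. apply Rmult_eq_reg_l with q; auto.
    transitivity (a1 * (1 - Q * q ^ 2 * qpow c (2 * (k - 1))) * q ^ 2); [ring|].
    rewrite I0; ring. }
  clearbody y Q a0 a1 a2 a3; clear - I1 I2 J0.
  transitivity (((1 - Q * y * q ^ 4) * (1 + Q ^ 2 * q ^ 2)) * a2 +
    Q * q * ((1 - Q * y * q ^ 4) * a1) + Q * q * (a3 * (1 - Q * q ^ 2 * (y * q ^ 2)))); [ring|].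
  rewrite I2.
  transitivity (q * (y - Q * q ^ 2) * ((1 + Q ^ 2 * q ^ 2) * a1 + Q * q * a2)
     + q * Q * q * (a1 * (1 - Q * y) * q)); [|rewrite J0; ring].
  assert (I3 : a2 * (1 - Q * q ^ 2 * y) * (1 + Q ^ 2 * q ^ 4) = a1 * q * (y - Q) * (1 + Q ^ 2 * q ^ 4))
    by (now rewrite I1).
  lra.
Qed.

(** Dividing by the central coefficient leaves exactly q^(k^2) in the limit. The normalisation never
    has to be evaluated: it cancels in [theta_chi], where both sides are of degree 2 in the theta
    constants. *)
Definition jratio (c : R) (n : nat) (k : Z) : R :=
  jacobi (exp (- c)) n k / jacobi (exp (- c)) n 0.

Lemma jratio_step c n k : 0 < c ->
  jratio c n (Z.of_nat (S k)) =
  jratio c n (Z.of_nat k) * exp (- c) * (exp (- c) ^ (2 * k) - exp (- c) ^ (2 * n)) /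
    (1 - exp (- c) ^ (2 * n + 2 * k + 2)).
Proof.
intro H; destruct (exp_opp_lt_1 c H) as [Q1 Q2].
assert (J := jacobi_step c n (Z.of_nat k)); cbv zeta in J.
assert (P := jacobi_center_pos (exp (- c)) n Q1); unfold jratio.
set (q := exp (- c)) in *.
assert (L : q ^ (2 * n + 2 * k + 2) < 1).
{ apply Rle_lt_trans with (q ^ 1); [apply pow_decr; auto; lia|rewrite pow_1; lra]. }
replace (Z.of_nat (S k)) with (Z.of_nat k + 1)%Z by lia.
replace (2 * Z.of_nat k)%Z with (Z.of_nat (2 * k)) in J by lia.
rewrite qpow_nat in J; fold q in J.
replace (q ^ (2 * n + 2) * q ^ (2 * k)) with (q ^ (2 * n + 2 * k + 2)) in J
  by (rewrite <- pow_add; f_equal; lia).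
apply Rmult_eq_reg_r with (1 - q ^ (2 * n + 2 * k + 2)); [|lra].
transitivity (jacobi q n (Z.of_nat k + 1) * (1 - q ^ (2 * n + 2 * k + 2)) / jacobi q n 0).
- field; lra.
- rewrite J; field; lra.
Qed.

Lemma jratio_nonneg c n k : 0 <= jratio c n k.
Proof.
apply Rmult_le_pos; [apply jacobi_nonneg, exp_pos|].
left; apply Rinv_0_lt_compat, jacobi_center_pos, exp_pos.
Qed.

Lemma gauss_succ c k :
  gauss c (Z.of_nat (S k)) = gauss c (Z.of_nat k) * exp (- c) * exp (- c) ^ (2 * k).
Proof.
unfold gauss; rewrite exp_pow, <- !exp_plus, <- !INR_IZR_INZ, S_INR, mult_INR.
f_equal; simpl; ring.
Qed.

Lemma Z_nat_cases (f : Z -> Prop) :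
  (forall k, f (Z.of_nat k)) -> (forall z, f z -> f (- z)%Z) -> forall z, f z.
Proof.
intros H1 H2 z; destruct (Z_le_dec 0 z).
- rewrite <- (Z2Nat.id z) by lia; apply H1.
- rewrite <- (Z.opp_involutive z); apply H2; rewrite <- (Z2Nat.id (- z)) by lia; apply H1.
Qed.

(** One step multiplies [jratio] by q (q^(2k) - q^(2n)) / (1 - q^(2n+2k+2)), which is at most the
    factor q q^(2k) of [gauss], because q^(2n+4k+2) <= q^(2n). *)
Lemma jratio_le c n z : 0 < c -> jratio c n z <= gauss c z.
Proof.
intro H; destruct (exp_opp_lt_1 c H) as [Q1 Q2].
revert z; apply Z_nat_cases.
2:{ intros z Hz; rewrite gauss_sym; unfold jratio; now rewrite jacobi_sym. }
assert (P := jacobi_center_pos (exp (- c)) n Q1).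
induction k as [|k IH].
- unfold jratio, gauss; simpl; unfold Rdiv; rewrite Rinv_r by lra.
  right; rewrite <- exp_0; f_equal; ring.
- destruct (le_lt_dec (S k) n) as [L|L].
  + rewrite jratio_step, gauss_succ by auto; unfold Rdiv; rewrite !Rmult_assoc.
    apply Rmult_le_compat; auto; [apply jratio_nonneg| |].
    * assert (exp (- c) ^ (2 * n) <= exp (- c) ^ (2 * k)) by (apply pow_decr; auto; lia).
      assert (exp (- c) ^ (2 * n + 2 * k + 2) < 1).
      { apply Rle_lt_trans with (exp (- c) ^ 1); [apply pow_decr; auto; lia|rewrite pow_1; lra]. }
      apply Rmult_le_pos; [lra|]; apply Rmult_le_pos; [lra|].
      left; apply Rinv_0_lt_compat; lra.
    * apply Rmult_le_compat_l; [lra|].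
      assert (E1 : exp (- c) ^ (2 * n) = exp (- c) ^ (2 * k) * exp (- c) ^ (2 * n - 2 * k))
        by (rewrite <- pow_add; f_equal; lia).
      assert (exp (- c) ^ (2 * n + 2 * k + 2) <= exp (- c) ^ (2 * n - 2 * k)) by (apply pow_decr; auto; lia).
      assert (exp (- c) ^ (2 * n + 2 * k + 2) < 1).
      { apply Rle_lt_trans with (exp (- c) ^ 1); [apply pow_decr; auto; lia|rewrite pow_1; lra]. }
      assert (0 < exp (- c) ^ (2 * k)) by (apply pow_lt; lra).
      rewrite E1; apply Rmult_le_reg_r with (1 - exp (- c) ^ (2 * n + 2 * k + 2)); [lra|].
      rewrite Rmult_assoc, Rinv_l by lra. nra.
  + unfold jratio; rewrite jacobi_support by lia; unfold Rdiv; rewrite Rmult_0_l.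
    left; apply exp_pos.
Qed.

Lemma pow_lim_0 q f : 0 < q < 1 -> (forall n, (n <= f n)%nat) -> is_lim_seq (fun n => q ^ f n) 0.
Proof.
intros H Hf; apply is_lim_seq_le_le with (fun _ => 0) (fun n => q ^ n).
- intro n; split; [apply pow_le; lra|apply pow_decr; auto].
- apply is_lim_seq_const.
- apply is_lim_seq_geom; rewrite Rabs_pos_eq; lra.
Qed.

Lemma jratio_lim c z : 0 < c -> is_lim_seq (fun n => jratio c n z) (gauss c z).
Proof.
intro H; destruct (exp_opp_lt_1 c H) as [Q1 Q2].
revert z; apply Z_nat_cases.
2:{ intros z Hz; rewrite gauss_sym; apply is_lim_seq_ext with (2 := Hz).
    intro n; unfold jratio; now rewrite jacobi_sym. }
induction k as [|k IH].
- apply is_lim_seq_ext with (fun _ => gauss c (Z.of_nat 0)); [|apply is_lim_seq_const].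
  intro n; assert (P := jacobi_center_pos (exp (- c)) n Q1).
  unfold jratio, gauss; simpl; unfold Rdiv; rewrite Rinv_r by lra.
  rewrite <- exp_0; f_equal; ring.
- apply is_lim_seq_ext with (fun n => jratio c n (Z.of_nat k) * exp (- c) *
    (exp (- c) ^ (2 * k) - exp (- c) ^ (2 * n)) / (1 - exp (- c) ^ (2 * n + 2 * k + 2))).
  { intro n; now rewrite jratio_step. }
  rewrite gauss_succ.
  replace (gauss c (Z.of_nat k) * exp (- c) * exp (- c) ^ (2 * k)) with
    (gauss c (Z.of_nat k) * exp (- c) * (exp (- c) ^ (2 * k) - 0) / (1 - 0)) by field.
  apply is_lim_seq_div'; [apply is_lim_seq_mult'|apply is_lim_seq_minus'|lra].
  + apply (is_lim_seq_scal_r _ (exp (- c)) (Finite _)), IH.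
  + apply is_lim_seq_minus'; [apply is_lim_seq_const|].
    apply (pow_lim_0 _ (fun n => 2 * n)%nat); auto; intro; lia.
  + apply is_lim_seq_const.
  + apply (pow_lim_0 _ (fun n => 2 * n + 2 * k + 2)%nat); auto; intro; lia.
Qed.

(** The triple product up to the normalising central coefficient; [jratio_le] provides the
    majorant. *)
Lemma jacobi_product_lim c w (W : Z -> R) :
  0 < c -> w <> 0 -> W 0%Z = 1 -> (forall z, W (z + 1)%Z = w * W z) ->
  zsummable (fun z => gauss c z * Rabs (W z)) ->
  is_lim_seq (fun n => rprod (fun j => (1 + w * exp (- c) ^ (2 * j + 1)) *
     (1 + exp (- c) ^ (2 * j + 1) / w)) n / jacobi (exp (- c)) n 0)
    (zsum (fun z => gauss c z * W z)).
Proof.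
intros H Hw W0 HW S.
apply is_lim_seq_ext with (fun n => zsum (fun z => jratio c n z * W z)).
{ intro n; rewrite <- (jacobi_generating _ n w W Hw W0 HW).
  unfold Rdiv; rewrite Rmult_comm, <- zsum_scal; apply zsum_ext; intro z.
  unfold jratio, Rdiv; ring. }
apply ztannery with (fun z => gauss c z * Rabs (W z)); auto.
- intros n z; rewrite Rabs_mult; apply Rmult_le_compat_r; [apply Rabs_pos|].
  rewrite Rabs_pos_eq by apply jratio_nonneg; now apply jratio_le.
- intro z; apply (is_lim_seq_scal_r _ (W z) (Finite _)), jratio_lim, H.
Qed.

(** The triple product at w = 1, -1 and q gives theta_3, theta_4 and exp (c / 4) theta_2, the last
    because z^2 + z = (z + 1/2)^2 - 1/4. Their finite products are X^2, Y^2 and essentially 2 Z^2,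
    and X Y Z tends to 1 by [euler_lim]; hence Z^2 Y^2 X^6 = X^4 (X Y Z)^2 gives the claim. *)
Lemma theta_chi c :
  0 < c ->
  theta2 c * theta4 c * chi (exp (- c)) ^ 6 = 2 * exp (- (c / 4)) * gsum c ^ 2.
Proof.
intro H; destruct (exp_opp_lt_1 c H) as [Q1 Q2]; set (q := exp (- c)) in *.
assert (SG := zsummable_gauss c H).
assert (L3 : is_lim_seq (fun n => rprod (fun j => 1 + q ^ (2 * j + 1)) n ^ 2 / jacobi q n 0) (gsum c)).
{ replace (gsum c) with (zsum (fun z => gauss c z * 1)) by (apply zsum_ext; intro; ring).
  apply is_lim_seq_ext with (fun n => rprod (fun j => (1 + 1 * q ^ (2 * j + 1)) *
     (1 + q ^ (2 * j + 1) / 1)) n / jacobi q n 0).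
  - intro n; f_equal; rewrite rprod_mult; simpl; rewrite Rmult_1_r; f_equal;
    apply rprod_ext; intro; field.
  - apply (jacobi_product_lim c 1 (fun _ => 1)); auto; try (intros; ring); try lra.
    apply zsummable_ext with (gauss c); auto; intro; rewrite Rabs_R1; ring. }
assert (L4 : is_lim_seq (fun n => rprod (fun j => 1 - q ^ (2 * j + 1)) n ^ 2 / jacobi q n 0) (theta4 c)).
{ set (sgn := fun z => if Z.even z then 1 else -1).
  assert (E : zsum (fun z => gauss c z * sgn z) = theta4 c).
  { assert (SS : zsummable (fun z => gauss c z * sgn z)).
    { apply zsummable_dominated with (2 := SG); intro z; rewrite Rabs_mult.
      rewrite (Rabs_pos_eq (gauss c z)) by (left; apply exp_pos).
      unfold sgn; destruct (Z.even z); [rewrite Rabs_R1; lra|].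
      rewrite Rabs_left by lra; lra. }
    destruct (zdissect _ SS) as [_ [_ D1]]; destruct (zdissect _ SG) as [_ [_ D2]].
    assert (E4 : zsum (fun z => gauss c (2 * z)) = gsum (4 * c)).
    { apply zsum_ext; intro z; rewrite gauss_scale; f_equal; ring. }
    rewrite (zsum_ext (fun z => gauss c (2 * z) * _) (fun z => gauss c (2 * z))) in D1.
    2:{ intro z; unfold sgn; rewrite Z.even_mul; simpl; ring. }
    rewrite (zsum_ext (fun z => gauss c (2 * z + 1) * _) (fun z => -1 * gauss c (2 * z + 1))) in D1.
    2:{ intro z; unfold sgn; rewrite Z.even_add, Z.even_mul; simpl; ring. }
    rewrite zsum_scal, E4 in D1; rewrite E4 in D2.
    rewrite D1; unfold theta4; change (gsum c) with (zsum (gauss c)); rewrite D2; ring. }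
  rewrite <- E.
  apply is_lim_seq_ext with (fun n => rprod (fun j => (1 + -1 * q ^ (2 * j + 1)) *
     (1 + q ^ (2 * j + 1) / -1)) n / jacobi q n 0).
  - intro n; f_equal; rewrite rprod_mult; simpl; rewrite Rmult_1_r; f_equal;
    apply rprod_ext; intro; field.
  - apply (jacobi_product_lim c (-1) sgn); auto; try lra.
    + intro z; unfold sgn; rewrite Z.even_add; destruct (Z.even z); simpl; ring.
    + apply zsummable_ext with (gauss c); auto; intro z; unfold sgn.
      destruct (Z.even z); [rewrite Rabs_R1; ring|rewrite Rabs_left by lra; ring]. }
(* At w = q the second half of the product runs over 1 + q^(2j) with j < n: it gains the factor 2 at
   j = 0 and lacks 1 + q^(2n). *)
assert (L2 : is_lim_seq (fun n => 2 * rprod (fun j => 1 + q ^ (2 * j + 2)) n ^ 2 / (1 + q ^ (2 * n))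
     / jacobi q n 0) (exp (c / 4) * theta2 c)).
{ assert (EG : forall z, gauss c z * qpow c z = exp (c / 4) * gauss (c / 4) (2 * z + 1)).
  { intro z; unfold gauss, qpow; rewrite <- !exp_plus; f_equal.
    rewrite plus_IZR, mult_IZR; field. }
  assert (S4 : zsummable (gauss (c / 4))) by (apply zsummable_gauss; lra).
  destruct (zdissect _ S4) as [_ [D2 D3]].
  assert (E : zsum (fun z => gauss c z * qpow c z) = exp (c / 4) * theta2 c).
  { rewrite (zsum_ext _ _ EG), zsum_scal; f_equal; unfold theta2, gsum; rewrite D3.
    rewrite (zsum_ext (fun z => gauss (c / 4) (2 * z)) (gauss c)); [ring|].
    intro z; rewrite gauss_scale; f_equal; field. }
  rewrite <- E.
  apply is_lim_seq_ext with (fun n => rprod (fun j => (1 + q * q ^ (2 * j + 1)) *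
     (1 + q ^ (2 * j + 1) / q)) n / jacobi q n 0).
  - intro n; f_equal; induction n as [|n IH]; [simpl; field|].
    cbn [rprod]; rewrite IH.
    replace (q * q ^ (2 * n + 1)) with (q ^ (2 * n + 2)) by (rewrite <- (pow_1 q) at 2; rewrite <- pow_add; f_equal; lia).
    replace (q ^ (2 * n + 1) / q) with (q ^ (2 * n)) by (rewrite pow_add; field; lra).
    replace (2 * S n)%nat with (2 * n + 2)%nat by lia.
    assert (0 < q ^ (2 * n)) by (apply pow_lt; lra).
    assert (0 < q ^ (2 * n + 2)) by (apply pow_lt; lra).
    field; lra.
  - apply (jacobi_product_lim c q (qpow c)); auto; try lra.
    + unfold qpow; rewrite <- exp_0; f_equal; ring.
    + intro z; unfold qpow, q; rewrite <- exp_plus, plus_IZR; f_equal; ring.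
    + apply zsummable_ext with (fun z => exp (c / 4) * gauss (c / 4) (2 * z + 1)).
      * intro z; rewrite <- EG; f_equal; rewrite Rabs_pos_eq; auto; left; apply exp_pos.
      * now apply zsummable_scal. }
destruct (chi_lim q (conj Q1 Q2)) as [LX _].
assert (LE := euler_lim q (conj Q1 Q2)).
set (X := rprod (fun j => 1 + q ^ (2 * j + 1))) in *.
set (Y := rprod (fun j => 1 - q ^ (2 * j + 1))) in *.
set (Z := rprod (fun j => 1 + q ^ (2 * j + 2))) in *.
assert (R1 : is_lim_seq (fun n => 2 * Z n ^ 2 / (1 + q ^ (2 * n)) / jacobi q n 0 *
    (Y n ^ 2 / jacobi q n 0) * (X n * X n * (X n * X n) * (X n * X n)))
   (exp (c / 4) * theta2 c * theta4 c * (chi q * chi q * (chi q * chi q) * (chi q * chi q)))).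
{ assert (LX2 := is_lim_seq_mult' _ _ _ _ LX LX).
  apply is_lim_seq_mult'; [now apply is_lim_seq_mult'|].
  apply is_lim_seq_mult'; [now apply is_lim_seq_mult'|exact LX2]. }
assert (R2 : is_lim_seq (fun n => 2 * Z n ^ 2 / (1 + q ^ (2 * n)) / jacobi q n 0 *
    (Y n ^ 2 / jacobi q n 0) * (X n * X n * (X n * X n) * (X n * X n)))
   (gsum c * gsum c * (2 * (1 * 1) / (1 + 0)))).
{ apply is_lim_seq_ext with (fun n => (X n ^ 2 / jacobi q n 0) * (X n ^ 2 / jacobi q n 0) *
    (2 * ((X n * Y n * Z n) * (X n * Y n * Z n)) / (1 + q ^ (2 * n)))).
  - intro n; assert (0 < q ^ (2 * n)) by (apply pow_lt; lra).
    assert (P := jacobi_center_pos q n Q1); field; lra.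
  - apply is_lim_seq_mult'; [apply is_lim_seq_mult'; auto|].
    apply is_lim_seq_div'; [| |lra].
    + apply (is_lim_seq_scal_l _ 2 (Finite _)), is_lim_seq_mult'; auto.
    + apply is_lim_seq_plus'; [apply is_lim_seq_const|].
      apply (pow_lim_0 _ (fun n => 2 * n)%nat); auto; intro; lia. }
apply is_lim_seq_unique in R1; apply is_lim_seq_unique in R2; rewrite R1 in R2.
assert (E : exp (c / 4) * theta2 c * theta4 c * (chi q * chi q * (chi q * chi q) * (chi q * chi q)) =
  gsum c * gsum c * (2 * (1 * 1) / (1 + 0))) by (now injection R2).
rewrite exp_Ropp; assert (0 < exp (c / 4)) by apply exp_pos.
apply Rmult_eq_reg_l with (exp (c / 4)); [|lra].
transitivity (exp (c / 4) * theta2 c * theta4 c * (chi q * chi q * (chi q * chi q) * (chi q * chi q))); [ring|].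
rewrite E; field; lra.
Qed.

(** * The septic number field *)

Lemma pow_eq_inv a b n : 0 <= a -> 0 <= b -> a ^ S n = b ^ S n -> a = b.
Proof.
intros Ha Hb E; destruct (Rtotal_order a b) as [L|[L|L]]; auto; exfalso.
- assert (a ^ S n < b ^ S n); [|lra].
  simpl; apply Rle_lt_trans with (a * b ^ n).
  + apply Rmult_le_compat_l; auto; apply pow_incr; lra.
  + apply Rmult_lt_compat_r; auto; apply pow_lt; lra.
- assert (b ^ S n < a ^ S n); [|lra].
  simpl; apply Rle_lt_trans with (b * a ^ n).
  + apply Rmult_le_compat_l; auto; apply pow_incr; lra.
  + apply Rmult_lt_compat_r; auto; apply pow_lt; lra.
Qed.

Lemma pow_lt_compat a b n : 0 <= a < b -> a ^ S n < b ^ S n.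
Proof.
intros H; simpl; apply Rle_lt_trans with (a * b ^ n).
- apply Rmult_le_compat_l; [lra|apply pow_incr; lra].
- apply Rmult_lt_compat_r; [apply pow_lt|]; lra.
Qed.

(** The term 7 g alone reaches 1 at g = 1/7. The bound later fixes the signs of elements of Q(g). *)
Lemma septic_unit : exists g, 0 < g < / 7 /\ g ^ 7 = 1 - 7 * g - 7 * g ^ 2 - 7 * g ^ 3.
Proof.
set (f := fun g => g ^ 7 + 7 * g ^ 3 + 7 * g ^ 2 + 7 * g - 1).
assert (C : continuity f) by (unfold f; reg).
destruct (IVT f 0 (/ 7) C) as [g [[G0 G1] G2]]; try (unfold f; lra).
exists g; unfold f in G2; split; [|lra].
split.
- destruct G0 as [G0| <-]; auto; lra.
- destruct G1 as [G1| ->]; auto; lra.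
Qed.

(** [f x / x ^ 7] is strictly decreasing for x > 0, all coefficients of [f] being positive and its
    degree below 7. The inequalities P3 to P7 compare the cross-multiplied terms, with (a b)^k
    factored out. *)
Lemma septic_positive_unique a b :
  let f := fun x => 14 * x ^ 4 + 42 * x ^ 3 + 70 * x ^ 2 + 77 * x + 83 in
  0 < a -> 0 < b -> a ^ 7 = f a -> b ^ 7 = f b -> a = b.
Proof.
intros f.
assert (W : forall a b, 0 < a -> a ^ 7 = f a -> b ^ 7 = f b -> ~ a < b).
{ clear; intros a b Ha Fa Fb L.
  assert (E : a ^ 7 * f b = b ^ 7 * f a) by (rewrite <- Fa, <- Fb; ring).
  unfold f in E.
  assert (0 < a * b) by nra.
  assert (P3 := pow_lt_compat a b 2 ltac:(lra)); assert (P4 := pow_lt_compat a b 3 ltac:(lra)).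
  assert (P5 := pow_lt_compat a b 4 ltac:(lra)); assert (P6 := pow_lt_compat a b 5 ltac:(lra)).
  assert (P7 := pow_lt_compat a b 6 ltac:(lra)).
  assert (Q : forall k x y, x < y -> (a * b) ^ k * x < (a * b) ^ k * y).
  { intros k x y Hxy; apply Rmult_lt_compat_l; auto; now apply pow_lt. }
  apply (Q 4%nat) in P3; apply (Q 3%nat) in P4; apply (Q 2%nat) in P5; apply (Q 1%nat) in P6.
  lra. }
intros Ha Hb Fa Fb; destruct (Rtotal_order a b) as [L|[L|L]]; auto.
- now destruct (W a b).
- now destruct (W b a).
Qed.

(** cos (4 pi / 7) = - cos (3 pi / 7) is a quartic equation in e with the factor e + 2 > 0; the
    other factor is the cubic. *)
Lemma cos_septic :
  let e := 2 * cos (PI / 7) in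
  2 * cos (2 * PI / 7) = e ^ 2 - 2 /\ 2 * cos (3 * PI / 7) = e ^ 2 - e - 1 /\
  e ^ 3 = e ^ 2 + 2 * e - 1 /\
  0 < e /\ 0 < e ^ 2 - 2 /\ 0 < e ^ 2 - e - 1.
Proof.
intro e; assert (HPI := PI_RGT_0).
assert (C2 : 2 * cos (2 * PI / 7) = e ^ 2 - 2).
{ replace (2 * PI / 7) with (2 * (PI / 7)) by field; rewrite cos_2a_cos; unfold e; ring. }
assert (C3 : 2 * cos (3 * PI / 7) = e ^ 3 - 3 * e).
{ replace (3 * PI / 7) with (2 * (PI / 7) + PI / 7) by field.
  rewrite cos_plus, cos_2a_cos, sin_2a.
  transitivity (2 * (cos (PI / 7) * (2 * cos (PI / 7) ^ 2 - 1 - 2 * (sin (PI / 7) * sin (PI / 7))))); [ring|].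
  generalize (sin2_cos2 (PI / 7)); unfold Rsqr; intro E.
  replace (sin (PI / 7) * sin (PI / 7)) with (1 - cos (PI / 7) * cos (PI / 7)) by lra.
  unfold e; ring. }
assert (P1 : 0 < e) by (apply Rmult_lt_0_compat; [lra|apply cos_gt_0; lra]).
assert (P2 : 0 < e ^ 2 - 2) by (rewrite <- C2; apply Rmult_lt_0_compat; [lra|apply cos_gt_0; lra]).
assert (P3 : 0 < e ^ 3 - 3 * e) by (rewrite <- C3; apply Rmult_lt_0_compat; [lra|apply cos_gt_0; lra]).
assert (C4 : (e ^ 2 - 2) ^ 2 - 2 = - (e ^ 3 - 3 * e)).
{ rewrite <- C2, <- C3.
  transitivity (2 * (2 * cos (2 * PI / 7) * cos (2 * PI / 7) - 1)); [ring|].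
  rewrite <- cos_2a_cos.
  replace (2 * (2 * PI / 7)) with (- (3 * PI / 7) + PI) by field.
  rewrite neg_cos, cos_neg; ring. }
assert (E : e ^ 3 = e ^ 2 + 2 * e - 1).
{ apply Rmult_eq_reg_l with (e + 2); [|lra]. lra. }
repeat split; auto; lra.
Qed.

Lemma Rpower_two_sevenths x : 0 < x -> 0 < Rpower x (2 / 7) /\ Rpower x (2 / 7) ^ 7 = x ^ 2.
Proof.
intro H; assert (P : 0 < Rpower x (2 / 7)) by apply exp_pos; split; auto.
rewrite <- Rpower_pow, Rpower_mult by auto.
replace (2 / 7 * INR 7) with (INR 2) by (simpl; field).
now apply Rpower_pow.
Qed.

(** The product of the three doubled cosines is 1. Comparing seventh powers, this gives Y = (e^2 -
    2)^2 X^2 and Z = (e^2 - e - 1)^2 Y^2, so the sum is a polynomial in e and X. The equation then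
    holds modulo the cubic of e and the value of X^7 in Q(e). *)
Lemma trig_sum_septic :
  let T := Rpower (cos (PI/7) / (2 * cos (2 * PI / 7) ^ 2)) (2/7)
         + Rpower (cos (2 * PI / 7) / (2 * cos (3 * PI / 7) ^ 2)) (2/7)
         + Rpower (cos (3 * PI / 7) / (2 * cos (PI/7) ^ 2)) (2/7) in
  0 < T /\ T ^ 7 = 14 * T ^ 4 + 42 * T ^ 3 + 70 * T ^ 2 + 77 * T + 83.
Proof.
destruct cos_septic as [C2 [C3 [He [P1 [P2 P3]]]]].
set (e := 2 * cos (PI / 7)) in *.
replace (cos (PI / 7) / (2 * cos (2 * PI / 7) ^ 2)) with (e / (e ^ 2 - 2) ^ 2)
  by (rewrite <- C2; unfold e; field; lra).
replace (cos (2 * PI / 7) / (2 * cos (3 * PI / 7) ^ 2)) with ((e ^ 2 - 2) / (e ^ 2 - e - 1) ^ 2)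
  by (rewrite <- C2, <- C3; field; lra).
replace (cos (3 * PI / 7) / (2 * cos (PI / 7) ^ 2)) with ((e ^ 2 - e - 1) / e ^ 2)
  by (rewrite <- C3; unfold e; field; unfold e in P1; lra).
clearbody e; clear C2 C3.
assert (U : e * (e ^ 2 - 2) * (e ^ 2 - e - 1) = 1) by ring [He].
assert (D : forall x y, 0 < x -> 0 < y -> 0 < x / y ^ 2).
{ intros x y Hx Hy; apply Rdiv_lt_0_compat; auto; now apply pow_lt. }
destruct (Rpower_two_sevenths _ (D e (e ^ 2 - 2) P1 P2)) as [X0 X7].
destruct (Rpower_two_sevenths _ (D (e ^ 2 - 2) (e ^ 2 - e - 1) P2 P3)) as [Y0 Y7].
destruct (Rpower_two_sevenths _ (D (e ^ 2 - e - 1) e P3 P1)) as [Z0 Z7].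
set (X := Rpower (e / (e ^ 2 - 2) ^ 2) (2 / 7)) in *.
set (Y := Rpower ((e ^ 2 - 2) / (e ^ 2 - e - 1) ^ 2) (2 / 7)) in *.
set (Z := Rpower ((e ^ 2 - e - 1) / e ^ 2) (2 / 7)) in *.
clearbody X Y Z; clear D.
assert (I1 : e = / ((e ^ 2 - 2) * (e ^ 2 - e - 1))).
{ apply Rmult_eq_reg_r with ((e ^ 2 - 2) * (e ^ 2 - e - 1)); [|apply Rgt_not_eq; nra].
  rewrite Rinv_l by (apply Rgt_not_eq; nra). lra. }
assert (HY : Y = (e ^ 2 - 2) ^ 2 * X ^ 2).
{ apply pow_eq_inv with 6%nat; try lra.
  - apply Rmult_le_pos; apply pow2_ge_0.
  - rewrite Rpow_mult_distr.
    replace ((X ^ 2) ^ 7) with ((X ^ 7) ^ 2) by ring.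
    rewrite X7, Y7. set (e2 := e ^ 2 - 2) in *; set (e3 := e ^ 2 - e - 1) in *.
    rewrite I1; field; lra. }
assert (HZ : Z = (e ^ 2 - e - 1) ^ 2 * Y ^ 2).
{ apply pow_eq_inv with 6%nat; try lra.
  - apply Rmult_le_pos; apply pow2_ge_0.
  - rewrite Rpow_mult_distr.
    replace ((Y ^ 2) ^ 7) with ((Y ^ 7) ^ 2) by ring.
    rewrite Z7, Y7. set (e2 := e ^ 2 - 2) in *; set (e3 := e ^ 2 - e - 1) in *.
    rewrite I1; field; lra. }
split; [lra|].
assert (HX : X ^ 7 = 8 * e ^ 2 - 17 * e + 6).
{ rewrite X7. replace (e / (e ^ 2 - 2) ^ 2) with (e ^ 3 * (e ^ 2 - e - 1) ^ 2).
  - ring [He].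
  - replace (e / (e ^ 2 - 2) ^ 2) with (e * (e * (e ^ 2 - 2) * (e ^ 2 - e - 1)) ^ 2 / (e ^ 2 - 2) ^ 2)
      by (rewrite U; field; lra).
    field; lra. }
rewrite HZ, HY; ring [He HX].
Qed.

Lemma multiplier_sq m g :
  0 < g < / 7 -> g ^ 7 = 1 - 7 * g - 7 * g ^ 2 - 7 * g ^ 3 ->
  m = Rpower 7 (3/2) *
      powerRZ (1 + Rpower (cos (PI/7) / (2 * cos (2 * PI / 7) ^ 2)) (2/7)
                 + Rpower (cos (2 * PI / 7) / (2 * cos (3 * PI / 7) ^ 2)) (2/7)
                 + Rpower (cos (3 * PI / 7) / (2 * cos (PI/7) ^ 2)) (2/7)) (-2) ->
  m ^ 2 = 7 - 42 * g - 42 * g ^ 2 - 42 * g ^ 3 + 7 * g ^ 4 + 7 * g ^ 5 + 7 * g ^ 6.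
Proof.
intros Hg H7 ->.
generalize trig_sum_septic; cbv zeta.
set (x := Rpower (cos (PI/7) / _) _).
set (y := Rpower (cos (2 * PI / 7) / _) _).
set (z := Rpower (cos (3 * PI / 7) / _) _).
replace (1 + x + y + z) with (1 + (x + y + z)) by ring.
set (T := x + y + z); clearbody T; clear x y z; intros [T0 T7].
assert (P : 0 <= g ^ 2 /\ 0 <= g ^ 4 /\ 0 <= g ^ 5 /\ g ^ 3 <= g).
{ repeat split; try (apply pow_le; lra).
  replace (g ^ 3) with (g * (g * g)) by ring. rewrite <- (Rmult_1_r g) at 4.
  apply Rmult_le_compat_l; nra. }
set (s := 9 + 7 * g + 2 * g ^ 2 - 2 * g ^ 3 + g ^ 4 + g ^ 5).
assert (s0 : 0 < s) by (unfold s; lra).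
(* The septic equation of [trig_sum_septic] for s / 3, cleared of denominators. *)
assert (S7 : s ^ 7 = 378 * s ^ 4 + 3402 * s ^ 3 + 17010 * s ^ 2 + 56133 * s + 181521)
  by (unfold s; ring [H7]).
assert (E : T = s / 3).
{ apply septic_positive_unique; [exact T0|lra|exact T7|].
  replace ((s / 3) ^ 7) with (s ^ 7 / 2187) by field.
  rewrite S7; field. }
change (powerRZ (1 + T) (-2)) with (/ (1 + T) ^ 2).
assert (E7 : Rpower 7 (3 / 2) ^ 2 = 343).
{ rewrite <- Rpower_pow, Rpower_mult by apply exp_pos.
  replace (3 / 2 * INR 2) with (INR 3) by (simpl; field).
  rewrite Rpower_pow by lra; ring. }
rewrite Rpow_mult_distr, E7, E.
(* Since 1 + T = (3 + s) / 3, the claim becomes an identity without division, which [ring] checks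
   modulo the equation of g. *)
apply Rmult_eq_reg_l with ((3 + s) ^ 4); [|apply Rgt_not_eq, pow_lt; lra].
transitivity (343 * 81); [field; lra|].
unfold s; ring [H7].
Qed.

(** With r the cube root of s, z = 10 mu / r - r / 6 is a sum of two terms with product - 5 mu / 3,
    as Cardano's method requires; the quadratic equation Q of s makes z a root of the cubic. As mu >
    0 the cubic is increasing, so its real root is unique. *)
Lemma cardano_depressed mu s p y :
  0 < mu ->
  s = 12 * mu * (9 * (7 - mu) + sqrt 3 * sqrt (27 * (mu ^ 2 + 49) + 122 * mu)) ->
  p = 1 + 10 * mu / Rpower s (1/3) - Rpower s (1/3) / 6 ->
  y ^ 3 + 5 * mu * y = mu ^ 2 - 7 * mu ->
  p = 1 + y.
Proof.
intros Hm Hs Hp Hy.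
rewrite <- sqrt_mult in Hs by nra.
set (D := 3 * (27 * (mu ^ 2 + 49) + 122 * mu)) in *.
assert (HD : sqrt D * sqrt D = D) by (apply sqrt_sqrt; unfold D; nra).
assert (D0 : 0 <= sqrt D) by apply sqrt_pos.
(* [Rpower s (1 / 3)] is a cube root only for s > 0. When mu > 7 the first summand is negative, but
   the square root outweighs it. *)
assert (s0 : 0 < s).
{ rewrite Hs; apply Rmult_lt_0_compat; [lra|].
  destruct (Rle_or_lt (- (9 * (7 - mu))) 0) as [L|L].
  - destruct D0 as [D0|D0]; [lra|]. rewrite <- D0 in HD; unfold D in HD; nra.
  - assert ((9 * (7 - mu)) * (9 * (7 - mu)) < sqrt D * sqrt D) by (rewrite HD; unfold D; nra). nra. }
assert (Q : s ^ 2 = 216 * mu * (7 - mu) * s + 216000 * mu ^ 3).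
{ assert (K : (s - 108 * mu * (7 - mu)) ^ 2 = (12 * mu) ^ 2 * D).
  { rewrite <- HD, Hs; ring. }
  unfold D in K; lra. }
assert (r0 : 0 < Rpower s (1 / 3)) by apply exp_pos.
assert (r3 : Rpower s (1 / 3) ^ 3 = s).
{ rewrite <- Rpower_pow, Rpower_mult by auto.
  replace (1 / 3 * INR 3) with 1 by (simpl; field). now apply Rpower_1. }
set (r := Rpower s (1 / 3)) in *; clearbody r.
set (z := 10 * mu / r - r / 6).
assert (Hz : z ^ 3 + 5 * mu * z = mu ^ 2 - 7 * mu).
{ assert (Z1 : z ^ 3 + 5 * mu * z = 1000 * mu ^ 3 / r ^ 3 - r ^ 3 / 216) by (unfold z; field; lra).
  rewrite Z1, r3; apply Rmult_eq_reg_r with (216 * s); [|lra].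
  transitivity (216000 * mu ^ 3 - s ^ 2); [field; lra|].
  rewrite Q; ring. }
assert (F : (z - y) * (z ^ 2 + z * y + y ^ 2 + 5 * mu) = 0) by lra.
assert (0 < z ^ 2 + z * y + y ^ 2 + 5 * mu) by nra.
apply Rmult_integral in F; destruct F as [F|F]; [|lra].
rewrite Hp; unfold z in F; lra.
Qed.

Lemma p_value m s p g :
  0 < g < / 7 -> g ^ 7 = 1 - 7 * g - 7 * g ^ 2 - 7 * g ^ 3 ->
  m = Rpower 7 (3/2) *
      powerRZ (1 + Rpower (cos (PI/7) / (2 * cos (2 * PI / 7) ^ 2)) (2/7)
                 + Rpower (cos (2 * PI / 7) / (2 * cos (3 * PI / 7) ^ 2)) (2/7)
                 + Rpower (cos (3 * PI / 7) / (2 * cos (PI/7) ^ 2)) (2/7)) (-2) ->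
  s = 12 * m ^ 2 *
      (9 * (7 - m ^ 2) + sqrt 3 * sqrt (27 * (m ^ 4 + 49) + 122 * m ^ 2)) ->
  p = 1 + 10 * m ^ 2 / Rpower s (1/3) - Rpower s (1/3) / 6 ->
  p = g ^ 7.
Proof.
intros Hg H7 Hm Hs Hp; assert (Hmu := multiplier_sq m g Hg H7 Hm).
replace (m ^ 4) with ((m ^ 2) ^ 2) in Hs by ring.
assert (m0 : 0 < m ^ 2).
{ rewrite Hm; apply pow_lt, Rmult_lt_0_compat; [apply exp_pos|].
  apply powerRZ_lt; generalize (proj1 trig_sum_septic); cbv zeta; lra. }
replace (g ^ 7) with (1 + - (7 * (g + g ^ 2 + g ^ 3))) by (rewrite H7; ring).
apply (cardano_depressed (m ^ 2) s p _ m0 Hs Hp).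
rewrite Hmu; ring [H7].
Qed.

(** * The modular equation of degree 7 at exp(-pi sqrt 7) *)

Lemma theta4_inversion c : 0 < c -> theta4 (PI ^ 2 / c) = sqrt (c / PI) * theta2 c.
Proof.
intro H; assert (HPI := PI_RGT_0); unfold theta4, theta2.
replace (4 * (PI ^ 2 / c)) with (PI ^ 2 / (c / 4)) by (field; lra).
rewrite !gsum_inversion by lra.
replace (c / PI) with (c / 4 / PI * (2 * 2)) by (field; lra).
rewrite sqrt_mult, sqrt_square by (try lra; left; apply Rdiv_lt_0_compat; lra).
ring.
Qed.

(** The signs alternate in theta_4; inversion turns it into a positive multiple of theta_2, whose
    terms are positive. *)
Lemma theta4_pos c : 0 < c -> 0 < theta4 c.
Proof.
intro H; assert (HPI := PI_RGT_0).
assert (0 < PI ^ 2 / c) by (apply Rdiv_lt_0_compat; nra).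
replace c with (PI ^ 2 / (PI ^ 2 / c)) by (field; lra).
rewrite theta4_inversion by auto.
apply Rmult_lt_0_compat; [|now apply theta2_pos].
apply sqrt_lt_R0, Rdiv_lt_0_compat; auto.
Qed.

(* For the moduli k, k' of q = exp (- c), these are k^(1/4) = alpha^(1/8) and
   k'^(1/4) = (1 - alpha)^(1/8) in Ramanujan's notation. *)
Definition k_root4 (c : R) : R := sqrt (theta2 c / gsum c).
Definition k'_root4 (c : R) : R := sqrt (theta4 c / gsum c).

Lemma gsum_pos c : 0 < c -> 0 < gsum c.
Proof. intro H; generalize (proj1 (gsum_bounds c H)); lra. Qed.

Lemma k_root4_pos c : 0 < c -> 0 < k_root4 c.
Proof.
intro H; apply sqrt_lt_R0, Rdiv_lt_0_compat; [now apply theta2_pos|now apply gsum_pos].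
Qed.

Lemma k'_root4_pos c : 0 < c -> 0 < k'_root4 c.
Proof.
intro H; apply sqrt_lt_R0, Rdiv_lt_0_compat; [now apply theta4_pos|now apply gsum_pos].
Qed.

Lemma k_root4_sq c : 0 < c -> k_root4 c ^ 2 = theta2 c / gsum c.
Proof.
intro H; unfold k_root4; rewrite pow2_sqrt; auto.
left; apply Rdiv_lt_0_compat; [now apply theta2_pos|now apply gsum_pos].
Qed.

Lemma k'_root4_sq c : 0 < c -> k'_root4 c ^ 2 = theta4 c / gsum c.
Proof.
intro H; unfold k'_root4; rewrite pow2_sqrt; auto.
left; apply Rdiv_lt_0_compat; [now apply theta4_pos|now apply gsum_pos].
Qed.

Lemma k_root4_complement c : 0 < c -> k_root4 c ^ 8 + k'_root4 c ^ 8 = 1.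
Proof.
intro H; replace (k_root4 c ^ 8) with ((k_root4 c ^ 2) ^ 4) by ring.
replace (k'_root4 c ^ 8) with ((k'_root4 c ^ 2) ^ 4) by ring.
rewrite k_root4_sq, k'_root4_sq by auto.
assert (G := gsum_pos c H); destruct (theta_duplication c H) as [_ [_ E]].
apply Rmult_eq_reg_r with (gsum c ^ 4); [|apply Rgt_not_eq, pow_lt; auto].
rewrite Rmult_1_l; transitivity (theta2 c ^ 4 + theta4 c ^ 4); [field; lra|now symmetry].
Qed.

(** [theta_septic] divided by [gsum c * gsum (7 * c)]: by duplication, theta_4(2x) = theta_3(x)
    k'_root4(x) and theta_2(x / 2) = sqrt 2 theta_3(x) k_root4(x). *)
Lemma k_root4_septic c :
  0 < c -> k_root4 c * k_root4 (7 * c) + k'_root4 c * k'_root4 (7 * c) = 1.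
Proof.
intro H; assert (H7 : 0 < 7 * c) by lra.
assert (E := theta_septic c H).
assert (G := gsum_pos c H); assert (G7 := gsum_pos _ H7).
assert (T4 : forall x, 0 < x -> theta4 (2 * x) = gsum x * k'_root4 x).
{ intros x Hx; apply pow_eq_inv with 1%nat.
  - left; apply theta4_pos; lra.
  - left; apply Rmult_lt_0_compat; [now apply gsum_pos|now apply k'_root4_pos].
  - rewrite <- (proj1 (theta_duplication x Hx)), Rpow_mult_distr, k'_root4_sq by auto.
    generalize (gsum_pos x Hx); intro; field; lra. }
assert (T2 : forall x, 0 < x -> theta2 (x / 2) ^ 2 = 2 * (gsum x * k_root4 x) ^ 2).
{ intros x Hx; rewrite (proj1 (proj2 (theta_duplication x Hx))), Rpow_mult_distr, k_root4_sq by auto.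
  generalize (gsum_pos x Hx); intro; field; lra. }
assert (K := k_root4_pos c H); assert (K7 := k_root4_pos _ H7).
assert (T22 : theta2 (c / 2) * theta2 (7 * c / 2) =
  2 * (gsum c * k_root4 c * (gsum (7 * c) * k_root4 (7 * c)))).
{ apply pow_eq_inv with 1%nat.
  - left; apply Rmult_lt_0_compat; apply theta2_pos; lra.
  - left; repeat apply Rmult_lt_0_compat; auto; lra.
  - rewrite Rpow_mult_distr, T2, T2 by auto; ring. }
replace (14 * c) with (2 * (7 * c)) in E by ring.
rewrite T22, !T4 in E by auto.
apply Rmult_eq_reg_l with (gsum c * gsum (7 * c)); [|apply Rgt_not_eq; nra].
lra.
Qed.

Lemma k_root4_inversion c : 0 < c -> k'_root4 (PI ^ 2 / c) = k_root4 c.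
Proof.
intro H; assert (HPI := PI_RGT_0); unfold k'_root4, k_root4; f_equal.
rewrite theta4_inversion, gsum_inversion by auto.
assert (G := gsum_pos c H).
assert (0 < sqrt (c / PI)) by (apply sqrt_lt_R0, Rdiv_lt_0_compat; auto).
field; lra.
Qed.

(** It tells the two moduli apart, their equations being symmetric. The threshold lies just below 3
    * 264 / 100, a cheap lower bound of pi sqrt 7. *)
Lemma k_root4_lt c : 79 / 10 <= c -> k_root4 c < k'_root4 c.
Proof.
intro H; assert (H0 : 0 < c) by lra.
apply sqrt_lt_1.
- left; apply Rdiv_lt_0_compat; [now apply theta2_pos|now apply gsum_pos].
- left; apply Rdiv_lt_0_compat; [now apply theta4_pos|now apply gsum_pos].
- apply Rmult_lt_compat_r; [apply Rinv_0_lt_compat; now apply gsum_pos|].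
  assert (B1 := gsum_le c H0).
  assert (B2 := proj1 (gsum_bounds c H0)).
  assert (B3 := proj1 (gsum_bounds (4 * c) ltac:(lra))).
  assert (B4 := proj2 (gsum_bounds (c / 4) ltac:(lra))).
  assert (X : 39 / 10 <= exp (c / 4)).
  { replace (c / 4) with (c / 8 + c / 8) by field; rewrite exp_plus.
    assert (1 + c / 8 <= exp (c / 8)) by apply exp_ineq1_le. nra. }
  assert (2 / (exp (c / 4) - 1) <= 2 / (29 / 10)).
  { apply Rmult_le_compat_l; [lra|]. apply Rinv_le_contravar; lra. }
  assert (2 / c <= 2 / (79 / 10)).
  { apply Rmult_le_compat_l; [lra|]. apply Rinv_le_contravar; lra. }
  unfold theta2, theta4; lra.
Qed.

Lemma chi_k_root4 c :
  0 < c -> (k_root4 c * k'_root4 c) ^ 2 * chi (exp (- c)) ^ 6 = 2 * exp (- (c / 4)).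
Proof.
intro H; assert (G := gsum_pos c H).
rewrite Rpow_mult_distr, k_root4_sq, k'_root4_sq by auto.
apply Rmult_eq_reg_r with (gsum c ^ 2); [|apply Rgt_not_eq, pow_lt; auto].
rewrite <- theta_chi by auto; field; lra.
Qed.

(* The moduli at pi sqrt 7 and at pi / sqrt 7 are complementary. *)
Lemma k_root4_sqrt7 : k_root4 (PI * sqrt 7) * k'_root4 (PI * sqrt 7) = / 2.
Proof.
assert (HPI := PI_RGT_0).
assert (S7 : 0 < sqrt 7) by (apply sqrt_lt_R0; lra).
assert (Q7 : sqrt 7 * sqrt 7 = 7) by (apply sqrt_sqrt; lra).
set (c := PI * sqrt 7); assert (Hc : 0 < c) by (apply Rmult_lt_0_compat; auto).
assert (Ec : c * c = 7 * PI ^ 2).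
{ unfold c; transitivity (PI ^ 2 * (sqrt 7 * sqrt 7)); [ring|rewrite Q7; ring]. }
assert (E7 : PI ^ 2 / c = c / 7).
{ apply Rmult_eq_reg_r with (7 * c); [|lra].
  transitivity (7 * PI ^ 2); [field; lra|rewrite <- Ec; field]. }
assert (E := k_root4_septic (c / 7) ltac:(lra)).
replace (7 * (c / 7)) with c in E by field.
assert (I1 := k_root4_inversion c Hc); rewrite E7 in I1.
assert (I2 := k_root4_inversion (c / 7) ltac:(lra)).
replace (PI ^ 2 / (c / 7)) with c in I2.
2:{ symmetry; apply Rmult_eq_reg_r with (c / 7); [|lra].
    transitivity (PI ^ 2); [field; lra|].
    transitivity (c * c / 7); [rewrite Ec; field|field]. }
rewrite I1, <- I2 in E; lra.
Qed.

(** Divided by x, the equation reads al h(1 + x) = (1 - al) h(1 - x) with h(z) = (z^8 - 1) / (z -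
    1): the left side increases in x and the right side decreases. *)
Lemma pow_sum_unique al x y :
  0 < al < 1 -> 0 < x < 1 -> 0 < y < 1 ->
  al * ((1 + x) ^ 8 - 1) = (1 - al) * (1 - (1 - x) ^ 8) ->
  al * ((1 + y) ^ 8 - 1) = (1 - al) * (1 - (1 - y) ^ 8) -> x = y.
Proof.
set (h := fun z => 1 + z + z ^ 2 + z ^ 3 + z ^ 4 + z ^ 5 + z ^ 6 + z ^ 7).
assert (hinc : forall a b, 0 <= a < b -> h a < h b).
{ intros a b Hab; unfold h.
  generalize (pow_lt_compat a b 1 Hab) (pow_lt_compat a b 2 Hab) (pow_lt_compat a b 3 Hab)
    (pow_lt_compat a b 4 Hab) (pow_lt_compat a b 5 Hab) (pow_lt_compat a b 6 Hab); lra. }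
assert (hdiv : forall al x, 0 < x ->
  al * ((1 + x) ^ 8 - 1) = (1 - al) * (1 - (1 - x) ^ 8) ->
  al * h (1 + x) = (1 - al) * h (1 - x)).
{ intros al' x' Hx E; apply Rmult_eq_reg_l with x'; [|lra].
  transitivity (al' * ((1 + x') ^ 8 - 1)); [unfold h; ring|].
  rewrite E; unfold h; ring. }
assert (W : forall al x y, 0 < al < 1 -> 0 < x < 1 -> 0 < y < 1 ->
  al * h (1 + x) = (1 - al) * h (1 - x) -> al * h (1 + y) = (1 - al) * h (1 - y) -> ~ x < y).
{ intros al' x' y' Ha Hx Hy Ex Ey L.
  assert (A1 := hinc (1 + x') (1 + y') ltac:(lra)).
  assert (A2 := hinc (1 - y') (1 - x') ltac:(lra)). nra. }
intros Ha Hx Hy Ex Ey; apply hdiv in Ex; [|lra]; apply hdiv in Ey; [|lra].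
destruct (Rtotal_order x y) as [L|[L|L]]; auto; exfalso.
- exact (W al x y Ha Hx Hy Ex Ey L).
- exact (W al y x Ha Hy Hx Ey Ex L).
Qed.

(** * The value at exp (- pi sqrt 343) *)

(** As a a' + b b' = 1, the difference w gives 2 a a' = 1 + w and 2 b b' = 1 - w, and a b = 1/2
    gives a' b' = (1 - w^2) / 2. Inserting this in a'^8 + b'^8 = 1 yields the equation of
    [pow_sum_unique] with al = b^8; it remains to exhibit a root w0 in (0, 1) with w0^2 = 1 -
    g^3. *)
Lemma k_root4_343 g :
  0 < g < / 7 -> g ^ 7 = 1 - 7 * g - 7 * g ^ 2 - 7 * g ^ 3 ->
  k_root4 (PI * sqrt 343) * k'_root4 (PI * sqrt 343) = g ^ 3 / 2.
Proof.
intros Hg H7; assert (HPI := PI2_3_2).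
assert (S7 : 264 / 100 <= sqrt 7).
{ rewrite <- (sqrt_square (264 / 100)) by lra; apply sqrt_le_1; lra. }
assert (Q7 : sqrt 7 * sqrt 7 = 7) by (apply sqrt_sqrt; lra).
replace (sqrt 343) with (7 * sqrt 7).
2:{ rewrite <- (sqrt_square 7) at 1 by lra; rewrite <- sqrt_mult by lra; f_equal; ring. }
replace (PI * (7 * sqrt 7)) with (7 * (PI * sqrt 7)) by ring.
assert (K1 := k_root4_sqrt7).
set (c := PI * sqrt 7) in *.
assert (Hc : 79 / 10 <= c) by (unfold c; nra).
clearbody c.
assert (L1 := k_root4_lt c Hc); assert (L2 := k_root4_lt (7 * c) ltac:(lra)).
assert (C1 := k_root4_complement c ltac:(lra)).
assert (C2 := k_root4_complement (7 * c) ltac:(lra)).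
assert (M := k_root4_septic c ltac:(lra)).
assert (P1 := k_root4_pos c ltac:(lra)); assert (P2 := k_root4_pos (7 * c) ltac:(lra)).
set (b := k_root4 c) in *; set (a := k'_root4 c) in *.
set (b' := k_root4 (7 * c)) in *; set (a' := k'_root4 (7 * c)) in *.
clearbody a b a' b'.
set (w := a * a' - b * b').
assert (Ew : (1 - w ^ 2) / 2 = a' * b').
{ unfold w; transitivity (((a * a' + b * b') ^ 2 - (a * a' - b * b') ^ 2) / 2).
  - rewrite Rplus_comm in M; rewrite M; field.
  - transitivity (2 * (b * a) * (a' * b')); [field|rewrite K1; field]. }
set (al := b ^ 8).
assert (Hal : 1 - al = a ^ 8) by (unfold al; lra).
assert (Pab : al * (1 - al) = / 256).
{ rewrite Hal; unfold al; rewrite <- Rpow_mult_distr, K1; field. }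
assert (Lab : al < 1 - al) by (rewrite Hal; apply (pow_lt_compat b a 7); lra).
assert (al0 : 0 < al) by (now apply pow_lt).
assert (Hw : 0 < w < 1).
{ unfold w; split; [|nra]. assert (b * b' < a * a'); [|lra].
  apply Rmult_gt_0_lt_compat; lra. }
assert (Fw : al * ((1 + w) ^ 8 - 1) = (1 - al) * (1 - (1 - w) ^ 8)).
{ replace (1 + w) with (2 * (a * a')) by (unfold w; lra).
  replace (1 - w) with (2 * (b * b')) by (unfold w; lra).
  rewrite !Rpow_mult_distr, <- Hal; fold al.
  assert (2 ^ 8 * (al * (1 - al)) * (a' ^ 8 + b' ^ 8) = 1) by (rewrite Pab, Rplus_comm, C2; field).
  lra. }
(* The positive square root of (1 - g^3) / 7, which happens to lie in Q(g). *)
set (om := (8 - 4 * g ^ 2 - 4 * g ^ 3 + g ^ 5 - g ^ 6) / 21).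
assert (Eom : 7 * om ^ 2 = 1 - g ^ 3).
{ apply Rmult_eq_reg_l with 63; [|lra].
  transitivity ((8 - 4 * g ^ 2 - 4 * g ^ 3 + g ^ 5 - g ^ 6) ^ 2); [unfold om; field|ring [H7]]. }
assert (om0 : 0 < om).
{ assert (0 < g ^ 5) by (apply pow_lt; lra).
  assert (g ^ 2 < 1) by nra. assert (g ^ 3 < 1) by nra.
  assert (g ^ 6 < 1) by (replace (g ^ 6) with (g ^ 3 * g ^ 3) by ring; assert (0 < g ^ 3) by (apply pow_lt; lra); nra).
  unfold om; nra. }
(* The equation for w0 after division by w0, sorted by parity of the exponents: by Hal2 both sides
   carry one factor sqrt 7, which is removed here. *)
assert (Eo7 : om * (28 + 70 * (1 - g ^ 3) + 28 * (1 - g ^ 3) ^ 2 + (1 - g ^ 3) ^ 3) =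
  3 * (1 + 7 * (1 - g ^ 3) + 7 * (1 - g ^ 3) ^ 2 + (1 - g ^ 3) ^ 3)).
{ apply Rmult_eq_reg_l with 21; [|lra].
  transitivity ((8 - 4 * g ^ 2 - 4 * g ^ 3 + g ^ 5 - g ^ 6) *
    (28 + 70 * (1 - g ^ 3) + 28 * (1 - g ^ 3) ^ 2 + (1 - g ^ 3) ^ 3)); [unfold om; field|ring [H7]]. }
set (w0 := sqrt 7 * om).
assert (Ew0 : w0 ^ 2 = 1 - g ^ 3).
{ unfold w0; rewrite Rpow_mult_distr; replace (sqrt 7 ^ 2) with 7 by lra; exact Eom. }
assert (w00 : 0 < w0) by (apply Rmult_lt_0_compat; lra).
assert (g3 : 0 < g ^ 3) by (apply pow_lt; lra).
assert (Hw0 : 0 < w0 < 1) by (split; [auto|nra]).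
(* al (1 - al) = 1/256 gives (1 - 2 al)^2 = 63/64, and al < 1 - al fixes the sign. *)
assert (Hal2 : 8 * (1 - 2 * al) = 3 * sqrt 7).
{ apply pow_eq_inv with 1%nat; [lra|lra|].
  rewrite !Rpow_mult_distr; replace (sqrt 7 ^ 2) with 7 by lra.
  replace ((1 - 2 * al) ^ 2) with (1 - 4 * (al * (1 - al))) by ring.
  rewrite Pab; field. }
assert (Fw0 : al * ((1 + w0) ^ 8 - 1) = (1 - al) * (1 - (1 - w0) ^ 8)).
{ assert (X : w0 * (28 + 70 * w0 ^ 2 + 28 * (w0 ^ 2) ^ 2 + (w0 ^ 2) ^ 3) =
    8 * (1 - 2 * al) * (1 + 7 * w0 ^ 2 + 7 * (w0 ^ 2) ^ 2 + (w0 ^ 2) ^ 3)).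
  { rewrite Hal2, Ew0; unfold w0; rewrite Rmult_assoc, Eo7; ring. }
  apply Rminus_diag_uniq.
  transitivity (w0 * (w0 * (28 + 70 * w0 ^ 2 + 28 * (w0 ^ 2) ^ 2 + (w0 ^ 2) ^ 3) -
    8 * (1 - 2 * al) * (1 + 7 * w0 ^ 2 + 7 * (w0 ^ 2) ^ 2 + (w0 ^ 2) ^ 3))); [ring|].
  rewrite X; ring. }
assert (E : w = w0) by (apply (pow_sum_unique al); auto; lra).
rewrite E, Ew0 in Ew; lra.
Qed.

Lemma class_invariant_343_value g :
  0 < g < / 7 -> g ^ 7 = 1 - 7 * g - 7 * g ^ 2 - 7 * g ^ 3 ->
  class_invariant 343 = Rpower 2 (1/4) / g.
Proof.
intros Hg H7; assert (HPI := PI_RGT_0).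
assert (S0 : 0 < sqrt 343) by (apply sqrt_lt_R0; lra).
assert (K := k_root4_343 g Hg H7).
unfold class_invariant; replace (- PI * sqrt 343) with (- (PI * sqrt 343)) by ring.
set (c := PI * sqrt 343) in *; assert (Hc : 0 < c) by (apply Rmult_lt_0_compat; auto).
assert (X := chi_k_root4 c Hc); rewrite K in X.
destruct (chi_lim (exp (- c)) (exp_opp_lt_1 c Hc)) as [_ chi1].
cbv zeta; set (x := chi (exp (- c))) in *.
assert (R2 : forall y, 0 < Rpower 2 y) by (intro; apply exp_pos).
(* Sixth powers are compared, because [chi_k_root4] determines the sixth power of chi. *)
apply pow_eq_inv with 5%nat.
- left; repeat apply Rmult_lt_0_compat; try apply exp_pos; lra.
- left; apply Rdiv_lt_0_compat; [apply exp_pos|lra].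
- replace ((Rpower 2 (1 / 4) / g) ^ 6) with (Rpower 2 (1 / 4) ^ 6 / g ^ 6) by (field; lra).
  rewrite !Rpow_mult_distr.
  assert (E1 : Rpower (exp (- c)) (-1 / 24) ^ 6 = exp (c / 4)).
  { unfold Rpower; rewrite ln_exp, exp_pow; f_equal; simpl; field. }
  assert (E2 : Rpower 2 (-1 / 4) ^ 6 * 8 = Rpower 2 (1 / 4) ^ 6).
  { rewrite <- !Rpower_pow, !Rpower_mult by auto.
    replace 8 with (Rpower 2 3) by (replace 3 with (INR 3) by (simpl; ring); rewrite Rpower_pow by lra; ring).
    rewrite <- Rpower_plus; f_equal; simpl; field. }
  rewrite E1, <- E2.
  rewrite exp_Ropp in X.
  assert (0 < exp (c / 4)) by apply exp_pos.
  assert (X6 : x ^ 6 = 8 * / exp (c / 4) / g ^ 6).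
  { apply Rmult_eq_reg_l with ((g ^ 3 / 2) ^ 2); [|apply Rgt_not_eq, pow_lt, Rdiv_lt_0_compat; [apply pow_lt|]; lra].
    rewrite X; field; lra. }
  rewrite X6; field; lra.
Qed.

Theorem theorem5p1 :
  forall m s p : R,
  m = Rpower 7 (3/2) *
      powerRZ (1 + Rpower (cos (PI/7) / (2 * cos (2 * PI / 7) ^ 2)) (2/7)
                 + Rpower (cos (2 * PI / 7) / (2 * cos (3 * PI / 7) ^ 2)) (2/7)
                 + Rpower (cos (3 * PI / 7) / (2 * cos (PI/7) ^ 2)) (2/7)) (-2) ->
  s = 12 * m ^ 2 *
      (9 * (7 - m ^ 2) + sqrt 3 * sqrt (27 * (m ^ 4 + 49) + 122 * m ^ 2)) ->
  p = 1 + 10 * m ^ 2 / Rpower s (1/3) - Rpower s (1/3) / 6 ->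
  class_invariant 343 = Rpower 2 (1/4) * Rpower p (-1/7).
Proof.
intros m s p Hm Hs Hp.
destruct septic_unit as [g [Hg H7]].
rewrite (class_invariant_343_value g Hg H7), (p_value m s p g Hg H7 Hm Hs Hp).
unfold Rdiv at 1; f_equal.
rewrite <- (Rpower_pow 7 g), Rpower_mult by lra.
replace (INR 7 * (-1 / 7)) with (- (1)) by (simpl; field).
now rewrite Rpower_Ropp, Rpower_1 by lra.
Qed.
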